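(* Let $H$ be a Hopf algebra over $\mathbb{C}$ with bijective antipode, $A$ a left $H$-module algebra, $B$ a left $H$-comodule algebra, and $(N,\mathcal{M})$ a not necessarily compatible pair consisting of a right-left SAYD module $N$ and a left-right SAYD contramodule $\mathcal{M}$ over $H$. Let $A\rtimes B$ be the crossed product algebra, and let $L(N,\mathcal{M})$ be the vector space and $\tilde\Phi$, $\overline{AW}$ the maps defined in the context. Then for all $p,q\ge0$ the map $\tilde\Phi\circ\overline{AW}$ defines a cup product on cyclic cohomology, i.e. $[\psi]\otimes[\phi]\mapsto[\tilde\Phi(\overline{AW}(\psi\otimes\phi))]$ is a well-defined linear map $$\tilde\Phi\circ\overline{AW}:{}^H\!HC^p(B,N)\otimes HC^q_H(A,\mathcal{M})\to HC^{p+q}(A\rtimes B,L(N,\mathcal{M})).$$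
   Context: All algebras are unital, associative and over $\mathbb{C}$, $\otimes=\otimes_{\mathbb{C}}$, $\operatorname{Hom}$ denotes linear maps, $\operatorname{Hom}_H$ left $H$-linear maps and ${}^H\!\operatorname{Hom}$ left $H$-colinear maps. $H$ is a Hopf algebra with $\Delta(h)=h_{(1)}\otimes h_{(2)}$, counit $\varepsilon$, bijective antipode $S$. Left $H$-module algebra $A$: $h\cdot(ab)=(h_{(1)}\cdot a)(h_{(2)}\cdot b)$, $h\cdot1=\varepsilon(h)1$; $A^{\otimes n+1}$ carries the diagonal action. Left $H$-comodule algebra $B$: an algebra with left coaction $b\mapsto b_{<-1>}\otimes b_{<0>}$ that is multiplicative, $(bb')_{<-1>}\otimes(bb')_{<0>}=b_{<-1>}b'_{<-1>}\otimes b_{<0>}b'_{<0>}$, and unital. Iterated coactions are written $b_{<-k>}\otimes\cdots\otimes b_{<-1>}\otimes b_{<0>}$. $B^{\otimes n+1}$ has the coaction $b^0\otimes\cdots\otimes b^n\mapsto b^0_{<-1>}\cdots b^n_{<-1>}\otimes b^0_{<0>}\otimes\cdots\otimes b^n_{<0>}$. The crossed product $A\rtimes B$ is the vector space $A\otimes B$ (elements $a\rtimes b$), with unit $1\rtimes1$ and product $(a\rtimes b)(a'\rtimes b')=a(b_{<-1>}\cdot a')\rtimes b_{<0>}b'$. Right-left SAYD module $N$: right $H$-module and left $H$-comodule, coaction $n\mapsto n_{<-1>}\otimes n_{<0>}$, such that the coaction of $n\cdot h$ is $S(h_{(3)})n_{<-1>}h_{(1)}\otimes n_{<0>}\cdot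 h_{(2)}$ and $n_{<0>}\cdot n_{<-1>}=n$. A right $H$-contramodule is a vector space $\mathcal{M}$ with linear $\alpha:\operatorname{Hom}(H,\mathcal{M})\to\mathcal{M}$ with $\alpha(h\mapsto\alpha(F(h)))=\alpha(h\mapsto F(h_{(1)})(h_{(2)}))$ for $F\in\operatorname{Hom}(H,\operatorname{Hom}(H,\mathcal{M}))$ and $\alpha(h\mapsto\varepsilon(h)m)=m$. A left-right SAYD contramodule is a left $H$-module and right $H$-contramodule with $h\cdot\alpha(f)=\alpha(h_{(2)}\cdot f(S(h_{(3)})(-)h_{(1)}))$ and $\alpha(h\mapsto h\cdot m)=m$. The pair $(N,\mathcal{M})$ would be called compatible if there were a bilinear pairing $\langle\cdot\mid\cdot\rangle:N\times\mathcal{M}\to\mathbb{C}$ with $\langle n\cdot h\mid m\rangle=\langle n\mid h\cdot m\rangle$ and $\langle n\mid\alpha(f)\rangle=\langle n_{<0>}\mid f(n_{<-1>})\rangle$; no such pairing is assumed here. $L(N,\mathcal{M})$ is the coequalizer (a vector space) of the two maps $N\otimes_H\operatorname{Hom}(H,\mathcal{M})\rightrightarrows N\otimes_H\mathcal{M}$, $n\otimes f\mapsto n\otimes\alpha(f)$ and $n\otimes f\mapsto n_{<0>}\otimes f(n_{<-1>})$, where $H$ acts on $\operatorname{Hom}(H,\mathcal{M})$ by $(h\cdot f)(x)=h_{(2)}\cdot f(S(h_{(3)})xh_{(1)})$. The class of $n\otimes m$ in $L(N,\mathcal{M})$ is written $n\otimes_Hm$. Cocyclic module $\operatorname{Hom}_H(A^{\otimes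 n+1},\mathcal{M})$, with cyclic cohomology $HC^*_H(A,\mathcal{M})$: $(\partial_i\varphi)(a^0\otimes\cdots\otimes a^{n+1})=\varphi(a^0\otimes\cdots\otimes a^ia^{i+1}\otimes\cdots\otimes a^{n+1})$, $0\le i\le n$; $(\partial_{n+1}\varphi)(a^0\otimes\cdots\otimes a^{n+1})=\alpha(\varphi((S^{-1}(-)\cdot a^{n+1})a^0\otimes a^1\otimes\cdots\otimes a^n))$; $(\sigma_j\varphi)(a^0\otimes\cdots\otimes a^{n-1})=\varphi(a^0\otimes\cdots\otimes a^j\otimes1\otimes a^{j+1}\otimes\cdots\otimes a^{n-1})$, $0\le j\le n-1$; $(\tau\varphi)(a^0\otimes\cdots\otimes a^n)=\alpha(\varphi(S^{-1}(-)\cdot a^n\otimes a^0\otimes\cdots\otimes a^{n-1}))$. Cocyclic module ${}^H\!\operatorname{Hom}(B^{\otimes n+1},N)$, with cyclic cohomology ${}^H\!HC^*(B,N)$: $(\partial_i\psi)(b^0\otimes\cdots\otimes b^{n+1})=\psi(b^0\otimes\cdots\otimes b^ib^{i+1}\otimes\cdots\otimes b^{n+1})$, $0\le i\le n$; $(\partial_{n+1}\psi)(b^0\otimes\cdots\otimes b^{n+1})=\psi(b^{n+1}_{<0>}b^0\otimes b^1\otimes\cdots\otimes b^n)\cdot b^{n+1}_{<-1>}$; $(\sigma_j\psi)(b^0\otimes\cdots\otimes b^{n-1})=\psi(b^0\otimes\cdots\otimes b^j\otimes1\otimes\cdots\otimes b^{n-1})$, $0\le j\le n-1$; $(\tau\psi)(b^0\otimes\cdots\otimes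 b^n)=\psi(b^n_{<0>}\otimes b^0\otimes\cdots\otimes b^{n-1})\cdot b^n_{<-1>}$. Cyclic cohomology. For a cocyclic module $X$, let $X_{norm}$ be the elements killed by all codegeneracies, $b=\sum_{i=0}^{n+1}(-1)^i\partial_i$ and $B=\big(\sum_{i=0}^{n-1}(-1)^{(n-1)i}\tau^i\big)\sigma_{n-1}\tau$ on $X^n$ (this operator $B$ is not to be confused with the algebra $B$). For a mixed complex $(X,b,B)$ ($b$ of degree $+1$, $B$ of degree $-1$), $HC^n$ is the $n$-th cohomology of the complex with $n$-th term $\bigoplus_{i\ge0}X^{n-2i}$ and differential $b+B$; for a cocyclic module one uses $X_{norm}$ (this agrees with the cohomology of the cyclic cochains $\tau\phi=(-1)^n\phi$ with differential $b$). For a unital algebra $R$ and a vector space $L$, $HC^*(R,L)$ is the cyclic cohomology of the ordinary cocyclic module $\operatorname{Hom}(R^{\otimes n+1},L)$ (inner cofaces multiply adjacent entries, last coface $\varphi(r^{n+1}r^0\otimes r^1\otimes\cdots\otimes r^n)$, codegeneracies insert $1$, $(\tau\varphi)(r^0\otimes\cdots\otimes r^n)=\varphi(r^n\otimes r^0\otimes\cdots\otimes r^{n-1})$). Bicocyclic module. $C^{r,s}={}^H\!\operatorname{Hom}(B^{\otimes r+1},N)\otimes\operatorname{Hom}_H(A^{\otimes s+1},\mathcal{M})$, with vertical structure ($\partial_i^v=\partial_i\otimes\mathrm{Id}$, etc., degree $r$) and horizontal structure ($\partial_i^h=\mathrm{Id}\otimes\partial_i$, etc., degree $s$). Its diagonal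 $D$ is the cocyclic module $D^n=C^{n,n}$ with structure maps $\partial_i\otimes\partial_i$, $\sigma_j\otimes\sigma_j$, $\tau\otimes\tau$. $\operatorname{Tot}$ is the normalized total mixed complex, $\operatorname{Tot}^n=\bigoplus_{r+s=n}$ of the elements of $C^{r,s}$ killed by all vertical and horizontal codegeneracies, with $b_T=b^h+(-1)^sb^v$ and $B_T=B^h+(-1)^sB^v$ on bidegree $(r,s)$. The Alexander-Whitney map $AW:\operatorname{Tot}^n\to D^n$ is, on bidegree $(r,s)$ with $n=r+s$, $AW_{r,s}=(\partial_0^v)^s\,\partial_n^h\partial_{n-1}^h\cdots\partial_{s+1}^h$. By the cyclic Eilenberg-Zilber theorem it extends to an $S$-map $\overline{AW}=(AW,AW')$, with $AW':\operatorname{Tot}^n\to D^{n-2}$, such that $AW+AW'$ intertwines $b_T+B_T$ with $b_D+B_D$; it induces an isomorphism $HC^n(\operatorname{Tot})\to HC^n(D)$. Fix such an $\overline{AW}$. If $\psi=\sum_i\psi_{p-2i}$ and $\phi=\sum_j\phi_{q-2j}$ are normalized $(b,B)$-cocycles representing classes in ${}^H\!HC^p(B,N)$ and $HC^q_H(A,\mathcal{M})$, then $\psi\otimes\phi=\sum_{i,j}\psi_{p-2i}\otimes\phi_{q-2j}$ denotes the resulting cocycle of degree $p+q$ for $\operatorname{Tot}$. $\tilde\Phi:D^n\to\operatorname{Hom}((A\rtimes B)^{\otimes n+1},L(N,\mathcal{M}))$ is $\tilde\Phi(\psi\otimes\phi)(a^0\rtimes b^0\otimes\cdots\otimes a^n\rtimes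 b^n)=\psi(b^0_{<0>}\otimes\cdots\otimes b^n_{<0>})\otimes_H\phi(x_0\otimes\cdots\otimes x_n)$ with $x_k=S^{-1}(b^k_{<-k-1>}b^{k+1}_{<-k-1>}\cdots b^n_{<-k-1>})\cdot a^k$. *)

(* Defs.v *)
From HB Require Import structures.
From mathcomp Require Import all_boot all_order all_algebra.
From mathcomp Require Import generic_quotient ring_quotient boolp functions reals complex.
From mathcomp Require Import freeg zify.

Set Implicit Arguments.
Unset Strict Implicit.
Unset Printing Implicit Defensive.

Import GRing.Theory.
Local Open Scope ring_scope.

(* Associative unital algebras.  MathComp's algType excludes the zero algebra,
   which is allowed for module and comodule algebras. *)
HB.mixin Record Lmodule_isUAlgebra (K : pzRingType) A of GRing.Lmodule K A := {
  amul : A -> A -> A;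
  aone : A;
  amulA : associative amul;
  amul1l : left_id aone amul;
  amul1r : right_id aone amul;
  amul_linl : forall y, linear (amul^~ y);
  amul_linr : forall x, linear (amul x)
}.

#[short(type="ualgType")]
HB.structure Definition UAlgebra (K : pzRingType) :=
  {A of Lmodule_isUAlgebra K A & GRing.Lmodule K A}.

Notation "x ** y" := (amul x y) (at level 40, left associativity) : ring_scope.

HB.instance Definition _ (K : pzRingType) (A : ualgType K) :=
  Monoid.isLaw.Build A aone amul amulA amul1l amul1r.

Section Families.
Variables (K : pzRingType) (I : Type) (X : I -> lmodType K).

Definition fam := forall i, X i.

HB.instance Definition _ := Choice.copy fam (forall i, X i).

Definition fam_add (f g : fam) : fam := fun i => f i + g i.
Definition fam_zero : fam := fun=> 0.
Definition fam_opp (f : fam) : fam := fun i => - f i.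
Definition fam_scale (k : K) (f : fam) : fam := fun i => k *: f i.

Fact fam_addA : associative fam_add.
Proof. by move=> f g h; apply: functional_extensionality_dep => i; apply: addrA. Qed.
Fact fam_addC : commutative fam_add.
Proof. by move=> f g; apply: functional_extensionality_dep => i; apply: addrC. Qed.
Fact fam_add0 : left_id fam_zero fam_add.
Proof. by move=> f; apply: functional_extensionality_dep => i; apply: add0r. Qed.
Fact fam_addN : left_inverse fam_zero fam_opp fam_add.
Proof. by move=> f; apply: functional_extensionality_dep => i; apply: addNr. Qed.

HB.instance Definition _ :=
  GRing.isZmodule.Build fam fam_addA fam_addC fam_add0 fam_addN.

Fact fam_scaleA a b (f : fam) : fam_scale a (fam_scale b f) = fam_scale (a * b) f.
Proof. by apply: functional_extensionality_dep => i; apply: scalerA. Qed.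
Fact fam_scale1 : left_id 1 fam_scale.
Proof. by move=> f; apply: functional_extensionality_dep => i; apply: scale1r. Qed.
Fact fam_scaleDr : right_distributive fam_scale +%R.
Proof. by move=> a f g; apply: functional_extensionality_dep => i; apply: scalerDr. Qed.
Fact fam_scaleDl (f : fam) : {morph fam_scale^~ f : a b / a + b}.
Proof. by move=> a b; apply: functional_extensionality_dep => i; apply: scalerDl. Qed.

HB.instance Definition _ := GRing.Zmodule_isLmodule.Build K fam
  fam_scaleA fam_scale1 fam_scaleDr fam_scaleDl.

Lemma fam_DE (f g : fam) i : (f + g) i = f i + g i. Proof. by []. Qed.
Lemma fam_ZE k (f : fam) i : (k *: f) i = k *: f i. Proof. by []. Qed.
Lemma fam_0E i : (0 : fam) i = 0. Proof. by []. Qed.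
End Families.

Section Subspaces.
Variables (K : pzRingType) (V : lmodType K) (S : submodClosed V).

Record subm := Subm { subm_val : V; _ : subm_val \in S }.

HB.instance Definition _ := [isSub for subm_val].
HB.instance Definition _ := [Choice of subm by <:].
HB.instance Definition _ := [SubChoice_isSubLmodule of subm by <:].
End Subspaces.

Section Quotients.
Variables (K : pzRingType) (V : lmodType K) (P : V -> Prop).

Inductive spanned : V -> Prop :=
| Spanned0 : spanned 0
| SpannedS a x y : P x -> spanned y -> spanned (a *: x + y).

Definition span : {pred V} := fun x => `[< spanned x >].

Fact span_submod_closed : submod_closed span.
Proof.
split=> [|a x y /asboolP Sx /asboolP Sy]; first exact/asboolP/Spanned0.
apply/asboolP; elim: Sx => [|b u v Pu _ Sv]; first by rewrite scaler0 add0r.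
by rewrite scalerDr scalerA -addrA; apply: SpannedS.
Qed.
HB.instance Definition _ := GRing.isSubmodClosed.Build K V span
  (GRing.submod_closed_semi span_submod_closed).

Lemma span_gen x : P x -> x \in span.
Proof. by move=> Px; apply/asboolP; rewrite -[x]addr0 -[x]scale1r; apply: SpannedS => //; constructor. Qed.

Definition quotm := Quotient.quot span.
HB.instance Definition _ := GRing.Zmodule.on quotm.

Definition cls (x : V) : quotm := (\pi_(Quotient.quot span)%qT) x.

Lemma cls_eq x y : (cls x = cls y) <-> (x - y \in span).
Proof.
rewrite (Quotient.idealrBE span); split=> [e|/eqP //]; exact/eqP.
Qed.

Lemma clsK (u : quotm) : cls (repr u) = u. Proof. exact: reprK. Qed.

Lemma clsD x y : cls (x + y) = cls x + cls y.
Proof. exact: (raddfD (\pi_(Quotient.quot span)%qT)). Qed.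

Definition quotm_scale (a : K) (u : quotm) : quotm := cls (a *: repr u).

Lemma clsZ a x : cls (a *: x) = quotm_scale a (cls x).
Proof.
apply/cls_eq; rewrite -scalerBr; apply: rpredZ; apply/cls_eq.
by rewrite clsK.
Qed.

Fact quotm_scaleA a b u :
  quotm_scale a (quotm_scale b u) = quotm_scale (a * b) u.
Proof. by rewrite -[u]clsK -!clsZ scalerA. Qed.
Fact quotm_scale1 : left_id 1 quotm_scale.
Proof. by move=> u; rewrite -[u]clsK -clsZ scale1r. Qed.
Fact quotm_scaleDr : right_distributive quotm_scale +%R.
Proof.
by move=> a u v; rewrite -[u]clsK -[v]clsK -clsD -!clsZ scalerDr clsD.
Qed.
Fact quotm_scaleDl u : {morph quotm_scale^~ u : a b / a + b}.
Proof. by move=> a b; rewrite -[u]clsK -!clsZ scalerDl clsD. Qed.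

HB.instance Definition _ := GRing.Zmodule_isLmodule.Build K quotm
  quotm_scaleA quotm_scale1 quotm_scaleDr quotm_scaleDl.

Fact cls_is_linear : linear cls.
Proof. by move=> a x y; rewrite clsD clsZ. Qed.
HB.instance Definition _ := GRing.isLinear.Build K V quotm _ cls cls_is_linear.

End Quotients.

Definition bilinear_map (K : pzRingType) (U V W : lmodType K) (f : U -> V -> W) :=
  (forall y, linear (f^~ y)) /\ (forall x, linear (f x)).

Lemma linear_is (K : pzRingType) (U V : lmodType K) (f : U -> V) (Hf : linear f) :
  exists g : {linear U -> V}, g =1 f.
Proof.
pose l := GRing.isLinear.Build K U V *:%R f Hf.
by exists (HB.pack_for {linear U -> V} f l).
Qed.

Lemma linear_sum_of (K : pzRingType) (U V : lmodType K) (f : U -> V) I (r : seq I) F :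
  linear f -> f (\sum_(i <- r) F i) = \sum_(i <- r) f (F i).
Proof. by case/linear_is => g e; rewrite -e linear_sum; apply: eq_bigr => i _; rewrite e. Qed.

Lemma linearZ_of (K : pzRingType) (U V : lmodType K) (f : U -> V) a x :
  linear f -> f (a *: x) = a *: f x.
Proof. by case/linear_is => g e; rewrite -!e linearZ. Qed.

Lemma linearD_of (K : pzRingType) (U V : lmodType K) (f : U -> V) x y :
  linear f -> f (x + y) = f x + f y.
Proof. by case/linear_is => g e; rewrite -!e linearD. Qed.

Lemma linearB_of (K : pzRingType) (U V : lmodType K) (f : U -> V) x y :
  linear f -> f (x - y) = f x - f y.
Proof. by case/linear_is => g e; rewrite -!e linearB. Qed.

Lemma linear0_of (K : pzRingType) (U V : lmodType K) (f : U -> V) :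
  linear f -> f 0 = 0.
Proof. by case/linear_is => g e; rewrite -!e linear0. Qed.

(* V (x) W is the free vector space on V * W modulo the bilinearity relations. *)
Section Tensor.
Variables (K : fieldType) (V W : lmodType K).

Definition free := {freeg (V * W)%type / K}.
HB.instance Definition _ := GRing.Lmodule.on free.
Definition gen (v : V) (w : W) : free := Freeg [:: (1, (v, w))].

Variant tens_rel : free -> Prop :=
| Tens_rell k v v' w :
    tens_rel (gen (k *: v + v') w - (k *: gen v w + gen v' w))
| Tens_relr k v w w' :
    tens_rel (gen v (k *: w + w') - (k *: gen v w + gen v w')).

Definition tens := quotm tens_rel.
HB.instance Definition _ := GRing.Lmodule.on tens.

Definition pure (v : V) (w : W) : tens := cls tens_rel (gen v w).

(* A chosen list of pairs (v_i, w_i) such that t = \sum_i v_i (x) w_i. *)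
Definition terms (t : tens) : seq (V * W) :=
  [seq (coeff z (repr t : free) *: z.1, z.2) | z <- dom (repr t : free)].
End Tensor.

Notation "v \ox w" := (pure v w) (at level 40, left associativity) : ring_scope.

Section TensorTheory.
Variables (K : fieldType) (V W : lmodType K).

Lemma pure_linl (w : W) : linear (fun v : V => v \ox w).
Proof.
move=> k v v'; rewrite /pure -linearP; apply/cls_eq.
by apply: span_gen; constructor.
Qed.

Lemma pure_linr (v : V) : linear (fun w : W => v \ox w).
Proof.
move=> k w w'; rewrite /pure -linearP; apply/cls_eq.
by apply: span_gen; constructor.
Qed.

Lemma free_sum (D : free V W) :
  D = \sum_(z <- dom D) coeff z D *: gen z.1 z.2.
Proof.
rewrite -[LHS]freeg_sumE; apply: eq_bigr => -[v w] _; rewrite /gen.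
apply/eqP/freeg_eqP => x /=.
by rewrite coeffZ !coeffU mul1r.
Qed.

Lemma terms_sum (t : tens V W) : \sum_(p <- terms t) p.1 \ox p.2 = t.
Proof.
rewrite -[RHS]clsK [in RHS](free_sum (repr t)) linear_sum /terms big_map.
by apply: eq_bigr => -[v w] _ /=; rewrite linearZ (linearZ_of _ _ (pure_linl _)).
Qed.

Variables (U : lmodType K) (f : V -> W -> U).
Hypothesis fbil : bilinear_map f.

Let F : free V W -> U := fglift (fun p => f p.1 p.2).

Let F_lin : linear F.
Proof.
have FD x y : F (x + y) = F x + F y.
  have FB := lift_is_additive (fun p : V * W => f p.1 p.2).
  have F0 : F 0 = 0 by rewrite /F -(subrr (0 : free V W)) FB subrr.
  have FN z : F (- z) = - F z by rewrite -[- z]sub0r /F FB -/(F 0) F0 sub0r.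
  by rewrite -{1}[y]opprK /F FB -!/(F _) FN opprK.
have FZ a x : F (a *: x) = a *: F x.
  have F0 : F 0 = 0 by apply: (@addrI _ (F 0)); rewrite -FD !addr0.
  have Fs I (r : seq I) (G : I -> free V W) :
      F (\sum_(i <- r) G i) = \sum_(i <- r) F (G i).
    by elim/big_rec2: _ => // i y1 y2 _ <-; rewrite FD.
  rewrite (free_sum x) scaler_sumr !Fs scaler_sumr; apply: eq_bigr => -[v w] _ /=.
  have gE c : c *: gen v w = Freeg [:: (c, (v, w))].
    by apply/eqP/freeg_eqP => z /=; rewrite coeffZ !coeffU mul1r.
  by rewrite scalerA !gE /F !liftU scalerA.
by move=> a x y; rewrite FD FZ.
Qed.

Let F_gen v w : F (gen v w) = f v w.
Proof. by rewrite /F /gen liftU scale1r. Qed.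

Let F_rel x : x \in span (@tens_rel K V W) -> F x = 0.
Proof.
move/asboolP; elim=> [|a u v Ru _ Fv]; first exact: (linear0_of F_lin).
rewrite F_lin Fv addr0.
suff -> : F u = 0 by rewrite scaler0.
case: Ru => k v1 v2 v3; rewrite (linearB_of _ _ F_lin) F_lin !F_gen.
  by rewrite (fbil.1 v3) subrr.
by rewrite (fbil.2 v1) subrr.
Qed.

Let termsF (t : tens V W) : \sum_(p <- terms t) f p.1 p.2 = F (repr t).
Proof.
rewrite [in RHS](free_sum (repr t)) (linear_sum_of _ _ F_lin) /terms big_map.
apply: eq_bigr => -[v w] _ /=.
by rewrite (linearZ_of _ _ F_lin) F_gen (linearZ_of _ _ (fbil.1 w)).
Qed.

Lemma terms_pure v w : \sum_(p <- terms (v \ox w)) f p.1 p.2 = f v w.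
Proof.
rewrite termsF -F_gen; apply/eqP; rewrite -subr_eq0 -(linearB_of _ _ F_lin); apply/eqP.
apply: F_rel; apply/cls_eq; exact: clsK.
Qed.

Lemma terms_lin : linear (fun t : tens V W => \sum_(p <- terms t) f p.1 p.2).
Proof.
move=> a x y; rewrite !termsF -F_lin; apply/eqP.
rewrite -subr_eq0 -(linearB_of _ _ F_lin); apply/eqP.
apply: F_rel; apply/cls_eq.
by rewrite clsK cls_is_linear !clsK.
Qed.
End TensorTheory.

Section TensorMap.
Variables (K : fieldType) (U U' V V' : lmodType K).
Variables (f : {linear U -> U'}) (g : {linear V -> V'}).

Definition tmap (t : tens U V) : tens U' V' := \sum_(p <- terms t) f p.1 \ox g p.2.

Lemma tmap_bil : bilinear_map (fun u v => f u \ox g v).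
Proof.
by split=> x a u v /=; rewrite linearP; [apply: pure_linl|apply: pure_linr].
Qed.

Fact tmap_is_linear : linear tmap. Proof. exact: terms_lin tmap_bil. Qed.
HB.instance Definition _ :=
  GRing.isLinear.Build K (tens U V) (tens U' V') *:%R tmap tmap_is_linear.

Lemma tmap_pure u v : tmap (u \ox v) = f u \ox g v.
Proof. exact: terms_pure tmap_bil _ _. Qed.
End TensorMap.

(* Hom(U, V) as a vector space. *)
Section Hom.
Variables (K : fieldType) (U V : lmodType K).

Definition linear_pred : {pred U -> V} := fun f => `[< linear f >].
Fact linear_pred_submod : submod_closed linear_pred.
Proof.
split=> [|a f g /asboolP lf /asboolP lg]; apply/asboolP => k x y.
  by rewrite scaler0 addr0.
change (a *: f (k *: x + y) + g (k *: x + y) = k *: (a *: f x + g x) + (a *: f y + g y)).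
by rewrite lf lg !scalerDr !scalerA [a * k]mulrC addrACA.
Qed.
HB.instance Definition _ := GRing.isSubmodClosed.Build K (U -> V) linear_pred
  (GRing.submod_closed_semi linear_pred_submod).

Definition hom := subm linear_pred.
HB.instance Definition _ := SubType.on hom.
HB.instance Definition _ := GRing.Lmodule.on hom.

Definition hom_fun (f : hom) : U -> V := subm_val f.
Coercion hom_fun : hom >-> Funclass.

(* The element x |-> f x of Hom(U, V); only used for linear f. *)
Definition mkhom (f : U -> V) : hom := insubd (0 : hom) f.

Lemma hom_linear (f : hom) : linear f.
Proof. by case: f => f /= /asboolP. Qed.

Lemma mkhomE (f : U -> V) : linear f -> mkhom f =1 f.
Proof. by move=> lf x; rewrite /mkhom /hom_fun insubdK //; apply/asboolP. Qed.

Lemma homP (f g : hom) : f =1 g -> f = g.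
Proof. by move=> e; apply/val_inj/funext. Qed.

Lemma hom_linE a (f g : hom) x : (a *: f + g : hom) x = a *: f x + g x.
Proof. by []. Qed.

Lemma mkhom_lin a (f g : U -> V) : linear f -> linear g ->
  mkhom (fun x => a *: f x + g x) = a *: mkhom f + mkhom g.
Proof.
move=> lf lg; apply: homP => x; rewrite hom_linE !mkhomE // => k u v.
by rewrite lf lg !scalerDr !scalerA [a * k]mulrC addrACA.
Qed.
End Hom.

(* n-multilinear maps, i.e. Hom(V^{(x) n}, M); f v is the value of f on
   v 0 (x) ... (x) v (n-1). *)
Section Multilinear.
Variables (K : fieldType) (n : nat) (V M : lmodType K).

Definition upd (v : 'I_n -> V) (i : 'I_n) (x : V) : 'I_n -> V :=
  fun j => if j == i then x else v j.

Definition multilin_pred : {pred ('I_n -> V) -> M} :=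
  fun f => `[< forall v i, linear (fun x => f (upd v i x)) >].
Fact multilin_pred_submod : submod_closed multilin_pred.
Proof.
split=> [|a f g /asboolP lf /asboolP lg]; apply/asboolP => v i k x y.
  by rewrite scaler0 addr0.
change (a *: f (upd v i (k *: x + y)) + g (upd v i (k *: x + y)) =
  k *: (a *: f (upd v i x) + g (upd v i x)) + (a *: f (upd v i y) + g (upd v i y))).
by rewrite lf lg !scalerDr !scalerA [a * k]mulrC addrACA.
Qed.
HB.instance Definition _ := GRing.isSubmodClosed.Build K (('I_n -> V) -> M)
  multilin_pred (GRing.submod_closed_semi multilin_pred_submod).

Definition mult := subm multilin_pred.
HB.instance Definition _ := SubType.on mult.
HB.instance Definition _ := GRing.Lmodule.on mult.

Definition mult_fun (f : mult) : ('I_n -> V) -> M := subm_val f.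
Coercion mult_fun : mult >-> Funclass.

Lemma mult_lin (f : mult) v i : linear (fun x => f (upd v i x)).
Proof. by case: f => f /= /asboolP. Qed.

Lemma multP (f g : mult) : (forall v, f v = g v) -> f = g.
Proof. by move=> e; apply/val_inj/funext. Qed.

Lemma mult_linE a (f g : mult) v : (a *: f + g : mult) v = a *: f v + g v.
Proof. by []. Qed.
End Multilinear.

Section Hopf.
Variables (K : fieldType) (H : ualgType K).

(* A Hopf algebra structure with bijective antipode.  As in all formulas below,
   a sum over terms (Delta h) is the Sweedler sum over h_(1) (x) h_(2). *)
Record hopf := Hopf {
  Delta : {linear H -> tens H H};
  counit : {scalar H};
  antip : {linear H -> H};
  antipV : H -> H;
  antipK : cancel antip antipV;
  antipVK : cancel antipV antip;
  DeltaM : forall g h, Delta (g ** h) =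
    \sum_(p <- terms (Delta g)) \sum_(q <- terms (Delta h))
      (p.1 ** q.1) \ox (p.2 ** q.2);
  Delta1 : Delta aone = aone \ox aone;
  counitM : forall g h, counit (g ** h) = counit g * counit h;
  counit1 : counit aone = 1;
  DeltaA : forall h,
    \sum_(p <- terms (Delta h)) \sum_(q <- terms (Delta p.1))
      q.1 \ox (q.2 \ox p.2) =
    \sum_(p <- terms (Delta h)) \sum_(q <- terms (Delta p.2))
      p.1 \ox (q.1 \ox q.2);
  counitl : forall h, \sum_(p <- terms (Delta h)) counit p.1 *: p.2 = h;
  counitr : forall h, \sum_(p <- terms (Delta h)) counit p.2 *: p.1 = h;
  antipl : forall h,
    \sum_(p <- terms (Delta h)) antip p.1 ** p.2 = counit h *: aone;
  antipr : forall h,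
    \sum_(p <- terms (Delta h)) p.1 ** antip p.2 = counit h *: aone
}.

Variable hH : hopf.

(* Iterated coproduct: a sum over u <- sw n h is the Sweedler sum over
   h_(1) (x) ... (x) h_(n+1), where u`_i stands for h_(i+1). *)
Fixpoint sw (n : nat) (h : H) : seq (seq H) :=
  if n is m.+1 then [seq p.1 :: u | p <- terms (Delta hH h), u <- sw m p.2]
  else [:: [:: h]].

Record left_action (V : lmodType K) (act : H -> V -> V) := LeftAction {
  lact_bil : bilinear_map act;
  lact1 : forall v, act aone v = v;
  lactM : forall g h v, act (g ** h) v = act g (act h v)
}.

Record right_action (V : lmodType K) (act : V -> H -> V) := RightAction {
  ract_bil : bilinear_map act;
  ract1 : forall v, act v aone = v;
  ractM : forall v g h, act v (g ** h) = act (act v g) h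
}.

(* A sum over terms (rho v) is the sum over v_<-1> (x) v_<0>. *)
Record left_coaction (V : lmodType K) (rho : V -> tens H V) := LeftCoaction {
  coact_lin : linear rho;
  coactA : forall v,
    \sum_(p <- terms (rho v)) \sum_(q <- terms (Delta hH p.1))
      q.1 \ox (q.2 \ox p.2) =
    \sum_(p <- terms (rho v)) \sum_(q <- terms (rho p.2))
      p.1 \ox (q.1 \ox q.2);
  coact1 : forall v, \sum_(p <- terms (rho v)) counit hH p.1 *: p.2 = v
}.

Record moduleAlgebra (A : ualgType K) := ModuleAlgebra {
  ma_act : H -> A -> A;
  ma_actP : left_action ma_act;
  ma_actM : forall h a b, ma_act h (a ** b) =
    \sum_(p <- terms (Delta hH h)) ma_act p.1 a ** ma_act p.2 b;
  ma_act1 : forall h, ma_act h aone = counit hH h *: aone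
}.

Record comoduleAlgebra (B : ualgType K) := ComoduleAlgebra {
  ca_rho : B -> tens H B;
  ca_rhoP : left_coaction ca_rho;
  ca_rhoM : forall b c, ca_rho (b ** c) =
    \sum_(p <- terms (ca_rho b)) \sum_(q <- terms (ca_rho c))
      (p.1 ** q.1) \ox (p.2 ** q.2);
  ca_rho1 : ca_rho aone = aone \ox aone
}.

(* Right-left stable anti-Yetter-Drinfeld modules. *)
Record saydModule (N : lmodType K) := SaydModule {
  sm_act : N -> H -> N;
  sm_rho : N -> tens H N;
  sm_actP : right_action sm_act;
  sm_rhoP : left_coaction sm_rho;
  sm_ayd : forall n h, sm_rho (sm_act n h) =
    \sum_(u <- sw 2 h) \sum_(p <- terms (sm_rho n))
      (antip hH u`_2 ** p.1 ** u`_0) \ox sm_act p.2 u`_1;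
  sm_stable : forall n, \sum_(p <- terms (sm_rho n)) sm_act p.2 p.1 = n
}.

(* Left-right stable anti-Yetter-Drinfeld contramodules. *)
Record saydContramodule (M : lmodType K) := SaydContramodule {
  sc_act : H -> M -> M;
  sc_alpha : {linear hom H M -> M};
  sc_actP : left_action sc_act;
  sc_contraA : forall F : hom H (hom H M),
    sc_alpha (mkhom (fun h => sc_alpha (F h))) =
    sc_alpha (mkhom (fun h => \sum_(p <- terms (Delta hH h)) (F p.1 : hom H M) p.2));
  sc_contra1 : forall m, sc_alpha (mkhom (fun h => counit hH h *: m)) = m;
  sc_ayd : forall h (f : hom H M), sc_act h (sc_alpha f) =
    sc_alpha (mkhom (fun x => \sum_(u <- sw 2 h)
      sc_act u`_1 (f (antip hH u`_2 ** x ** u`_0))));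
  sc_stable : forall m, sc_alpha (mkhom (fun h => sc_act h m)) = m
}.

Lemma antipV_lin : linear (antipV hH).
Proof.
move=> a x y; apply: (can_inj (antipK hH)).
by rewrite linearP !antipVK.
Qed.
End Hopf.

Section SweedlerSums.
Variables (K : fieldType).

Lemma tens_ind (V W : lmodType K) (P : tens V W -> Prop) :
  P 0 -> (forall x y, P x -> P y -> P (x + y)) -> (forall v w, P (v \ox w)) ->
  forall t, P t.
Proof.
move=> P0 PD Pp t; rewrite -(terms_sum t).
by elim/big_ind: _ => // p _; apply: Pp.
Qed.

Lemma terms_sum_pure (V W U : lmodType K) (f : V -> W -> U) I (r : seq I) F G :
  bilinear_map f ->
  \sum_(p <- terms (\sum_(i <- r) F i \ox G i)) f p.1 p.2 = \sum_(i <- r) f (F i) (G i).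
Proof.
move=> bf; rewrite (linear_sum_of _ _ (terms_lin bf)).
by apply: eq_bigr => i _; rewrite terms_pure.
Qed.

Lemma sum_lin (V W : lmodType K) I (r : seq I) (F : I -> V -> W) :
  (forall i, linear (F i)) -> linear (fun x => \sum_(i <- r) F i x).
Proof.
move=> lF a x y; rewrite scaler_sumr -big_split /=.
by apply: eq_bigr => i _; rewrite lF.
Qed.

Lemma comp_lin (U V W : lmodType K) (f : V -> W) (g : U -> V) :
  linear f -> linear g -> linear (fun x => f (g x)).
Proof. by move=> lf lg a x y; rewrite lg lf. Qed.

Lemma coactA_sum (H : ualgType K) (hH : hopf H) (V U : lmodType K)
    (rho : V -> tens H V) (g : H -> H -> V -> U) v :
  left_coaction hH rho ->
  (forall x y, linear (fun z => g z x y)) -> (forall x y, linear (fun z => g x z y)) ->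
  (forall x y, linear (g x y)) ->
  \sum_(p <- terms (rho v)) \sum_(q <- terms (Delta hH p.1)) g q.1 q.2 p.2 =
  \sum_(p <- terms (rho v)) \sum_(q <- terms (rho p.2)) g p.1 q.1 q.2.
Proof.
move=> rhoP l1 l2 l3.
have b2 x : bilinear_map (fun y z => g x y z) by split=> z; [apply: l2|apply: l3].
pose G x t := \sum_(q <- terms t) g x q.1 q.2.
have bG : bilinear_map G.
  split=> [t|x]; last exact: terms_lin.
  by apply: sum_lin => p; apply: l1.
have := congr1 (fun t => \sum_(p <- terms t) G p.1 p.2) (coactA rhoP v).
rewrite !(linear_sum_of _ _ (terms_lin bG)).
under eq_bigr do rewrite (terms_sum_pure _ _ _ bG).
under [in RHS]eq_bigr do rewrite (terms_sum_pure _ _ _ bG).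
rewrite /G => e; transitivity
  (\sum_(p <- terms (rho v)) \sum_(q <- terms (Delta hH p.1))
     \sum_(q0 <- terms (q.2 \ox p.2)) g q.1 q0.1 q0.2).
  by apply: eq_bigr => p _; apply: eq_bigr => q _; rewrite (terms_pure (b2 _)).
rewrite {}e.
by apply: eq_bigr => p _; apply: eq_bigr => q _; rewrite (terms_pure (b2 _)).
Qed.
End SweedlerSums.

(* The crossed product of A and B; the element a |x b is a \ox b. *)
Section Crossed.
Variables (K : fieldType) (H : ualgType K) (hH : hopf H) (A B : ualgType K).
Variables (mA : moduleAlgebra hH A) (cB : comoduleAlgebra hH B).

Local Notation act := (ma_act mA).
Local Notation rho := (ca_rho cB).

Definition crossed_mul_pure (a : A) (b : B) (a' : A) (b' : B) : tens A B :=
  \sum_(w <- terms (rho b)) (a ** act w.1 a') \ox (w.2 ** b').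

Definition crossed_mul (s t : tens A B) : tens A B :=
  \sum_(p <- terms s) \sum_(q <- terms t) crossed_mul_pure p.1 p.2 q.1 q.2.

Let actl a : linear (act^~ a). Proof. exact: (lact_bil (ma_actP mA)).1. Qed.
Let actr h : linear (act h). Proof. exact: (lact_bil (ma_actP mA)).2. Qed.
Let rho_lin : linear rho. Proof. exact: coact_lin (ca_rhoP cB). Qed.

Let core_a b a' b' : linear (fun a => crossed_mul_pure a b a' b').
Proof.
apply: sum_lin => w; apply: (comp_lin (pure_linl _)); exact: amul_linl.
Qed.
Let inner_bil a a' b' :
  bilinear_map (fun (x : H) (y : B) => (a ** act x a') \ox (y ** b')).
Proof.
split=> [y|x].
  apply: (comp_lin (pure_linl _)); apply: (comp_lin (amul_linr _)); exact: actl.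
apply: (comp_lin (pure_linr _)); exact: amul_linl.
Qed.
Let core_b a a' b' : linear (fun b => crossed_mul_pure a b a' b').
Proof. exact: (comp_lin (terms_lin (inner_bil a a' b')) rho_lin). Qed.
Let core_a' a b b' : linear (fun a' => crossed_mul_pure a b a' b').
Proof.
apply: sum_lin => w; apply: (comp_lin (pure_linl _)).
apply: (comp_lin (amul_linr _)); exact: actr.
Qed.
Let core_b' a b a' : linear (fun b' => crossed_mul_pure a b a' b').
Proof.
apply: sum_lin => w; apply: (comp_lin (pure_linr _)); exact: amul_linr.
Qed.
Let core_bil1 a' b' : bilinear_map (fun a b => crossed_mul_pure a b a' b').
Proof. by split=> [b|a]. Qed.
Let core_bil2 a b : bilinear_map (crossed_mul_pure a b).
Proof. by split=> [b'|a']. Qed.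

Fact crossed_mul_linr s : linear (crossed_mul s).
Proof. by apply: sum_lin => p; apply: terms_lin. Qed.
Fact crossed_mul_linl t : linear (crossed_mul^~ t).
Proof.
have bF : bilinear_map
    (fun a b => \sum_(q <- terms t) crossed_mul_pure a b q.1 q.2).
  by split=> z; apply: sum_lin.
exact: (terms_lin bF).
Qed.

Lemma crossed_mulE a b a' b' :
  crossed_mul (a \ox b) (a' \ox b') = crossed_mul_pure a b a' b'.
Proof.
rewrite /crossed_mul.
under eq_bigr do rewrite (terms_pure (core_bil2 _ _)).
by rewrite (terms_pure (core_bil1 _ _)).
Qed.

Lemma lin_tens_ext (V W U : lmodType K) (f g : tens V W -> U) :
  linear f -> linear g -> (forall v w, f (v \ox w) = g (v \ox w)) -> f =1 g.
Proof.
move=> lf lg e t; elim/tens_ind: t => // [|x y ex ey].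
  by rewrite (linear0_of lf) (linear0_of lg).
by rewrite (linearD_of _ _ lf) (linearD_of _ _ lg) ex ey.
Qed.

Fact crossed_mulA : associative crossed_mul.
Proof.
move=> x y z; move: x; apply: lin_tens_ext => [||a b].
- exact: crossed_mul_linl.
- exact: (comp_lin (crossed_mul_linl z) (crossed_mul_linl y)).
move: y; apply: lin_tens_ext => [||a' b'].
- exact: (comp_lin (crossed_mul_linr _) (crossed_mul_linl z)).
- exact: (comp_lin (crossed_mul_linl z) (crossed_mul_linr _)).
move: z; apply: lin_tens_ext => [||a2 b2].
- exact: (comp_lin (crossed_mul_linr _) (crossed_mul_linr _)).
- exact: crossed_mul_linr.
rewrite !crossed_mulE.
rewrite [in LHS]/crossed_mul_pure [in RHS]/crossed_mul_pure.
rewrite (linear_sum_of _ _ (crossed_mul_linr _)).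
rewrite (linear_sum_of _ _ (crossed_mul_linl _)).
under eq_bigr do rewrite crossed_mulE /crossed_mul_pure.
under [in RHS]eq_bigr do rewrite crossed_mulE /crossed_mul_pure ca_rhoM.
have bF a0 b0 : bilinear_map (fun (x : H) (y : B) => (a0 ** act x a2) \ox (y ** b0)).
  exact: inner_bil.
transitivity (\sum_(i <- terms (rho b')) \sum_(w <- terms (rho b))
   \sum_(q <- terms (Delta hH w.1))
     ((a ** (act q.1 a' ** act (q.2 ** i.1) a2)) \ox (w.2 ** (i.2 ** b2)))).
  apply: eq_bigr => i _; apply: eq_bigr => w _.
  rewrite ma_actM (linear_sum_of _ _ (amul_linr _)) (linear_sum_of _ _ (pure_linl _)).
  by apply: eq_bigr => q _; rewrite (lactM (ma_actP mA)).
rewrite exchange_big /=.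
transitivity (\sum_(w <- terms (rho b)) \sum_(q <- terms (Delta hH w.1))
    \sum_(i <- terms (rho b'))
     ((a ** (act q.1 a' ** act (q.2 ** i.1) a2)) \ox (w.2 ** (i.2 ** b2)))).
  by apply: eq_bigr => w _; rewrite exchange_big.
rewrite (coactA_sum (g := fun (x y : H) (z : B) => \sum_(i <- terms (rho b'))
     ((a ** (act x a' ** act (y ** i.1) a2)) \ox (z ** (i.2 ** b2)))) _ (ca_rhoP cB)).
- apply: eq_bigr => w _.
  rewrite (linear_sum_of _ _ (terms_lin (bF _ _))); apply: eq_bigr => q _.
  rewrite (linear_sum_of _ _ (terms_lin (bF _ _))); apply: eq_bigr => i _.
  by rewrite (terms_pure (bF _ _)) !amulA.
- move=> y z; apply: sum_lin => i; apply: (comp_lin (pure_linl _)).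
  apply: (comp_lin (amul_linr _)); apply: (comp_lin (amul_linl _)); exact: actl.
- move=> y z; apply: sum_lin => i; apply: (comp_lin (pure_linl _)).
  do 2! apply: (comp_lin (amul_linr _)); apply: (comp_lin (actl _)); exact: amul_linl.
- move=> y z; apply: sum_lin => i; apply: (comp_lin (pure_linr _)); exact: amul_linl.
Qed.

Fact crossed_mul1l : left_id (aone \ox aone) crossed_mul.
Proof.
apply: lin_tens_ext => [||a b] //; first exact: crossed_mul_linr.
rewrite crossed_mulE /crossed_mul_pure ca_rho1 (terms_pure (inner_bil _ _ _)).
by rewrite !amul1l (lact1 (ma_actP mA)).
Qed.

Fact crossed_mul1r : right_id (aone \ox aone) crossed_mul.
Proof.
apply: lin_tens_ext => [||a b] //; first exact: crossed_mul_linl.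
rewrite crossed_mulE /crossed_mul_pure.
rewrite -[in RHS](coact1 (ca_rhoP cB) b) (linear_sum_of _ _ (pure_linr _)).
apply: eq_bigr => w _; rewrite ma_act1 amul1r (linearZ_of _ _ (amul_linr _)) amul1r.
by rewrite (linearZ_of _ _ (pure_linl _)) (linearZ_of _ _ (pure_linr _)).
Qed.

Definition crossed of moduleAlgebra hH A & comoduleAlgebra hH B := tens A B.
HB.instance Definition _ := GRing.Lmodule.on (crossed mA cB).
HB.instance Definition _ := Lmodule_isUAlgebra.Build K (crossed mA cB)
  crossed_mulA crossed_mul1l crossed_mul1r crossed_mul_linl crossed_mul_linr.
End Crossed.

(* The data of a cocyclic module X: X^n is the subspace cc_mem n of cc n, and the
   structure maps of X are the restrictions to these subspaces of linear maps
   between the ambient spaces cc n. *)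
Record cocyclicData (K : fieldType) := Cocyclic {
  cc :> nat -> lmodType K;
  cc_mem : forall n, submodClosed (cc n);
  coface : forall n, 'I_n.+2 -> {linear cc n -> cc n.+1};
  codegen : forall n, 'I_n.+1 -> {linear cc n.+1 -> cc n};
  cyc : forall n, {linear cc n -> cc n}
}.

Arguments coface {K} c {n}.
Arguments codegen {K} c {n}.
Arguments cyc {K} c {n}.

(* The three cocyclic modules below have the common shape
   (tau f)(a^0, ..., a^n) = T a^n (x |-> f(x, a^0, ..., a^(n-1))),
   (d_(n+1) f)(a^0, ..., a^(n+1)) = T a^(n+1) (x |-> f(x a^0, a^1, ..., a^n))
   for a bilinear map T : A * Hom(A, M) -> M. *)
Section TwistedCochains.
Variables (K : fieldType) (A : ualgType K) (M : lmodType K).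

Record twist := Twist {
  twist_fun :> A -> hom A M -> M;
  twist_bil : bilinear_map twist_fun
}.

Section Arguments.
Variable n : nat.

Definition merge (i : nat) (a : 'I_n.+2 -> A) : 'I_n.+1 -> A := fun j =>
  if (j < i)%N then a (inord j)
  else if j == i :> nat then a (inord i) ** a (inord i.+1)
  else a (inord j.+1).

Definition insert1 (i : nat) (a : 'I_n.+1 -> A) : 'I_n.+2 -> A := fun j =>
  if (j <= i)%N then a (inord j)
  else if j == i.+1 :> nat then aone
  else a (inord j.-1).

Definition rotate (x : A) (a : 'I_n.+1 -> A) : 'I_n.+1 -> A := fun j =>
  if j == ord0 then x else a (inord j.-1).

Definition rotate_merge (x : A) (a : 'I_n.+2 -> A) : 'I_n.+1 -> A := fun j =>
  if j == ord0 then x ** a ord0 else a (inord j).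
End Arguments.

Lemma mult_precomp n m (f : mult m A M) (T : ('I_n -> A) -> ('I_m -> A)) :
  (forall v k, exists w k', exists2 l, linear l &
     forall x, T (upd v k x) = upd w k' (l x)) ->
  (fun a => f (T a)) \in @multilin_pred K n A M.
Proof.
move=> HT; apply/asboolP => v k; have [w [k' [l ll e]]] := HT v k.
by move=> a x y; rewrite !e ll mult_lin.
Qed.

Local Ltac ifs := repeat (case: ifP; let E := fresh in move=> E);
  solve [reflexivity | exfalso; lia | congr (_ (inord _)); lia
   | congr (_ ** _); congr (_ (inord _)); lia].

Lemma inord_eq n (k : 'I_n.+1) j : (j <= n)%N -> (inord j == k) = (j == k :> nat).
Proof. by move=> lj; rewrite -val_eqE /= inordK. Qed.

Lemma eq_inord n (k : 'I_n.+1) j : (j <= n)%N -> (k == inord j) = (k == j :> nat).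
Proof. by move=> lj; rewrite -val_eqE /= inordK. Qed.

Lemma merge_mult n i (f : mult n.+1 A M) : (i <= n)%N ->
  (fun a => f (merge i a)) \in @multilin_pred K n.+2 A M.
Proof.
move=> lin; apply: mult_precomp => v k; have kn := ltn_ord k.
pose k' := if (k <= i)%N then k : nat else k.-1.
pose l x : A := if k == i :> nat then x ** v (inord i.+1)
  else if k == i.+1 :> nat then v (inord i) ** x else x.
exists (merge i v), (inord k'), l.
  rewrite /l; case: eqP => _; first exact: amul_linl.
  by case: eqP => _ //; exact: amul_linr.
move=> x; apply: functional_extensionality_dep => j; have jn := ltn_ord j.
rewrite /merge /upd eq_inord; last by rewrite /k'; case: ifP; lia.
rewrite !inord_eq; try lia.
rewrite /l /k'; case: (leqP k i) => ki; ifs.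
Qed.

Lemma insert1_mult n i (f : mult n.+2 A M) : (i <= n)%N ->
  (fun a => f (insert1 i a)) \in @multilin_pred K n.+1 A M.
Proof.
move=> lin; apply: mult_precomp => v k; have kn := ltn_ord k.
pose k' := if (k <= i)%N then k : nat else k.+1.
exists (insert1 i v), (inord k'), id => // x.
apply: functional_extensionality_dep => j; have jn := ltn_ord j.
rewrite /insert1 /upd eq_inord; last by rewrite /k'; case: ifP; lia.
rewrite /k'; case: (leqP k i) => ki; case: (leqP j i) => ji;
  try (by rewrite inord_eq; [ifs|lia]); case: eqP => ej; first [by ifs
    | by rewrite inord_eq; [ifs|lia]].
Qed.

Lemma rotate_lin n (f : mult n.+1 A M) a : linear (fun x => f (rotate x a)).
Proof.
suff e x : rotate x a = upd (rotate 0 a) ord0 x.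
  by move=> k x y; rewrite (e (k *: x + y)) mult_lin -e -e.
by apply: functional_extensionality_dep => j; rewrite /rotate /upd; case: eqP.
Qed.

Lemma rotate_merge_lin n (f : mult n.+1 A M) a :
  linear (fun x => f (rotate_merge x a)).
Proof.
suff e x : rotate_merge x a = upd (rotate_merge 0 a) ord0 (x ** a ord0).
  by move=> k x y; rewrite (e (k *: x + y)) amul_linl mult_lin -e -e.
by apply: functional_extensionality_dep => j; rewrite /rotate_merge /upd; case: eqP.
Qed.

Lemma twist_mult (T : twist) n m (f : mult n.+1 A M)
    (R : A -> ('I_m.+1 -> A) -> ('I_n.+1 -> A)) :
  (forall a, linear (fun x => f (R x a))) ->
  (forall x v y, R x (upd v ord_max y) = R x v) ->
  (forall v k, k != ord_max -> exists k' (l : A -> A -> A),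
     (forall x, linear (l x)) /\
     forall x y, R x (upd v k y) = upd (R x v) k' (l x y)) ->
  (fun a => T (a ord_max) (mkhom (fun x => f (R x a)))) \in @multilin_pred K m.+1 A M.
Proof.
move=> fl R1 R2; apply/asboolP => v k c x y.
case: (eqVneq k ord_max) => [->|nk].
  have E0 z : upd v ord_max z ord_max = z by rewrite /upd eqxx.
  have E z : (fun x0 => f (R x0 (upd v ord_max z))) = (fun x0 => f (R x0 v)).
    by apply/funext => x0; rewrite R1.
  by rewrite !E0 !E (twist_bil T).1.
have E z : upd v k z ord_max = v ord_max by rewrite /upd eq_sym (negPf nk).
have [k' [l [ll e]]] := R2 v k nk.
rewrite !E -(twist_bil T).2; congr (T _ _).
rewrite -mkhom_lin //; apply: homP => z; rewrite !mkhomE //.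
  by rewrite !e ll mult_lin.
by move=> b x1 x2; rewrite !fl !scalerDr !scalerA [b * _]mulrC addrACA.
Qed.

Lemma rotate_mult (T : twist) n (f : mult n.+1 A M) :
  (fun a => T (a ord_max) (mkhom (fun x => f (rotate x a))))
    \in @multilin_pred K n.+1 A M.
Proof.
apply: twist_mult => [a|x v y|v k nk]; first exact: rotate_lin.
  apply: functional_extensionality_dep => j; rewrite /rotate /upd.
  case: eqP => // /eqP; rewrite -val_eqE /= => j0; have jn := ltn_ord j.
  by rewrite inord_eq /=; [ifs|lia].
have {nk} nk : k != n :> nat by rewrite -val_eqE in nk.
have kn := ltn_ord k.
exists (inord k.+1), (fun _ y => y); split=> // x y.
apply: functional_extensionality_dep => j; have jn := ltn_ord j.
rewrite /rotate /upd -val_eqE /= eq_inord; last by lia.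
case: eqP => ej; first by ifs.
by rewrite inord_eq; [ifs|lia].
Qed.

Lemma rotate_merge_mult (T : twist) n (f : mult n.+1 A M) :
  (fun a => T (a ord_max) (mkhom (fun x => f (rotate_merge x a))))
    \in @multilin_pred K n.+2 A M.
Proof.
apply: twist_mult => [a|x v y|v k nk]; first exact: rotate_merge_lin.
  apply: functional_extensionality_dep => j; have jn := ltn_ord j.
  rewrite /rotate_merge /upd -!val_eqE /=.
  by case: eqP => // j0; rewrite inordK; [ifs|lia].
have {nk} nk : k != n.+1 :> nat by rewrite -val_eqE in nk.
have kn := ltn_ord k.
exists (inord k), (fun x y => if k == ord0 then x ** y else y); split=> [x|x y].
  by case: eqP => // _; exact: amul_linr.
apply: functional_extensionality_dep => j; have jn := ltn_ord j.
rewrite /rotate_merge /upd -!val_eqE /= !inordK; try lia.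
ifs.
Qed.

Lemma mult_map_linear n m (F : mult n A M -> mult m A M) :
  (forall c f g a, F (c *: f + g) a = c *: F f a + F g a) -> linear F.
Proof. by move=> e c f g; apply: multP => a; rewrite e. Qed.

Section StructureMaps.
Variables (T : twist) (n : nat).

Definition coface_fun (i : 'I_n.+2) (f : mult n.+1 A M) (a : 'I_n.+2 -> A) : M :=
  if (i <= n)%N then f (merge i a)
  else T (a ord_max) (mkhom (fun x => f (rotate_merge x a))).

Fact coface_multilin i f : coface_fun i f \in @multilin_pred K n.+2 A M.
Proof.
rewrite /coface_fun; case: leqP => lein; first exact: merge_mult.
exact: rotate_merge_mult.
Qed.
Definition tw_coface i f : mult n.+2 A M := Subm (coface_multilin i f).

Fact tw_coface_linear i : linear (tw_coface i).
Proof.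
apply: mult_map_linear => c f g a; rewrite /mult_fun /= /coface_fun.
case: leqP => // _; rewrite -(twist_bil T).2; congr (T _ _).
by rewrite -mkhom_lin //; apply: rotate_merge_lin.
Qed.
HB.instance Definition _ i := GRing.isLinear.Build K (mult n.+1 A M) (mult n.+2 A M)
  *:%R (tw_coface i) (tw_coface_linear i).

Fact codegen_multilin (j : 'I_n.+1) (f : mult n.+2 A M) :
  (fun a => f (insert1 j a)) \in @multilin_pred K n.+1 A M.
Proof. exact/insert1_mult/leq_ord. Qed.
Definition tw_codegen j f : mult n.+1 A M := Subm (codegen_multilin j f).

Fact tw_codegen_linear j : linear (tw_codegen j).
Proof. exact: mult_map_linear. Qed.
HB.instance Definition _ j := GRing.isLinear.Build K (mult n.+2 A M) (mult n.+1 A M)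
  *:%R (tw_codegen j) (tw_codegen_linear j).

Definition tw_cyc (f : mult n.+1 A M) : mult n.+1 A M := Subm (rotate_mult T f).

Fact tw_cyc_linear : linear tw_cyc.
Proof.
apply: mult_map_linear => c f g a; rewrite /mult_fun /=.
rewrite -(twist_bil T).2; congr (T _ _).
by rewrite -mkhom_lin //; apply: rotate_lin.
Qed.
HB.instance Definition _ := GRing.isLinear.Build K (mult n.+1 A M) (mult n.+1 A M)
  *:%R tw_cyc tw_cyc_linear.
End StructureMaps.

Definition twisted (T : twist) (S : forall n, submodClosed (mult n.+1 A M)) : cocyclicData K :=
  @Cocyclic K (fun n => mult n.+1 A M) S (fun n i => tw_coface T i)
    (fun n j => @tw_codegen n j) (fun n => @tw_cyc T n).

End TwistedCochains.

Section FullSubspace.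
Variables (K : pzRingType) (V : lmodType K).
Definition full_pred : {pred V} := predT.
Fact full_submod : submod_closed full_pred. Proof. by []. Qed.
HB.instance Definition _ := GRing.isSubmodClosed.Build K V full_pred
  (GRing.submod_closed_semi full_submod).
End FullSubspace.

(* Hom(A^{(x) n+1}, M). *)
Section OrdinaryCochains.
Variables (K : fieldType) (A : ualgType K) (M : lmodType K).

Fact ord_twist_bil : bilinear_map (fun (a : A) (g : hom A M) => g a).
Proof. by split=> [g|a]; [exact: hom_linear|]. Qed.

Definition ordC : cocyclicData K :=
  twisted (Twist ord_twist_bil) (fun n => @full_pred K (mult n.+1 A M)).
End OrdinaryCochains.

(* Hom_H(A^{(x) n+1}, M). *)
Section ModuleAlgebraCochains.
Variables (K : fieldType) (H : ualgType K) (hH : hopf H).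
Variables (A : ualgType K) (mA : moduleAlgebra hH A).
Variables (M : lmodType K) (sM : saydContramodule hH M).

Definition contra_twist_fun (a : A) (g : hom A M) : M :=
  sc_alpha sM (mkhom (fun h => g (ma_act mA (antipV hH h) a))).

Fact contra_twist_bil : bilinear_map contra_twist_fun.
Proof.
have al : bilinear_map (ma_act mA) := lact_bil (ma_actP mA).
have L (g : hom A M) a : linear (fun h => g (ma_act mA (antipV hH h) a)).
  apply: (comp_lin (@hom_linear _ _ _ g)).
  exact: (comp_lin (al.1 a) (@antipV_lin _ _ hH)).
split=> [g c x y|a c g1 g2]; rewrite /contra_twist_fun -linearP -mkhom_lin //.
congr (sc_alpha _ (mkhom _)); apply/funext => h.
by rewrite al.2 hom_linear.
Qed.

Definition Hlinear_pred n : {pred mult n.+1 A M} := fun f => `[<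
  forall h a, \sum_(u <- sw hH n h) f (fun i => ma_act mA u`_i (a i)) =
    sc_act sM h (f a) >].

Fact Hlinear_submod n : submod_closed (@Hlinear_pred n).
Proof.
have al : bilinear_map (sc_act sM) := lact_bil (sc_actP sM).
split=> [|c f g /asboolP Hf /asboolP Hg]; apply/asboolP => h a.
  by rewrite big1 // (linear0_of (al.2 h)).
rewrite [X in sc_act _ _ X](mult_linE c f g a) al.2 -Hf -Hg scaler_sumr -big_split.
by [].
Qed.
HB.instance Definition _ n := GRing.isSubmodClosed.Build K (mult n.+1 A M)
  (@Hlinear_pred n) (GRing.submod_closed_semi (@Hlinear_submod n)).

Definition HlinC : cocyclicData K := twisted (Twist contra_twist_bil) (@Hlinear_pred).
End ModuleAlgebraCochains.

(* All functions c on 'I_n with c i \in s i. *)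
Fixpoint choices (T : Type) (n : nat) : ('I_n -> seq T) -> seq ('I_n -> T) :=
  match n with
  | 0 => fun=> [:: (fun i : 'I_0 => match notF (ltn_ord i) with end)]
  | m.+1 => fun s : 'I_m.+1 -> seq T =>
    [seq (fun i : 'I_m.+1 => if unlift ord0 i is Some j then c j else x)
      | x <- s ord0, c <- choices (fun j => s (fintype.lift ord0 j))]
  end.

(* ^H Hom(B^{(x) n+1}, N). *)
Section ComoduleAlgebraCochains.
Variables (K : fieldType) (H : ualgType K) (hH : hopf H).
Variables (B : ualgType K) (cB : comoduleAlgebra hH B).
Variables (N : lmodType K) (sN : saydModule hH N).

Definition coact_twist_fun (b : B) (g : hom B N) : N :=
  \sum_(p <- terms (ca_rho cB b)) sm_act sN (g p.2) p.1.

Fact coact_twist_bil : bilinear_map coact_twist_fun.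
Proof.
have al : bilinear_map (sm_act sN) := ract_bil (sm_actP sN).
split=> [g|b]; last first.
  apply: sum_lin => p c x y.
  exact: (al.1 p.1 c ((x : hom B N) p.2) ((y : hom B N) p.2)).
have bg : bilinear_map (fun (h : H) (b : B) => sm_act sN ((g : hom B N) b) h).
  by split=> [b|h]; [exact: al.2|exact: (comp_lin (al.1 h) (@hom_linear _ _ _ g))].
exact: (comp_lin (terms_lin bg) (coact_lin (ca_rhoP cB))).
Qed.

Definition Hcolinear_pred n : {pred mult n.+1 B N} := fun f => `[<
  forall b, sm_rho sN (f b) =
    \sum_(c <- choices (fun i => terms (ca_rho cB (b i))))
      (\big[amul/aone]_i (c i).1) \ox f (fun i => (c i).2) >].

Fact Hcolinear_submod n : submod_closed (@Hcolinear_pred n).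
Proof.
have rl : linear (sm_rho sN) := coact_lin (sm_rhoP sN).
split=> [|k f g /asboolP Hf /asboolP Hg]; apply/asboolP => b.
  by rewrite [X in sm_rho _ X](_ : _ = 0) // (linear0_of rl) big1 // => c _;
    rewrite [X in _ \ox X](_ : _ = 0) // (linear0_of (pure_linr _)).
rewrite [X in sm_rho _ X](mult_linE k f g b) rl Hf Hg scaler_sumr -big_split /=.
apply: eq_bigr => c _; rewrite -pure_linr; congr (_ \ox _).
Qed.
HB.instance Definition _ n := GRing.isSubmodClosed.Build K (mult n.+1 B N)
  (@Hcolinear_pred n) (GRing.submod_closed_semi (@Hcolinear_submod n)).

Definition HcolinC : cocyclicData K := twisted (Twist coact_twist_bil) (@Hcolinear_pred).
End ComoduleAlgebraCochains.

Section CyclicCohomology.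
Variables (K : fieldType) (X : cocyclicData K).

(* X_norm. *)
Definition normalized (n : nat) : X n -> Prop :=
  if n is m.+1 then fun x => x \in cc_mem X m.+1 /\ forall j, codegen X j x = 0
  else fun x => x \in cc_mem X 0.

Definition hochb n (x : X n) : X n.+1 := \sum_(i < n.+2) (-1) ^+ i *: coface X i x.

Definition connesB n (x : X n.+1) : X n :=
  \sum_(i < n.+1) (-1) ^+ (n * i)%N *: iter i (cyc X) (codegen X ord_max (cyc X x)).

(* (X, b + B) *)
Definition totd (z : fam X) : fam X := fun n =>
  (if n is m.+1 return X n then hochb (z m) else 0) + connesB (z n.+1).

(* z is supported in the degrees n, n - 2, n - 4, ... *)
Definition cochain (n : nat) (z : fam X) : Prop :=
  (forall k, normalized (z k)) /\
  (forall k, ~~ ((k <= n)%N && (odd k == odd n)) -> z k = 0).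

Definition cocycle_pred n : {pred fam X} := fun z => `[< cochain n z /\ totd z = 0 >].

Definition coboundary n (z : fam X) : Prop :=
  if n is m.+1 then exists2 y, cochain m y & z = totd y else z = 0.

Lemma hochb_linear n : linear (@hochb n).
Proof.
move=> a x y; rewrite /hochb scaler_sumr -big_split /=; apply: eq_bigr => i _.
by rewrite linearP scalerDr !scalerA mulrC.
Qed.

Lemma connesB_linear n : linear (@connesB n).
Proof.
have itl i : linear (iter i (cyc X : X n -> X n)).
  by elim: i => // i IH a x y; rewrite !iterS IH linearP.
move=> a x y; rewrite /connesB scaler_sumr -big_split /=; apply: eq_bigr => i _.
by rewrite !linearP itl scalerDr !scalerA mulrC.
Qed.

Lemma totd_linear : linear totd.
Proof.
move=> a x y; apply: functional_extensionality_dep => -[|n].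
  by rewrite fam_DE fam_ZE /totd !add0r connesB_linear.
by rewrite fam_DE fam_ZE /totd hochb_linear connesB_linear scalerDr addrACA.
Qed.

Lemma normalized_lin n a (x y : X n) :
  normalized x -> normalized y -> normalized (a *: x + y).
Proof.
case: n x y => [|n] x y /=; first by move=> *; rewrite rpredD ?rpredZ.
move=> [mx sx] [my sy]; split=> [|j]; first by rewrite rpredD ?rpredZ.
by rewrite linearP sx sy scaler0 addr0.
Qed.

Lemma normalized0 n : normalized (0 : X n).
Proof.
by case: n => [|n] /=; rewrite ?rpred0 //; split=> [|j]; rewrite ?rpred0 ?linear0.
Qed.

Fact cocycle_submod n : submod_closed (cocycle_pred n).
Proof.
split=> [|a x y /asboolP [[nx sx] dx] /asboolP [[ny sy] dy]]; apply/asboolP.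
  by split; [split=> // k; apply: normalized0|rewrite (linear0_of totd_linear)].
split; last by rewrite totd_linear dx dy scaler0 addr0.
split=> k; first exact: normalized_lin.
by move=> hk; rewrite fam_DE fam_ZE sx // sy // scaler0 addr0.
Qed.
HB.instance Definition _ n := GRing.isSubmodClosed.Build K (fam X)
  (cocycle_pred n) (GRing.submod_closed_semi (@cocycle_submod n)).

Definition cocycle n := subm (cocycle_pred n).
HB.instance Definition _ n := GRing.Lmodule.on (cocycle n).
Definition cocycle_val n (z : cocycle n) : fam X := subm_val z.
Coercion cocycle_val : cocycle >-> fam.

Definition HC n := quotm (fun z : cocycle n => coboundary n z).
HB.instance Definition _ n := GRing.Lmodule.on (HC n).

Definition class n (z : cocycle n) : HC n := cls _ z.
End CyclicCohomology.

Arguments normalized {K} X {n}.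
Arguments hochb {K} X {n}.
Arguments connesB {K} X {n}.

(* The bicocyclic module C^{r,s} = X^r (x) Y^s.  The ground ring being a field,
   it is the subspace of cc X r (x) cc Y s spanned by the x (x) y with x in X^r
   and y in Y^s. *)
Section Bicocyclic.
Variables (K : fieldType) (X Y : cocyclicData K).

Variant mem_tens r s : tens (X r) (Y s) -> Prop :=
  Mem_tens x y of x \in cc_mem X r & y \in cc_mem Y s : mem_tens (x \ox y).

Definition bimod_mem r s : {pred tens (X r) (Y s)} := span (@mem_tens r s).
HB.instance Definition _ r s := GRing.SubmodClosed.on (@bimod_mem r s).

(* C^{r,*} *)
Definition hor r : cocyclicData K := @Cocyclic K (fun s => tens (X r) (Y s))
  (fun s => @bimod_mem r s)
  (fun s i => tmap (@idfun (X r)) (coface Y i))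
  (fun s j => tmap (@idfun (X r)) (codegen Y j))
  (fun s => tmap (@idfun (X r)) (cyc Y)).

(* C^{*,s} *)
Definition ver s : cocyclicData K := @Cocyclic K (fun r => tens (X r) (Y s))
  (fun r => @bimod_mem r s)
  (fun r i => tmap (coface X i) (@idfun (Y s)))
  (fun r j => tmap (codegen X j) (@idfun (Y s)))
  (fun r => tmap (cyc X) (@idfun (Y s))).

Definition diag : cocyclicData K := @Cocyclic K (fun n => tens (X n) (Y n))
  (fun n => @bimod_mem n n)
  (fun n i => tmap (coface X i) (coface Y i))
  (fun n j => tmap (codegen X j) (codegen Y j))
  (fun n => tmap (cyc X) (cyc Y)).

(* Elements of the product of all C^{r,s}. *)
Definition bifam := fam (fun r => fam (fun s => tens (X r) (Y s))).
HB.instance Definition _ := GRing.Lmodule.on bifam.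

(* Tot^n *)
Definition Tot (n : nat) (x : bifam) : Prop :=
  (forall r s, normalized (hor r) (x r s) /\ normalized (ver s) (x r s)) /\
  (forall r s, (r + s)%N <> n -> x r s = 0).

(* b_T + B_T *)
Definition Tot_d (x : bifam) : bifam := fun r s =>
  (if s is s'.+1 return tens (X r) (Y s) then hochb (hor r) (x r s') else 0) +
  (-1) ^+ s *:
    (if r is r'.+1 return tens (X r) (Y s) then hochb (ver s) (x r' s) else 0) +
  connesB (hor r) (x r s.+1) + (-1) ^+ s *: connesB (ver s) (x r.+1 s).

Definition Tot_comp (n : nat) (x : bifam) : bifam := fun r s =>
  if (r + s == n)%N then x r s else 0.

(* (d_0)^k on Z^r, and d_(s+k) ... d_(s+1) on Z^s *)
Fixpoint front (Z : cocyclicData K) (k r : nat) (x : Z r) : Z (k + r)%N :=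
  if k is l.+1 return Z (k + r)%N then coface Z ord0 (front l x) else x.
Fixpoint back (Z : cocyclicData K) (k s : nat) (x : Z s) : Z (k + s)%N :=
  if k is l.+1 return Z (k + s)%N then coface Z ord_max (back l x) else x.

Definition AWrs r s (x : tens (X r) (Y s)) : tens (X (s + r)%N) (Y (r + s)%N) :=
  @front (ver (r + s)) s r (@back (hor r) r s x).

Definition tens_cast m m' n n' (em : m = m') (en : n = n')
    (t : tens (X m) (Y n)) : tens (X m') (Y n') :=
  ecast i (tens (X i) (Y n')) em (ecast j (tens (X m) (Y j)) en t).

(* The Alexander-Whitney map; only the components of x in Tot^n contribute. *)
Definition AW (x : bifam) (n : nat) : diag n :=
  \sum_(r < n.+1) tens_cast (subnK (leq_ord r)) (subnKC (leq_ord r))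
    (AWrs (x r (n - r)%N)).

Section Extension.
Variable AW' : forall n : nat, bifam -> diag n.

(* AW + AW', where AW' n is regarded as a map Tot^(n+2) -> D^n. *)
Definition AWbar (x : bifam) : fam diag := fun n =>
  AW x n + AW' n (Tot_comp n.+2 x).

(* (AW, AW') is an S-map between the normalized mixed complexes. *)
Record AW_extension : Prop := {
  AW'_linear : forall n a x y, Tot n.+2 x -> Tot n.+2 y ->
    AW' n (a *: x + y) = a *: AW' n x + AW' n y;
  AW'_normalized : forall n x, Tot n.+2 x -> normalized diag (AW' n x);
  AW'_chain : forall n x, Tot n x ->
    totd (AWbar x) = AWbar (Tot_d x)
}.
End Extension.

Definition tens_fam (x : fam X) (y : fam Y) : bifam := fun r s => x r \ox y s.
End Bicocyclic.

(* L(N, M): the coequalizer is the quotient of N (x)_H M by the differences of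
   the images of the generators n (x) f of N (x)_H Hom(H, M). *)
Section Coequalizer.
Variables (K : fieldType) (H : ualgType K) (hH : hopf H) (N M : lmodType K).
Variables (sN : saydModule hH N) (sM : saydContramodule hH M).

Variant tensH_rel : tens N M -> Prop :=
  TensH_rel n h m : tensH_rel (sm_act sN n h \ox m - n \ox sc_act sM h m).
Definition tensH := quotm tensH_rel.
HB.instance Definition _ := GRing.Lmodule.on tensH.

Variant coeq_rel : tensH -> Prop :=
  Coeq_rel n (f : hom H M) : coeq_rel
    (cls tensH_rel (n \ox sc_alpha sM f) -
     \sum_(p <- terms (sm_rho sN n)) cls tensH_rel (p.2 \ox f p.1)).
Definition coeq := quotm coeq_rel.
HB.instance Definition _ := GRing.Lmodule.on coeq.

Definition to_coeq (n : N) (m : M) : coeq := cls coeq_rel (cls tensH_rel (n \ox m)).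
End Coequalizer.

Section CupProduct.
Variables (K : fieldType) (H : ualgType K) (hH : hopf H) (A B : ualgType K).
Variables (mA : moduleAlgebra hH A) (cB : comoduleAlgebra hH B).
Variables (N M : lmodType K) (sN : saydModule hH N) (sM : saydContramodule hH M).

(* Iterated coaction: a sum over c <- coacts k b is the sum over
   b_<-k> (x) ... (x) b_<-1> (x) b_<0>, where c.1`_i stands for b_<-i-1> and
   c.2 for b_<0>. *)
Fixpoint coacts (k : nat) (b : B) : seq (seq H * B) :=
  if k is l.+1 then
    [seq (rcons c.1 p.1, c.2) | p <- terms (ca_rho cB b), c <- coacts l p.2]
  else [:: ([::], b)].

(* Phi(psi (x) phi)(a^0 |x b^0 (x) ... (x) a^n |x b^n) *)
Definition Phi_pure n (psi : mult n.+1 B N) (phi : mult n.+1 A M)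
    (a : 'I_n.+1 -> A) (b : 'I_n.+1 -> B) : coeq sN sM :=
  \sum_(c <- choices (fun j => coacts j.+1 (b j)))
    to_coeq sN sM (psi (fun j => (c j).2))
      (phi (fun k => ma_act mA
         (antipV hH (\big[amul/aone]_(j < n.+1 | (k <= j)%N) (c j).1`_k)) (a k))).

Definition Phi n (t : tens (mult n.+1 B N) (mult n.+1 A M))
    (r : 'I_n.+1 -> crossed mA cB) : coeq sN sM :=
  \sum_(w <- terms t) \sum_(e <- choices (fun i => terms (r i : tens A B)))
    Phi_pure w.1 w.2 (fun i => (e i).1) (fun i => (e i).2).
End CupProduct.

(* Main.v *)
Require Import Defs.
From HB Require Import structures.
From mathcomp Require Import all_boot all_order all_algebra.
From mathcomp Require Import boolp functions reals complex.
From mathcomp Require Import zify.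

Set Implicit Arguments.
Unset Strict Implicit.
Unset Printing Implicit Defensive.

Import GRing.Theory.
Local Open Scope ring_scope.

(** The elements of the crossed product satisfy
    a |x b = (1 |x b_<0>)(S^{-1}(b_<-1>) . a |x 1), so a word a^0 b^0 ... a^n b^n can be
    sorted, moving every a to the right past the b's that follow it.  Feeding the
    sorted b's to psi and the sorted a's to phi is the map Phi.  Sorting is
    compatible with multiplying neighbours and with units ([Theta_mg],
    [Theta_ins]), hence Phi commutes with inner cofaces and codegeneracies for
    arbitrary multilinear psi and phi.  Equivariance and the coequalizer enter only
    for the cyclic operator ([PhiC_cyc]): in tau psi the last b acts on the value of
    psi by b_<-1>; over H this action moves to tau phi, which is H-linear, and there
    it cancels the sorting past the last b ([Theta_last]).  What remains has the
    form n (x) alpha(f), which equals n_<0> (x) f(n_<-1>) in the coequalizer, and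
    colinearity of psi turns the coaction of n into the coaction of the arguments.
    The last coface is the cyclic operator after the zeroth coface, so Phi is a map
    of cocyclic modules on the diagonal D and commutes with b + B.

    On the other side, H-linear and H-colinear cochains are stable under the
    structure maps by the anti-Yetter-Drinfeld conditions ([lin_cyc], [colin_cyc]),
    and the relations between codegeneracies and the other structure maps
    ([twisted_laws]) show that b, B and the Alexander-Whitney map preserve
    normalized elements.  Therefore the family y (x) z lies in Tot degree by degree,
    the chain property of the extended Alexander-Whitney map can be summed over the
    homogeneous components ([AWbar_chain]), and the composite with Phi satisfies a
    Leibniz rule ([cup_Leibniz]).  Cocycles are sent to cocycles, and the product
    is a coboundary as soon as one factor is, which makes it well defined and
    bilinear on cohomology classes.

    All computations are done on functions of lists: a cochain is evaluated on a
    list of arguments, and the codiagonal coaction and the diagonal action on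
    tensor powers become the recursive sums [coactL] and [actL].  Every Sweedler
    cancellation then involves only one or two list entries and proceeds by
    induction along the list. *)

(** * Sweedler sums and linearity *)

Section SweedlerSum.
Variable K : fieldType.

(** The value at t of the linear map induced by F, for F bilinear.  Taking F
    curried lets nested sums read like Sweedler notation, one binder per factor. *)
Definition tsum (V W : lmodType K) (U : nmodType) (t : tens V W) (F : V -> W -> U) : U :=
  \sum_(p <- terms t) F p.1 p.2.

Section Basic.
Variables V W U : lmodType K.
Implicit Types (t : tens V W) (F : V -> W -> U).

Lemma eq_tsum t F G : (forall v w, F v w = G v w) -> tsum t F = tsum t G.
Proof. by move=> e; apply: eq_bigr. Qed.

Lemma tsum_lin F : bilinear_map F -> linear (fun t => tsum t F).
Proof. exact: terms_lin. Qed.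

Lemma tsum_pure F v w : bilinear_map F -> tsum (v \ox w) F = F v w.
Proof. by move=> bF; apply: terms_pure. Qed.

Lemma tsum_map (U' : lmodType K) (L : U -> U') t F : linear L ->
  L (tsum t F) = tsum t (fun v w => L (F v w)).
Proof. exact: linear_sum_of. Qed.

Lemma tsum_param (Z : lmodType K) t (F : V -> W -> Z -> U) :
  (forall v w, linear (F v w)) -> linear (fun z => tsum t (fun v w => F v w z)).
Proof. by move=> lF; apply: sum_lin. Qed.

Lemma tsum_comp (Z : lmodType K) (f : Z -> tens V W) F :
  linear f -> bilinear_map F -> linear (fun z => tsum (f z) F).
Proof. by move=> lf bF; apply: (comp_lin (tsum_lin bF) lf). Qed.

End Basic.

Lemma tsum_exch (V W V' W' U : lmodType K) (t : tens V W) (t' : tens V' W')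
    (F : V -> W -> V' -> W' -> U) :
  tsum t (fun v w => tsum t' (F v w)) =
  tsum t' (fun v' w' => tsum t (fun v w => F v w v' w')).
Proof. exact: exchange_big. Qed.

Definition trilinear_map (X Y Z U : lmodType K) (g : X -> Y -> Z -> U) :=
  [/\ forall y z, linear (fun x => g x y z), forall x z, linear (fun y => g x y z) &
      forall x y, linear (g x y)].

Lemma bilinearP (X Y U : lmodType K) (f : X -> Y -> U) :
  (forall y, linear (fun x => f x y)) -> (forall x, linear (fun y => f x y)) ->
  bilinear_map f.
Proof. by []. Qed.

Lemma trilinearP (X Y Z U : lmodType K) (g : X -> Y -> Z -> U) :
  (forall y z, linear (fun x => g x y z)) -> (forall x z, linear (fun y => g x y z)) ->
  (forall x y, linear (fun z => g x y z)) -> trilinear_map g.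
Proof. by []. Qed.

Lemma lin_id (X : lmodType K) : linear (fun x : X => x).
Proof. by []. Qed.

Lemma lin_scale (X U : lmodType K) (f : X -> U) (a : K) :
  linear f -> linear (fun x => a *: f x).
Proof. by move=> lf c x y; rewrite lf scalerDr !scalerA mulrC. Qed.

Lemma lin_scalel (X U : lmodType K) (f : X -> K) (u : U) :
  (forall c x y, f (c *: x + y) = c * f x + f y) -> linear (fun x => f x *: u).
Proof. by move=> lf c x y; rewrite lf scalerDl scalerA. Qed.

Lemma lin_bil_l (X Y Z U : lmodType K) (B : X -> Y -> U) (f : Z -> X) (y : Y) :
  bilinear_map B -> linear f -> linear (fun z => B (f z) y).
Proof. by move=> [b1 _] lf; apply: (comp_lin (b1 y) lf). Qed.

Lemma lin_bil_r (X Y Z U : lmodType K) (B : X -> Y -> U) (f : Z -> Y) (x : X) :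
  bilinear_map B -> linear f -> linear (fun z => B x (f z)).
Proof. by move=> [_ b2] lf; apply: (comp_lin (b2 x) lf). Qed.

Lemma amul_bil (H : ualgType K) : bilinear_map (@amul K H).
Proof. by split=> [y|x]; [apply: amul_linl|apply: amul_linr]. Qed.

Lemma pure_bil (V W : lmodType K) : bilinear_map (fun (v : V) (w : W) => v \ox w).
Proof. by split=> [w|v]; [apply: pure_linl|apply: pure_linr]. Qed.

End SweedlerSum.

(** The composite linearity side conditions of Sweedler calculus: [lin] walks
    down the term to the single occurrence of the variable. *)
Ltac lin_hopf := fail.
Ltac lin_lists := fail.
Ltac lin :=
  lazymatch goal with
  | |- bilinear_map _ => apply: bilinearP => ?; lin
  | |- trilinear_map _ => apply: trilinearP => ? ?; lin
  | |- forall _, _ => move=> ?; lin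
  | |- GRing.linear_for _ _ => first
    [ exact: lin_id
    | solve [lin_hopf]
    | solve [lin_lists]
    | (apply: tsum_param => ? ?; solve [lin])
    | (apply: tsum_comp; solve [lin])
    | (apply: (lin_bil_l _ (@amul_bil _ _)); solve [lin])
    | (apply: (lin_bil_r _ (@amul_bil _ _)); solve [lin])
    | (apply: (lin_bil_l _ (@pure_bil _ _ _)); solve [lin])
    | (apply: (lin_bil_r _ (@pure_bil _ _ _)); solve [lin])
    | (apply: lin_scale; solve [lin])
    | (apply: lin_scalel => ? ? ?; rewrite ?linearP //=)
    | (apply: linearP)
    | (apply: (comp_lin (@linearP _ _ _ _ _)); solve [lin])
    | done ]
  end.

(** * Hopf algebras: the antipode and its inverse *)

Ltac lin_hopf ::= first
  [ (apply: (comp_lin (@antipV_lin _ _ _)); solve [lin])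
  | exact: antipV_lin
  | exact: hom_linear
  | (apply: (comp_lin (@hom_linear _ _ _ _)); solve [lin])
  | (apply: (lin_bil_l _ (lact_bil (ma_actP _))); solve [lin])
  | (apply: (lin_bil_r _ (lact_bil (ma_actP _))); solve [lin])
  | (apply: (lin_bil_l _ (lact_bil (sc_actP _))); solve [lin])
  | (apply: (lin_bil_r _ (lact_bil (sc_actP _))); solve [lin])
  | (apply: (lin_bil_l _ (ract_bil (sm_actP _))); solve [lin])
  | (apply: (lin_bil_r _ (ract_bil (sm_actP _))); solve [lin])
  | (apply: (comp_lin (coact_lin (ca_rhoP _))); solve [lin])
  | (apply: (comp_lin (coact_lin (sm_rhoP _))); solve [lin]) ].

Section Antipode.
Variables (K : fieldType) (H : ualgType K) (hH : hopf H).

Lemma tsum_coassoc (V U : lmodType K) (rho : V -> tens H V) (g : H -> H -> V -> U) v :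
  left_coaction hH rho -> trilinear_map g ->
  tsum (rho v) (fun x w => tsum (Delta hH x) (fun x1 x2 => g x1 x2 w)) =
  tsum (rho v) (fun x w => tsum (rho w) (fun y w' => g x y w')).
Proof. by move=> rP [g1 g2 g3]; apply: coactA_sum rP g1 g2 g3. Qed.

Lemma tsum_counit (V U : lmodType K) (rho : V -> tens H V) (f : V -> U) v :
  left_coaction hH rho -> linear f ->
  tsum (rho v) (fun x w => counit hH x *: f w) = f v.
Proof.
move=> rP lf; rewrite -[in RHS](coact1 rP v) (linear_sum_of _ _ lf).
by apply: eq_bigr => p _; rewrite (linearZ_of _ _ lf).
Qed.

Lemma Delta_coaction : left_coaction hH (Delta hH).
Proof. by split=> [|h|h]; [exact: linearP|apply: DeltaA|apply: counitl]. Qed.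

Lemma tsum_DeltaA (U : lmodType K) (g : H -> H -> H -> U) h : trilinear_map g ->
  tsum (Delta hH h) (fun x y => tsum (Delta hH x) (fun x1 x2 => g x1 x2 y)) =
  tsum (Delta hH h) (fun x y => tsum (Delta hH y) (fun y1 y2 => g x y1 y2)).
Proof. by move=> tg; apply: (tsum_coassoc h Delta_coaction tg). Qed.

Lemma tsum_counitl (U : lmodType K) (f : H -> U) h : linear f ->
  tsum (Delta hH h) (fun x y => counit hH x *: f y) = f h.
Proof. by move=> lf; apply: (tsum_counit h Delta_coaction lf). Qed.

Lemma tsum_counitr (U : lmodType K) (f : H -> U) h : linear f ->
  tsum (Delta hH h) (fun x y => counit hH y *: f x) = f h.
Proof.
move=> lf; rewrite -[in RHS](counitr hH h) (linear_sum_of _ _ lf).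
by apply: eq_bigr => p _; rewrite (linearZ_of _ _ lf).
Qed.

Lemma tsum_DeltaM (U : lmodType K) (f : H -> H -> U) g h : bilinear_map f ->
  tsum (Delta hH (g ** h)) f = tsum (Delta hH g) (fun g1 g2 =>
    tsum (Delta hH h) (fun h1 h2 => f (g1 ** h1) (g2 ** h2))).
Proof.
move=> bf; rewrite DeltaM (linear_sum_of _ _ (tsum_lin bf)).
by apply: eq_bigr => p _; rewrite (linear_sum_of _ _ (tsum_lin bf)); apply: eq_bigr => q _;
  rewrite tsum_pure.
Qed.

Lemma tsum_antipl (U : lmodType K) (f : H -> U) h : linear f ->
  tsum (Delta hH h) (fun x y => f (antip hH x ** y)) = counit hH h *: f aone.
Proof.
by move=> lf; rewrite -(linearZ_of _ _ lf) -(antipl hH) (linear_sum_of _ _ lf).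
Qed.

Lemma tsum_antipr (U : lmodType K) (f : H -> U) h : linear f ->
  tsum (Delta hH h) (fun x y => f (x ** antip hH y)) = counit hH h *: f aone.
Proof.
by move=> lf; rewrite -(linearZ_of _ _ lf) -(antipr hH) (linear_sum_of _ _ lf).
Qed.

(** Both sides are values of the convolution
    S(g_1 h_1) g_2 h_2 S(h_3) S(g_3): contracting the last four factors leaves
    S(g h), contracting the first three leaves S(h) S(g). *)
Lemma antipM g h : antip hH (g ** h) = antip hH h ** antip hH g.
Proof.
pose P x y1 y2 u v1 v2 : H :=
  (antip hH (x ** u) ** (y1 ** v1)) ** (antip hH v2 ** antip hH y2).
pose E := tsum (Delta hH g) (fun x y => tsum (Delta hH y) (fun y1 y2 =>
  tsum (Delta hH h) (fun u v => tsum (Delta hH v) (fun v1 v2 => P x y1 y2 u v1 v2)))).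
have E1 : E = antip hH (g ** h).
  transitivity (tsum (Delta hH g) (fun x y => counit hH y *: antip hH (x ** h))).
    apply: eq_tsum => x y.
    rewrite -[antip hH (x ** h)]amul1r.
    rewrite -(@tsum_antipr _ (fun z => antip hH (x ** h) ** z) y); last by lin.
    apply: eq_tsum => y1 y2.
    transitivity (tsum (Delta hH h) (fun u v => counit hH v *:
        (antip hH (x ** u) ** (y1 ** antip hH y2)))).
      apply: eq_tsum => u v; rewrite -{2}[y1]amul1r.
      rewrite -(@tsum_antipr _ (fun z => antip hH (x ** u) ** ((y1 ** z) ** antip hH y2)) v).
        by apply: eq_tsum => v1 v2; rewrite /P !amulA.
      lin.
    by apply: (@tsum_counitr _ (fun u => antip hH (x ** u) ** (y1 ** antip hH y2))); lin.
  by apply: (@tsum_counitr _ (fun x => antip hH (x ** h))); lin.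
rewrite -E1 /E.
have -> : antip hH h ** antip hH g = tsum (Delta hH g) (fun x y =>
    counit hH x *: (antip hH h ** antip hH y)).
  by rewrite (@tsum_counitl _ (fun y => antip hH h ** antip hH y)) //; lin.
transitivity (tsum (Delta hH g) (fun x y => tsum (Delta hH x) (fun x1 x2 =>
  tsum (Delta hH h) (fun u v => tsum (Delta hH u) (fun u1 u2 => P x1 x2 y u1 u2 v))))).
  rewrite (tsum_DeltaA (g := fun x1 x2 y => tsum (Delta hH h) (fun u v =>
     tsum (Delta hH u) (fun u1 u2 => P x1 x2 y u1 u2 v)))); last by rewrite /P; lin.
  apply: eq_tsum => x y; apply: eq_tsum => y1 y2.
  rewrite -(tsum_DeltaA (g := fun u1 u2 v => P x y1 y2 u1 u2 v)); last by rewrite /P; lin.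
  by [].
apply: eq_tsum => x y; rewrite tsum_exch.
rewrite -(@tsum_counitl _ (fun h => antip hH h ** antip hH y)); last by lin.
rewrite (tsum_map _ _ (@lin_scale _ _ _ _ (counit hH x) (@lin_id _ H))).
apply: eq_tsum => u v.
rewrite scalerA -counitM -[antip hH v ** _]amul1l.
rewrite -(@tsum_antipl _ (fun z => z ** (antip hH v ** antip hH y))); last by lin.
by rewrite tsum_DeltaM //; lin.
Qed.

Lemma antip1 : antip hH aone = aone.
Proof.
have := @tsum_antipl _ id aone (fun _ _ _ => erefl).
by rewrite Delta1 tsum_pure; [rewrite /= amul1r counit1 scale1r|lin].
Qed.

Lemma antipVM g h : antipV hH (g ** h) = antipV hH h ** antipV hH g.
Proof. by apply: (can_inj (antipK hH)); rewrite antipM !antipVK. Qed.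

Lemma antipV1 : antipV hH aone = aone.
Proof. by apply: (can_inj (antipK hH)); rewrite antip1 antipVK. Qed.

Lemma tsum_antipVl (U : lmodType K) (f : H -> U) h : linear f ->
  tsum (Delta hH h) (fun x y => f (antipV hH y ** x)) = counit hH h *: f aone.
Proof.
move=> lf; transitivity (f (antipV hH (counit hH h *: aone))).
  rewrite -(antipl hH) (linear_sum_of _ _ (@antipV_lin _ _ hH)) (linear_sum_of _ _ lf).
  by apply: eq_bigr => p _; rewrite antipVM antipK.
by rewrite (linearZ_of _ _ (@antipV_lin _ _ hH)) antipV1 (linearZ_of _ _ lf).
Qed.

Lemma tsum_antipVr (U : lmodType K) (f : H -> U) h : linear f ->
  tsum (Delta hH h) (fun x y => f (y ** antipV hH x)) = counit hH h *: f aone.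
Proof.
move=> lf; transitivity (f (antipV hH (counit hH h *: aone))).
  rewrite -(antipr hH) (linear_sum_of _ _ (@antipV_lin _ _ hH)) (linear_sum_of _ _ lf).
  by apply: eq_bigr => p _; rewrite antipVM antipK.
by rewrite (linearZ_of _ _ (@antipV_lin _ _ hH)) antipV1 (linearZ_of _ _ lf).
Qed.

Lemma counitV h : counit hH (antipV hH h) = counit hH h.
Proof.
have := @tsum_antipVl _ (counit hH : H -> K^o) h (@linearP _ _ _ _ _).
rewrite counit1 => e; rewrite -[RHS]mulr1 -[RHS]/(counit hH h *: (1 : K^o)) -{}e.
rewrite -(@tsum_counitl K^o (fun y => counit hH (antipV hH y))) //.
  by apply: eq_bigr => p _; rewrite counitM mulrC.
by move=> a x y; rewrite antipV_lin linearP.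
Qed.

Section ModuleAlgebra.
Variables (A : ualgType K) (mA : moduleAlgebra hH A).
Local Notation act := (ma_act mA).

Lemma antipV_act1 h : act (antipV hH h) aone = counit hH h *: aone.
Proof. by rewrite ma_act1 counitV. Qed.

(** Let g(h) be the right-hand side.  Then h_2 . g(h_1) = eps(h) a b, because
    h_2 S^{-1}(h_1) = eps(h); acting by S^{-1}(h_3) on h_2 . g(h_1) isolates g(h).
    This avoids the coproduct of S^{-1}(h). *)
Lemma antipV_actM h a b : act (antipV hH h) (a ** b) =
  tsum (Delta hH h) (fun x y => act (antipV hH y) a ** act (antipV hH x) b).
Proof.
pose g h := tsum (Delta hH h) (fun x y => act (antipV hH y) a ** act (antipV hH x) b).
have lg : linear g by rewrite /g; lin.
have hg k : tsum (Delta hH k) (fun x y => act y (g x)) = counit hH k *: (a ** b).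
  transitivity (tsum (Delta hH k) (fun x w => tsum (Delta hH w) (fun y z =>
      act z (act (antipV hH y) a ** act (antipV hH x) b)))).
    rewrite -(tsum_DeltaA (g := fun x y z => act z (act (antipV hH y) a ** act (antipV hH x) b))); last by lin.
    by apply: eq_tsum => x y; rewrite /g (tsum_map _ _ ((lact_bil (ma_actP mA)).2 _)).
  transitivity (tsum (Delta hH k) (fun x w => a ** act w (act (antipV hH x) b))).
    apply: eq_tsum => x w.
    transitivity (tsum (Delta hH w) (fun u v => tsum (Delta hH u) (fun u1 u2 =>
       act (u2 ** antipV hH u1) a ** act v (act (antipV hH x) b)))).
      rewrite (tsum_DeltaA (g := fun u1 u2 v =>
        act (u2 ** antipV hH u1) a ** act v (act (antipV hH x) b))); last by lin.
      apply: eq_tsum => y z; rewrite ma_actM; apply: eq_bigr => p _.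
      by rewrite (lactM (ma_actP mA)).
    rewrite -(@tsum_counitl _ (fun v => a ** act v (act (antipV hH x) b)) w); last by lin.
    apply: eq_tsum => u v.
    rewrite (@tsum_antipVr _ (fun z => act z a ** act v (act (antipV hH x) b))); last by lin.
    by rewrite (lact1 (ma_actP mA)).
  rewrite -[in RHS](@lact1 _ _ _ _ (ma_actP mA) b) -/act.
  rewrite -(@tsum_antipVr _ (fun z => a ** act z b)); last by lin.
  by apply: eq_tsum => x y; rewrite (lactM (ma_actP mA)).
rewrite -[RHS]/(g h) -(@tsum_counitr _ g h lg).
transitivity (tsum (Delta hH h) (fun x w => tsum (Delta hH w) (fun y z =>
   act (antipV hH z ** y) (g x)))); last first.
  apply: eq_tsum => x w.
  rewrite (@tsum_antipVl _ (fun z => act z (g x))); last by lin.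
  by rewrite (lact1 (ma_actP mA)).
rewrite -(tsum_DeltaA (g := fun x y z => act (antipV hH z ** y) (g x))); last by lin.
rewrite -(@tsum_counitl _ (fun z => act (antipV hH z) (a ** b))); last by lin.
apply: eq_tsum => x y; rewrite -(linearZ_of _ _ ((lact_bil (ma_actP mA)).2 _)).
rewrite -hg (tsum_map _ _ ((lact_bil (ma_actP mA)).2 _)); apply: eq_tsum => u v.
by rewrite (lactM (ma_actP mA)).
Qed.
End ModuleAlgebra.

End Antipode.

(** * Multilinear functions of lists *)

Section ListMultilinear.
Variable K : fieldType.

(** Lists of length n stand for pure tensors of degree n, and multilinearity is
    asked on those alone; hence the side conditions on sizes below. *)
Definition mlin (V U : lmodType K) n (F : seq V -> U) :=
  forall s1 s2, (size s1 + (size s2).+1 = n)%N -> linear (fun x => F (s1 ++ x :: s2)).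

(** The functions summed over the coaction of a list: the argument in front
    receives the product of the b_<-1>. *)
Definition hml (W V U : lmodType K) n (G : W -> seq V -> U) :=
  (forall s, size s = n -> linear (fun h => G h s)) /\ (forall h, mlin n (G h)).

Section Mlin.
Variables V U : lmodType K.
Implicit Types F : seq V -> U.

Lemma mlin0 F : mlin 0 F. Proof. by move=> s1 s2; rewrite addnS. Qed.

Lemma mlin_cons n F x : mlin n.+1 F -> mlin n (fun s => F (x :: s)).
Proof. by move=> mF s1 s2 e; apply: (mF (x :: s1)); rewrite /= addSn e. Qed.

Lemma mlin_head n F s : mlin n.+1 F -> size s = n -> linear (fun x => F (x :: s)).
Proof. by move=> mF e; apply: (mF [::]); rewrite add0n e. Qed.

Lemma mlinS n F : (forall s, size s = n -> linear (fun x => F (x :: s))) ->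
  (forall x, mlin n (fun s => F (x :: s))) -> mlin n.+1 F.
Proof.
move=> l0 lS [|y s1] s2 /=; first by rewrite add0n => -[/l0].
by rewrite addSn => -[e]; apply: lS.
Qed.

Lemma lin_head (Z : lmodType K) (f : Z -> V) n F s :
  mlin n.+1 F -> size s = n -> linear f -> linear (fun z => F (f z :: s)).
Proof. by move=> mF e lf; apply: (comp_lin (mlin_head mF e) lf). Qed.

Lemma mlin_map (U' : lmodType K) (L : U -> U') n F :
  linear L -> mlin n F -> mlin n (fun s => L (F s)).
Proof. by move=> lL mF s1 s2 e; apply: (comp_lin lL (mF _ _ e)). Qed.

Lemma mlin_tsum (V' W' : lmodType K) (t : tens V' W') n (F : V' -> W' -> seq V -> U) :
  (forall v w, mlin n (F v w)) -> mlin n (fun s => tsum t (fun v w => F v w s)).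
Proof. by move=> mF s1 s2 e; apply: tsum_param => v w; apply: mF. Qed.

Lemma hml_cons (W : lmodType K) n (G : W -> seq V -> U) x :
  hml n.+1 G -> hml n (fun h s => G h (x :: s)).
Proof. by move=> [g1 g2]; split=> [s e|h]; [apply: g1; rewrite /= e|apply: mlin_cons]. Qed.

Lemma hml_comp (W W' : lmodType K) n (f : W' -> W) (G : W -> seq V -> U) :
  linear f -> hml n G -> hml n (fun h s => G (f h) s).
Proof. by move=> lf [g1 g2]; split=> [s e|h]; [apply: (comp_lin (g1 _ e) lf)|apply: g2]. Qed.

End Mlin.

Section ListOps.
Variable A : ualgType K.

(** Inner cofaces and codegeneracies precompose a cochain with these; codegeneracy
    j inserts its unit at position j + 1. *)
Fixpoint mg (i : nat) (s : seq A) : seq A :=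
  match i, s with
  | 0, [:: x, y & s'] => x ** y :: s'
  | j.+1, x :: s' => x :: mg j s'
  | _, _ => s
  end.

Fixpoint ins (i : nat) (s : seq A) : seq A :=
  match i, s with
  | j.+1, x :: s' => x :: ins j s'
  | _, _ => aone :: s
  end.

Lemma size_mg i s : (i.+1 < size s)%N -> size (mg i s) = (size s).-1.
Proof.
elim: i s => [|i IH] [|x s] //=; first by case: s.
by rewrite ltnS => h; rewrite IH // prednK //; apply: leq_ltn_trans h.
Qed.

Lemma size_ins i s : size (ins i s) = (size s).+1.
Proof. by elim: i s => [|i IH] [|x s] //=; rewrite IH. Qed.

Variable U : lmodType K.

Lemma mlin_mg i n (F : seq A -> U) : (i < n)%N -> mlin n F ->
  mlin n.+1 (fun s => F (mg i s)).
Proof.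
elim: i n F => [|i IH] [|n] F // lin mF.
  apply: mlinS => [[|y s] //= [e]|x].
    by apply: (lin_head mF e); apply: amul_linl.
  apply: mlinS => [s e|y]; first by apply: (lin_head mF e); apply: amul_linr.
  exact: mlin_cons.
apply: mlinS => [s e|x] /=.
  by apply: (mlin_head mF); rewrite size_mg e.
by apply: (IH _ (fun t => F (x :: t))) => //; apply: mlin_cons.
Qed.

End ListOps.
End ListMultilinear.

(** * The codiagonal coaction on lists *)

Section CoactionOnLists.
Variables (K : fieldType) (H : ualgType K) (hH : hopf H).
Variables (B : ualgType K) (cB : comoduleAlgebra hH B).
Local Notation rho := (ca_rho cB).

Lemma tsum_rhoM (U : lmodType K) (f : H -> B -> U) b c : bilinear_map f ->
  tsum (rho (b ** c)) f = tsum (rho b) (fun u b' =>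
    tsum (rho c) (fun v c' => f (u ** v) (b' ** c'))).
Proof.
move=> bf; rewrite ca_rhoM (linear_sum_of _ _ (tsum_lin bf)).
by apply: eq_bigr => p _; rewrite (linear_sum_of _ _ (tsum_lin bf)); apply: eq_bigr => q _;
  rewrite tsum_pure.
Qed.

(** The Sweedler sum of G over h (x) (b^0_<0>, ..., b^n_<0>) with
    h = b^0_<-1> ... b^n_<-1>. *)
Fixpoint coactL (U : lmodType K) (bs : seq B) (G : H -> seq B -> U) : U :=
  if bs is b :: bs' then
    tsum (rho b) (fun u b' => coactL bs' (fun h s => G (u ** h) (b' :: s)))
  else G aone [::].

Section Lemmas.
Variable U : lmodType K.
Implicit Types (G : H -> seq B -> U).

Lemma eq_coactL bs G G' : (forall h s, size s = size bs -> G h s = G' h s) ->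
  coactL bs G = coactL bs G'.
Proof.
elim: bs G G' => [|b bs IH] G G' e /=; first exact: e.
by apply: eq_tsum => u b'; apply: IH => h s es; apply: e; rewrite /= es.
Qed.

Lemma coactL_map (U' : lmodType K) (L : U -> U') bs G : linear L ->
  L (coactL bs G) = coactL bs (fun h s => L (G h s)).
Proof.
move=> lL; elim: bs G => [|b bs IH] G //=.
by rewrite (tsum_map _ _ lL); apply: eq_tsum => u b'; apply: IH.
Qed.

Lemma coactL_param (Z : lmodType K) bs (G : Z -> H -> seq B -> U) :
  (forall h s, size s = size bs -> linear (fun z => G z h s)) ->
  linear (fun z => coactL bs (G z)).
Proof.
elim: bs G => [|b bs IH] G lG /=; first exact: lG.
by apply: tsum_param => u b'; apply: IH => h s e; apply: lG; rewrite /= e.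
Qed.

Lemma coactL_mlin n G : hml n G -> mlin n (fun bs => coactL bs G).
Proof.
elim: n G => [|n IH] G [g1 g2]; first exact: mlin0.
apply: mlinS => [s e|x] /=.
  apply: (tsum_comp (coact_lin (ca_rhoP cB))); split=> [b|u].
    apply: coactL_param => h s' es; apply: (comp_lin (g1 _ _)); last exact: amul_linl.
    by rewrite /= es e.
  apply: coactL_param => h s' es; apply: (mlin_head (g2 _)); by rewrite es.
apply: mlin_tsum => u b; apply: IH; split=> [s e|h]; last exact: mlin_cons.
by apply: (comp_lin (g1 _ _)); [rewrite /= e|exact: amul_linr].
Qed.

Lemma coactL_tsum (V W : lmodType K) (t : tens V W) bs (F : H -> seq B -> V -> W -> U) :
  coactL bs (fun h s => tsum t (F h s)) =
  tsum t (fun v w => coactL bs (fun h s => F h s v w)).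
Proof.
elim: bs F => [|b bs IH] F //=.
by rewrite tsum_exch; apply: eq_tsum => u b'; apply: IH.
Qed.

Lemma coactL_rcons bs b G : coactL (rcons bs b) G =
  tsum (rho b) (fun u b' => coactL bs (fun h s => G (h ** u) (rcons s b'))).
Proof.
elim: bs G => [|c bs IH] G /=.
  by apply: eq_tsum => u b'; rewrite amul1l amul1r.
rewrite tsum_exch; apply: eq_tsum => u b'.
by rewrite IH; apply: eq_tsum => v b''; apply: eq_coactL => h s _; rewrite amulA.
Qed.

(** Coassociativity holds factor by factor because Delta is multiplicative. *)
Lemma coactL_assoc n bs (G : H -> H -> seq B -> U) : size bs = n ->
  (forall x, hml n (G x)) -> (forall y, hml n (fun x => G x y)) ->
  coactL bs (fun h s => tsum (Delta hH h) (fun x y => G x y s)) =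
  coactL bs (fun x s => coactL s (fun y s' => G x y s')).
Proof.
elim: n bs G => [|n IH] [|b bs] G //= => [_|[e]] g1 g2.
  by rewrite Delta1 tsum_pure //; split=> [y|x]; [apply: (g2 y).1|apply: (g1 x).1].
have gm x y : linear (fun z : H => x ** z) by apply: amul_linr.
transitivity (tsum (rho b) (fun u b' => tsum (Delta hH u) (fun u1 u2 =>
   coactL bs (fun x s => coactL s (fun y s' => G (u1 ** x) (u2 ** y) (b' :: s')))))).
  apply: eq_tsum => u b'.
  transitivity (coactL bs (fun h s => tsum (Delta hH u) (fun u1 u2 =>
     tsum (Delta hH h) (fun h1 h2 => G (u1 ** h1) (u2 ** h2) (b' :: s))))).
    apply: eq_coactL => h s es; apply: tsum_DeltaM.
    by split=> [y|x]; [apply: (g2 y).1|apply: (g1 x).1]; rewrite /= es e.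
  rewrite coactL_tsum; apply: eq_tsum => u1 u2.
  apply: (IH _ (fun x y s => G (u1 ** x) (u2 ** y) (b' :: s)) e) => x.
    apply: (@hml_comp _ _ _ _ _ _ _ (fun h s => G (u1 ** x) h (b' :: s))).
      exact: amul_linr.
    exact: hml_cons.
  apply: (@hml_comp _ _ _ _ _ _ _ (fun h s => G h (u2 ** x) (b' :: s))).
    exact: amul_linr.
  exact: (hml_cons b' (g2 _)).
rewrite (tsum_coassoc (g := fun u1 u2 b' => coactL bs (fun x s =>
   coactL s (fun y s' => G (u1 ** x) (u2 ** y) (b' :: s')))) _ (ca_rhoP cB)).
  by apply: eq_tsum => u b'; rewrite -coactL_tsum.
split=> [u2 b'|u1 b'|u1 u2]; apply: coactL_param => x s es;
  apply: coactL_param => y s' es'.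
- apply: (comp_lin ((g2 _).1 _ _)); last exact: amul_linl.
  by rewrite /= es' es e.
- apply: (comp_lin ((g1 _).1 _ _)); last exact: amul_linl.
  by rewrite /= es' es e.
- by apply: (mlin_head ((g1 _).2 _)); rewrite es' es e.
Qed.

Lemma coactL_counit n bs (F : seq B -> U) : size bs = n -> mlin n F ->
  coactL bs (fun h s => counit hH h *: F s) = F bs.
Proof.
elim: n bs F => [|n IH] [|b bs] F //= => [_ _|[e] mF].
  by rewrite counit1 scale1r.
rewrite -[RHS](tsum_counit b (ca_rhoP cB) (mlin_head mF e)).
apply: eq_tsum => u b'; rewrite -(IH bs (fun s => F (b' :: s)) e); last exact: mlin_cons.
rewrite (coactL_map _ _ (@lin_scale _ _ _ _ (counit hH u) (@lin_id _ U))).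
by apply: eq_coactL => h s _; rewrite counitM scalerA.
Qed.

(** This is the multiplicativity of the coaction of B. *)
Lemma coactL_mg n i bs G : size bs = n.+1 -> (i < n)%N -> hml n G ->
  coactL (mg i bs) G = coactL bs (fun h s => G h (mg i s)).
Proof.
elim: i n bs G => [|i IH] [|n] [|b [|c bs]] G //= [e] lin [g1 g2].
  rewrite tsum_rhoM; last first.
    split=> [b'|u]; apply: coactL_param => h s es.
      apply: (comp_lin (g1 _ _)); last exact: amul_linl.
      by rewrite /= es e.
    by apply: (mlin_head (g2 _)); rewrite es.
  apply: eq_tsum => u b'; apply: eq_tsum => v c'; apply: eq_coactL => h s es.
  by rewrite amulA.
apply: eq_tsum => u b'.
apply: (IH n (c :: bs) (fun h s => G (u ** h) (b' :: s))) => //=; first by rewrite e.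
split=> [s es|h]; last exact: mlin_cons.
by apply: (comp_lin (g1 _ _)); [rewrite /= es|exact: amul_linr].
Qed.

Lemma coactL_ins n i bs G : size bs = n -> (i <= n)%N -> hml n.+1 G ->
  coactL (ins i bs) G = coactL bs (fun h s => G h (ins i s)).
Proof.
have base bs' G' : hml (size bs').+1 G' ->
    coactL (aone :: bs') G' = coactL bs' (fun h s => G' h (aone :: s)).
  move=> [g1 g2] /=; rewrite ca_rho1 tsum_pure.
    by apply: eq_coactL => h s _; rewrite amul1l.
  split=> [b'|u]; apply: coactL_param => h s es.
    by apply: (comp_lin (g1 _ _)); [rewrite /= es|exact: amul_linl].
  by apply: (mlin_head (g2 _)).
elim: i n bs G => [|i IH] n bs G e lin gG.
  by case: bs e => [|b bs] e; apply: base; rewrite e.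
case: n bs e lin gG => [|n] [|b bs] //= [e] lin gG.
  apply: eq_tsum => u b'; case: gG => g1 g2.
  apply: (IH n bs) => //; split=> [s es|h]; last exact: mlin_cons.
  by apply: (comp_lin (g1 _ _)); [rewrite /= es|exact: amul_linr].
Qed.
End Lemmas.
End CoactionOnLists.

(** * The diagonal action on lists *)

Section ActionOnLists.
Variables (K : fieldType) (H : ualgType K) (hH : hopf H).
Variables (A : ualgType K) (mA : moduleAlgebra hH A).
Local Notation act := (ma_act mA).

(** The Sweedler sum of F over (h_(1) . a^0, ..., h_(n+1) . a^n); the counit at
    the empty list makes this the trivial action in degree zero. *)
Fixpoint actL (U : lmodType K) (h : H) (s : seq A) (F : seq A -> U) : U :=
  if s is a :: s' then tsum (Delta hH h) (fun x y => actL y s' (fun t => F (act x a :: t)))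
  else counit hH h *: F [::].

Section Lemmas.
Variable U : lmodType K.
Implicit Types (F : seq A -> U).

Lemma eq_actL h s F F' : (forall t, size t = size s -> F t = F' t) ->
  actL h s F = actL h s F'.
Proof.
elim: s h F F' => [|a s IH] h F F' e /=; first by rewrite e.
by apply: eq_tsum => x y; apply: IH => t et; apply: e; rewrite /= et.
Qed.

Lemma actL_map (U' : lmodType K) (L : U -> U') h s F : linear L ->
  L (actL h s F) = actL h s (fun t => L (F t)).
Proof.
move=> lL; elim: s h F => [|a s IH] h F /=; first by rewrite (linearZ_of _ _ lL).
by rewrite (tsum_map _ _ lL); apply: eq_tsum => x y; apply: IH.
Qed.

Lemma actL_param (Z : lmodType K) h s (F : Z -> seq A -> U) :
  (forall t, size t = size s -> linear (fun z => F z t)) ->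
  linear (fun z => actL h s (F z)).
Proof.
elim: s h F => [|a s IH] h F lF /=; first by apply: lin_scale; apply: lF.
by apply: tsum_param => x y; apply: IH => t e; apply: lF; rewrite /= e.
Qed.

Lemma actL_linh n s F : size s = n -> mlin n F -> linear (fun h => actL h s F).
Proof.
elim: n s F => [|n IH] [|a s] F //= => [_ _|[e] mF]; first by lin.
apply: (tsum_comp (@linearP _ _ _ _ _)); split=> [y|x].
  by apply: actL_param => t et; apply: (lin_head mF); [rewrite et|lin].
by apply: (IH s (fun t => F (act x a :: t))) => //; apply: mlin_cons.
Qed.

Lemma actL_tsum (V W : lmodType K) (t : tens V W) h s (F : seq A -> V -> W -> U) :
  actL h s (fun s' => tsum t (F s')) = tsum t (fun v w => actL h s (fun s' => F s' v w)).
Proof.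
elim: s h F => [|a s IH] h F /=.
  by rewrite (tsum_map _ _ (@lin_scale _ _ _ _ (counit hH h) (@lin_id _ U))).
by rewrite tsum_exch; apply: eq_tsum => x y; apply: IH.
Qed.

Lemma actL_rcons n s a h F : size s = n -> mlin n.+1 F ->
  actL h (rcons s a) F = tsum (Delta hH h) (fun x y =>
    actL x s (fun t => F (rcons t (act y a)))).
Proof.
elim: n s h F => [|n IH] [|b s] h F //= => [_|[e]] mF.
  have lF : linear (fun x => F [:: act x a]).
    by apply: (@lin_head _ _ _ _ (fun x => act x a) 0 F [::] mF) => //; lin.
  transitivity (F [:: act h a]).
    exact: (@tsum_counitr _ _ hH _ (fun x => F [:: act x a])).
  by rewrite (@tsum_counitl _ _ hH _ (fun y => F [:: act y a])).
transitivity (tsum (Delta hH h) (fun x w => tsum (Delta hH w) (fun y z =>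
   actL y s (fun t => F (act x b :: rcons t (act z a)))))).
  by apply: eq_tsum => x w; rewrite (IH s w (fun t => F (act x b :: t)) e (mlin_cons _ mF)).
rewrite -(tsum_DeltaA hH (g := fun x y z => actL y s (fun t => F (act x b :: rcons t (act z a))))).
  by [].
split=> [y z|x z|x y].
- apply: actL_param => t et; apply: (lin_head mF); last by lin.
  by rewrite size_rcons et e.
- apply: (@actL_linh n) => // s1 s2 es.
  have -> : (fun c => F (act x b :: rcons (s1 ++ c :: s2) (act z a))) =
     (fun c => F ((act x b :: s1) ++ c :: rcons s2 (act z a))).
    by apply/funext => c; rewrite /= rcons_cat.
  by apply: mF; rewrite /= size_rcons addSn addnS es.
- apply: actL_param => t et.
  have -> : (fun z => F (act x b :: rcons t (act z a))) =
     (fun z => F ((act x b :: t) ++ [:: act z a])).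
    by apply/funext => z; rewrite cat_cons -cats1.
  apply: (@comp_lin _ _ _ _ (fun c => F ((act x b :: t) ++ [:: c])) (fun z => act z a)).
    by apply: mF; rewrite /= et e addn1.
  by lin.
Qed.

(** This is the module algebra law: the two parts of h acting on the neighbours
    are the coproduct of the part that acts on their product. *)
Lemma actL_mg n i h s F : size s = n.+1 -> (i < n)%N -> mlin n F ->
  actL h (mg i s) F = actL h s (fun t => F (mg i t)).
Proof.
elim: i n s h F => [|i IH] [|n] [|b [|c s]] h F //= [e] lin mF; last first.
  apply: eq_tsum => x y.
  by rewrite (IH n (c :: s)) //= ?e //; apply: mlin_cons.
rewrite -(tsum_DeltaA hH (g := fun x y z => actL z s (fun t => F (act x b ** act y c :: t)))).
  apply: eq_tsum => x y.
  rewrite ma_actM.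
  have l t : size t = size s -> linear (fun z => F (z :: t)).
    by move=> et; apply: (mlin_head mF); rewrite et.
  transitivity (actL y s (fun t => tsum (Delta hH x) (fun x1 x2 =>
     F (act x1 b ** act x2 c :: t)))).
    by apply: eq_actL => t et; rewrite (linear_sum_of _ _ (l _ et)).
  exact: actL_tsum.
split=> [y z|x z|x y]; last by apply: (@actL_linh n) => //; apply: mlin_cons.
  by apply: actL_param => t et; apply: (lin_head mF); [rewrite et|lin].
by apply: actL_param => t et; apply: (lin_head mF); [rewrite et|lin].
Qed.

Lemma actL_ins n i h s F : size s = n -> (i <= n)%N -> mlin n.+1 F ->
  actL h (ins i s) F = actL h s (fun t => F (ins i t)).
Proof.
have base h' s' F' : mlin (size s').+1 F' ->
    actL h' (aone :: s') F' = actL h' s' (fun t => F' (aone :: t)).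
  move=> mF /=.
  rewrite -(@tsum_counitl _ _ hH _ (fun y => actL y s' (fun t => F' (aone :: t)))).
    apply: eq_tsum => x y.
    rewrite (actL_map _ _ _ (@lin_scale _ _ _ _ (counit hH x) (@lin_id _ U))).
    apply: eq_actL => t et; rewrite ma_act1 (linearZ_of _ _ (mlin_head mF _)) //.
  by apply: actL_linh => //; apply: mlin_cons.
elim: i n s h F => [|i IH] n s h F e lin mF.
  by case: s e => [|b s] e; apply: base; rewrite e.
case: n s e lin mF => [|n] [|b s] //= [e] lin mF.
  apply: eq_tsum => x y.
  by apply: (IH n s) => //; apply: mlin_cons.
Qed.
End Lemmas.
End ActionOnLists.

(** * Cochains evaluated on lists *)

Section ListsAndTuples.
Variable K : fieldType.

Section Conversion.
Variable V : lmodType K.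

Definition fn n (s : seq V) : 'I_n -> V := fun i => s`_i.
Arguments fn n s : clear implicits.
Definition ls n (v : 'I_n -> V) : seq V := [seq v i | i <- enum 'I_n].

Lemma size_ls n (v : 'I_n -> V) : size (ls v) = n.
Proof. by rewrite size_map size_enum_ord. Qed.

Lemma lsK n (v : 'I_n -> V) : fn n (ls v) = v.
Proof.
apply/funext => i; rewrite /fn (nth_map i) ?size_enum_ord //.
by rewrite nth_ord_enum.
Qed.

Lemma ls_fn n s : size s = n -> ls (fn n s) = s.
Proof.
move=> e; apply: (@eq_from_nth _ 0) => [|i]; rewrite size_ls // => lin.
rewrite (nth_map (Ordinal lin)) ?size_enum_ord //.
by rewrite (nth_ord_enum _ (Ordinal lin)).
Qed.

Lemma lsS n (v : 'I_n.+1 -> V) : ls v = v ord0 :: ls (fun j => v (fintype.lift ord0 j)).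
Proof. by rewrite /ls enum_ordSl /= -map_comp. Qed.

Lemma ls0 (v : 'I_0 -> V) : ls v = [::].
Proof. by apply: size0nil; rewrite size_ls. Qed.

Lemma fn_upd n s1 s2 x (lin : (size s1 < n)%N) :
  fn n (s1 ++ x :: s2) = upd (fn n (s1 ++ 0 :: s2)) (Ordinal lin) x.
Proof.
apply/funext => j; rewrite /fn /upd -val_eqE /= !nth_cat.
by case: (ltngtP j (size s1)) => // [h|->]; [rewrite -(subnSK h)|rewrite subnn].
Qed.

Lemma ls_upd n (v : 'I_n -> V) i x :
  ls (upd v i x) = take i (ls v) ++ x :: drop i.+1 (ls v).
Proof.
have lin := ltn_ord i.
apply: (@eq_from_nth _ 0) => [|k].
  by rewrite size_cat /= size_takel ?size_drop !size_ls ?(ltnW lin) // addnS; lia.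
rewrite size_ls => lkn.
have e w : (ls w)`_k = w (Ordinal lkn) by rewrite -[in RHS](lsK w).
rewrite e /upd -val_eqE /= nth_cat size_takel ?size_ls ?(ltnW lin) //.
case: (ltngtP k i) => [h|h|->].
- by rewrite nth_take // e.
- have -> : (k - i = (k - i.+1).+1)%N by lia.
  by rewrite /= nth_drop subnKC // e.
- by rewrite subnn.
Qed.
End Conversion.
Arguments fn {V} n s.

Section Evaluation.
Variables (V M : lmodType K) (n : nat).

Lemma mult_mlin (f : mult n V M) : mlin n (fun s => f (fn n s)).
Proof.
move=> s1 s2 e; have lin : (size s1 < n)%N by rewrite -e -addSnnS leq_addr.
have -> : (fun x => f (fn n (s1 ++ x :: s2))) =
    (fun x => f (upd (fn n (s1 ++ 0 :: s2)) (Ordinal lin) x)).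
  by apply/funext => x; rewrite -fn_upd.
exact: mult_lin.
Qed.

Lemma mlin_mult (F : seq V -> M) : mlin n F ->
  (fun v => F (ls v)) \in @multilin_pred K n V M.
Proof.
move=> mF; apply/asboolP => v i; under [fun x => _]funext => x do rewrite ls_upd.
have lin := ltn_ord i.
by apply: mF; rewrite size_takel ?size_drop size_ls ?(ltnW lin) // addnS; lia.
Qed.

Lemma mult_eqP (f g : mult n V M) :
  (forall s, size s = n -> f (fn n s) = g (fn n s)) -> f = g.
Proof. by move=> e; apply: multP => v; rewrite -(lsK v); apply: e; apply: size_ls. Qed.
End Evaluation.

Section Operations.
Variable A : ualgType K.
Implicit Types s : seq A.

Lemma nth_mg i s j : (i.+1 < size s)%N -> (mg i s)`_j =
  if (j < i)%N then s`_j else if j == i then s`_i ** s`_i.+1 else s`_j.+1.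
Proof.
elim: i s j => [|i IH] [|x s] //= j; first by case: s j => [|y s] // [|j].
by rewrite ltnS => h; case: j => [|j] //=; rewrite IH.
Qed.

Lemma nth_ins i s j : (i <= size s)%N -> (ins i s)`_j =
  if (j < i)%N then s`_j else if j == i then aone else s`_j.-1.
Proof.
elim: i s j => [|i IH] [|x s] // j; try by case: j.
rewrite /= ltnS => h; case: j => [|j] //=; rewrite IH // ltnS eqSS.
by case: (ltngtP j i) => //; case: j.
Qed.

Lemma merge_fn n i s : size s = n.+2 -> (i <= n)%N ->
  Defs.merge i (fn n.+2 s) = fn n.+1 (mg i s).
Proof.
move=> e lin; apply/funext => j; have := ltn_ord j; rewrite /Defs.merge /fn => lj.
rewrite nth_mg ?e // !inordK; try lia.
by case: ifP => //; case: ifP => //; rewrite inordK //; lia.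
Qed.

Lemma insert1_fn n i s : size s = n.+1 -> (i <= n)%N ->
  insert1 i (fn n.+1 s) = fn n.+2 (ins i.+1 s).
Proof.
move=> e lin; apply/funext => j; have := ltn_ord j; rewrite /insert1 /fn => lj.
rewrite nth_ins ?e // ltnS; case: leqP => h; first by rewrite inordK //; lia.
by case: eqP => // _; rewrite inordK //; lia.
Qed.

Lemma fn_last n y s : size s = n -> fn n.+1 (rcons s y) ord_max = y.
Proof. by move=> e; rewrite /fn nth_rcons /= e ltnn eqxx. Qed.

Lemma rotate_fn n x y s : size s = n ->
  rotate x (fn n.+1 (rcons s y)) = fn n.+1 (x :: s).
Proof.
move=> e; apply/funext => j; have lj := ltn_ord j; rewrite /rotate /fn.
rewrite -val_eqE /=; case: j lj => [[|j] hj] //= lj.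
by rewrite inordK ?nth_rcons ?e; [case: ltnP => //; lia|lia].
Qed.

Lemma rotate_merge_fn n x y s : size s = n.+1 ->
  rotate_merge x (fn n.+2 (rcons s y)) = fn n.+1 (mg 0 (x :: s)).
Proof.
case: s => [|z s] //= [e]; apply/funext => j; have lj := ltn_ord j.
rewrite /rotate_merge /fn -val_eqE /=; case: j lj => [[|j] hj] //= lj.
by rewrite inordK /= ?nth_rcons ?e; [case: ltnP => //; lia|lia].
Qed.

Lemma ins_rcons i s y : (i <= size s)%N -> ins i (rcons s y) = rcons (ins i s) y.
Proof. by elim: i s => [|i IH] [|x s] //= h; rewrite IH. Qed.

Lemma ins_size s : ins (size s) s = rcons s aone.
Proof. by elim: s => //= x s ->. Qed.

Lemma ins_ins i j s : (j <= i)%N -> (i <= size s)%N ->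
  ins i.+1 (ins j s) = ins j (ins i s).
Proof.
elim: j i s => [|j IH] [|i] [|x s] //= h1 h2.
by rewrite -IH.
Qed.

Lemma mg_ins_lt i j s : (i < j)%N -> (j < size s)%N ->
  mg i (ins j.+1 s) = ins j (mg i s).
Proof.
elim: i j s => [|i IH] [|j] [|x [|y s]] //= h1 h2.
by rewrite -[in RHS](IH j (y :: s)).
Qed.

Lemma mg_ins_l i s : (i < size s)%N -> mg i (ins i.+1 s) = s.
Proof.
elim: i s => [|i IH] [|x s] //= h; first by rewrite amul1r.
by rewrite [mg i _]IH.
Qed.

Lemma mg_ins_r i s : (i < size s)%N -> mg i (ins i s) = s.
Proof.
elim: i s => [|i IH] [|x s] //= h; first by rewrite amul1l.
by rewrite IH.
Qed.

Lemma mg_ins_gt i j s : (j <= i)%N -> (i.+1 < size s)%N ->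
  mg i.+1 (ins j s) = ins j (mg i s).
Proof.
elim: j i s => [|j IH] [|i] [|x s] //= h1 h2.
by congr (_ :: _); exact: (IH i s).
Qed.
End Operations.
End ListsAndTuples.
Arguments fn {K V} n s.

Section TwistedOnLists.
Variables (K : fieldType) (A : ualgType K) (M : lmodType K) (T : twist A M).

Lemma coface_fn n (i : 'I_n.+2) (f : mult n.+1 A M) s : size s = n.+2 -> (i <= n)%N ->
  tw_coface T i f (fn _ s) = f (fn _ (mg i s)).
Proof. by move=> e lin; rewrite /tw_coface /mult_fun /= /coface_fun lin merge_fn. Qed.

Lemma cyc_fn n (f : mult n.+1 A M) s y : size s = n ->
  tw_cyc T f (fn _ (rcons s y)) = T y (mkhom (fun x => f (fn _ (x :: s)))).
Proof.
move=> e; rewrite [LHS]/mult_fun /= fn_last //.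
by congr (T _ (mkhom _)); apply/funext => x; rewrite rotate_fn.
Qed.

(** Both rotate the last argument to the front through T and multiply it into the
    first one. *)
Lemma coface_last n (i : 'I_n.+2) (f : mult n.+1 A M) : (n < i)%N ->
  tw_coface T i f = tw_cyc T (tw_coface T ord0 f).
Proof.
move=> lin; apply: mult_eqP => s; case/lastP: s => // s y; rewrite size_rcons => -[e].
rewrite cyc_fn // -[LHS]/(coface_fun T i f _) /coface_fun leqNgt lin fn_last //.
congr (T _ (mkhom _)); apply/funext => x.
by rewrite rotate_merge_fn // coface_fn //= e.
Qed.

Lemma codegen_fn n (j : 'I_n.+1) (f : mult n.+2 A M) s : size s = n.+1 ->
  tw_codegen j f (fn _ s) = f (fn _ (ins j.+1 s)).
Proof. by move=> e; rewrite [LHS]/mult_fun /= insert1_fn // -ltnS. Qed.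

Lemma cons_lin n (f : mult n.+1 A M) s : size s = n ->
  linear (fun x => f (fn n.+1 (x :: s))).
Proof. exact: (mlin_head (mult_mlin f)). Qed.
End TwistedOnLists.

(** The relations of a cocyclic module that involve codegeneracies: these are
    the ones that make normalized cochains stable under b, B and
    Alexander-Whitney maps. *)
Record cocyclic_laws (K : fieldType) (X : cocyclicData K) : Prop := CocyclicLaws {
  coface_mem : forall n (i : 'I_n.+2) x, x \in cc_mem X n -> coface X i x \in cc_mem X n.+1;
  codegen_mem : forall n (j : 'I_n.+1) x, x \in cc_mem X n.+1 -> codegen X j x \in cc_mem X n;
  cyc_mem : forall n x, x \in cc_mem X n -> cyc X x \in cc_mem X n;
  codegen_coface_id : forall n (i : 'I_n.+2) (j : 'I_n.+1) (x : X n),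
    (i == j :> nat) || (i == j.+1 :> nat) -> codegen X j (coface X i x) = x;
  codegen_coface_lt : forall n (i : 'I_n.+3) (j : 'I_n.+2) (x : X n.+1), (i < j)%N ->
    codegen X j (coface X i x) = coface X (inord i) (codegen X (inord j.-1) x);
  codegen_coface_gt : forall n (i : 'I_n.+3) (j : 'I_n.+2) (x : X n.+1), (j.+1 < i)%N ->
    codegen X j (coface X i x) = coface X (inord i.-1) (codegen X (inord j) x);
  codegen_codegen : forall n (i : 'I_n.+2) (j : 'I_n.+1) (x : X n.+2), (j < i)%N ->
    codegen X j (codegen X i x) = codegen X (inord i.-1) (codegen X (inord j) x);
  codegen_cyc : forall n (j : 'I_n.+2) (x : X n.+2), (j <= n)%N ->
    codegen X j (cyc X x) = cyc X (codegen X (inord j.+1) x);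
  codegen_cyc2 : forall n (x : X n.+1),
    codegen X ord_max (cyc X (cyc X x)) = cyc X (codegen X ord0 x)
}.

Section TwistedLaws.
Variables (K : fieldType) (A : ualgType K) (M : lmodType K) (T : twist A M).
Variable S : forall n, submodClosed (mult n.+1 A M).
Local Notation X := (twisted T S).

(* a unit in the last argument is moved to the front without a trace *)
Hypothesis T1 : forall g : A -> M, linear g -> T aone (mkhom g) = g aone.
Hypothesis inner_mem : forall n (i : 'I_n.+2) x, (i <= n)%N ->
  x \in S n -> tw_coface T i x \in S n.+1.
Hypothesis tw_codegen_mem : forall n (j : 'I_n.+1) x, x \in S n.+1 -> tw_codegen j x \in S n.
Hypothesis tw_cyc_mem : forall n x, x \in S n -> tw_cyc T x \in S n.

Lemma twisted_laws : cocyclic_laws X.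
Proof.
split=> /=.
- move=> n i x mx; case: (leqP i n) => h; first exact: inner_mem.
  by rewrite coface_last //; apply: tw_cyc_mem; apply: inner_mem.
- exact: tw_codegen_mem.
- exact: tw_cyc_mem.
- move=> n i j f h; have lj := ltn_ord j; have li := ltn_ord i.
  apply: mult_eqP => s e; rewrite codegen_fn //.
  case: (leqP i n) => hi.
    rewrite coface_fn ?size_ins ?e //; congr (f (fn _ _)).
    by case/orP: h => /eqP ij; rewrite ij in hi *; [rewrite mg_ins_l ?e|rewrite mg_ins_r ?e].
  rewrite coface_last //.
  have -> : ins j.+1 s = rcons s aone by rewrite -ins_size e; congr (ins _ _); lia.
  rewrite cyc_fn // T1; last first.
    exact: (mlin_head (mult_mlin (tw_coface T ord0 f)) e).
  rewrite coface_fn //= ?e //; congr (f (fn _ _)).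
  by case: s e => // x s _; rewrite amul1l.
- move=> n i j f h; have lj := ltn_ord j; have li := ltn_ord i.
  apply: mult_eqP => s e; rewrite codegen_fn // coface_fn ?size_ins ?e //; try lia.
  have ei : (inord i : 'I_n.+2) = i :> nat by rewrite inordK; lia.
  have ej : (inord j.-1 : 'I_n.+1) = j.-1 :> nat by rewrite inordK; lia.
  rewrite coface_fn ?ei //; try lia.
  rewrite codegen_fn ?ej ?size_mg ?e //; try lia.
  by rewrite mg_ins_lt ?e ?prednK //; lia.
- move=> n i j f h; have lj := ltn_ord j; have li := ltn_ord i.
  have ei : (inord i.-1 : 'I_n.+2) = i.-1 :> nat by rewrite inordK; lia.
  have ej : (inord j : 'I_n.+1) = j :> nat by rewrite inordK; lia.
  apply: mult_eqP => s e; rewrite codegen_fn //.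
  case: (leqP i n.+1) => hi.
    rewrite coface_fn ?size_ins ?e // coface_fn ?ei //; try lia.
    rewrite codegen_fn ?ej ?size_mg ?e //; try lia.
    have {1}-> : i = i.-1.+1 :> nat by lia.
    by rewrite mg_ins_gt ?e //; lia.
  rewrite [in RHS]coface_last ?ei; try lia.
  rewrite (coface_last T f hi).
  case/lastP: s e => // s y; rewrite size_rcons => -[e].
  rewrite ins_rcons ?e //; try lia.
  rewrite !cyc_fn ?size_ins ?e //. congr (T y (mkhom _)); apply/funext => x.
  have e1 : size (x :: ins j.+1 s) = n.+3 by rewrite -[LHS]/(size (ins j.+1 s)).+1 size_ins e.
  have e2 : size (x :: s) = n.+2 by rewrite [LHS]/= e.
  rewrite !coface_fn //; case: s e {e1 e2} => // z s [e].
  by rewrite codegen_fn ?ej //= e.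

- move=> n i j f h; have lj := ltn_ord j; have li := ltn_ord i.
  have ei : (inord i.-1 : 'I_n.+1) = i.-1 :> nat by rewrite inordK; lia.
  have ej : (inord j : 'I_n.+2) = j :> nat by rewrite inordK; lia.
  apply: mult_eqP => s e; rewrite !codegen_fn ?size_ins ?e // ei ej.
  congr (f (fn _ _)); have -> : i.-1.+1 = i by lia.
  by rewrite ins_ins ?e //; lia.
- move=> n j f h.
  have ej : (inord j.+1 : 'I_n.+2) = j.+1 :> nat by rewrite inordK; lia.
  apply: mult_eqP => s; case/lastP: s => // s y; rewrite size_rcons => -[e].
  rewrite codegen_fn ?size_rcons ?e // ins_rcons ?e ?ltnS // !cyc_fn ?size_ins ?e //.
  congr (T y (mkhom _)); apply/funext => x.
  by rewrite codegen_fn /= ?e // ej.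
- move=> n f; apply: mult_eqP => s e.
  have es : ins (@ord_max n).+1 s = rcons s aone by rewrite -ins_size e.
  rewrite codegen_fn // es cyc_fn // T1; last first.
    exact: (mlin_head (mult_mlin (tw_cyc T f)) e).
  case/lastP: s e {es} => // s y; rewrite size_rcons => -[e].
  rewrite -rcons_cons !cyc_fn ?[size _]/= ?e //; congr (T y (mkhom _)); apply/funext => x.
  by rewrite codegen_fn ?[size _]/= ?e.
Qed.
End TwistedLaws.

(** * Equivariant cochains form cocyclic modules *)

Ltac lin_lists ::= first
  [ (apply: coactL_param => ? ? ?; solve [lin])
  | (apply: actL_param => ? ?; solve [lin])
  | (apply: (comp_lin (cons_lin _ _));
      [first [eassumption | (etransitivity; eassumption) | reflexivity] | solve [lin]]) ].

Lemma big_swS (K : fieldType) (H : ualgType K) (hH : hopf H) (V : nmodType) n h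
    (F : seq H -> V) :
  \sum_(u <- sw hH n.+1 h) F u =
  \sum_(p <- terms (Delta hH h)) \sum_(u <- sw hH n p.2) F (p.1 :: u).
Proof. exact: big_allpairs_dep. Qed.

Lemma sum_sw2 (K : fieldType) (H : ualgType K) (hH : hopf H) (U : lmodType K)
    (G : H -> H -> H -> U) h :
  \sum_(u <- sw hH 2 h) G u`_0 u`_1 u`_2 =
  tsum (Delta hH h) (fun x y => tsum (Delta hH y) (fun y1 y2 => G x y1 y2)).
Proof.
rewrite big_swS; apply: eq_bigr => p _; rewrite big_swS; apply: eq_bigr => q _.
by rewrite big_seq1.
Qed.

Lemma big_choicesS (V : nmodType) (T : Type) n (s : 'I_n.+1 -> seq T)
    (F : ('I_n.+1 -> T) -> V) :
  \sum_(c <- choices s) F c = \sum_(x <- s ord0)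
    \sum_(c <- choices (fun j => s (fintype.lift ord0 j)))
      F (fun i => if unlift ord0 i is Some j then c j else x).
Proof. exact: big_allpairs_dep. Qed.

Section Colinear.
Variables (K : fieldType) (H : ualgType K) (hH : hopf H).
Variables (B : ualgType K) (cB : comoduleAlgebra hH B).
Variables (N : lmodType K) (sN : saydModule hH N).
Local Notation rho := (ca_rho cB).
Local Notation rhoN := (sm_rho sN).
Local Notation act := (sm_act sN).

Lemma choices_coactL (U : lmodType K) n (b : 'I_n -> B) (G : H -> seq B -> U) :
  \sum_(c <- choices (fun i => terms (rho (b i))))
     G (\big[amul/aone]_i (c i).1) (ls (fun i => (c i).2)) = coactL cB (ls b) G.
Proof.
elim: n b G => [|n IH] b G; first by rewrite ls0 big_seq1 big_ord0 ls0.
rewrite big_choicesS lsS /=; apply: eq_bigr => p _.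
rewrite -IH; apply: eq_bigr => c _.
rewrite big_ord_recl unlift_none lsS unlift_none; congr (G (_ ** _) (_ :: _)).
  by apply: eq_bigr => i _; rewrite liftK.
by congr ls; apply/funext => i; rewrite liftK.
Qed.

Lemma HcolinearP n (f : mult n.+1 B N) : reflect
  (forall s, size s = n.+1 ->
     rhoN (f (fn _ s)) = coactL cB s (fun h t => h \ox f (fn _ t)))
  (f \in @Hcolinear_pred _ _ _ _ cB _ sN n).
Proof.
apply: (iffP (asboolP _)) => Hf.
  move=> s e; rewrite Hf -[in RHS](ls_fn e) -choices_coactL.
  by apply: eq_bigr => c _; rewrite lsK.
move=> b; rewrite -[b in LHS]lsK Hf ?size_ls // -choices_coactL.
by apply: eq_bigr => c _; rewrite lsK.
Qed.

(** How colinearity is used: the coaction of a value can be taken on the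
    arguments. *)
Lemma tsum_colinear (U : lmodType K) n (f : mult n.+1 B N) (Q : H -> N -> U) s :
  f \in @Hcolinear_pred _ _ _ _ cB _ sN n -> size s = n.+1 -> bilinear_map Q ->
  tsum (rhoN (f (fn _ s))) Q = coactL cB s (fun h t => Q h (f (fn _ t))).
Proof.
move=> /HcolinearP Hf e bQ; rewrite Hf // (coactL_map _ _ _ (tsum_lin bQ)).
by apply: eq_coactL => h t _; rewrite tsum_pure.
Qed.

Lemma mult_hml n (f : mult n B N) : hml n (fun (h : H) s => h \ox f (fn _ s)).
Proof.
split=> [s _|h]; first exact: pure_linl.
by apply: mlin_map; [exact: pure_linr|exact: mult_mlin].
Qed.

Lemma colin_coface n (i : 'I_n.+2) (f : mult n.+1 B N) T : (i <= n)%N ->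
  f \in @Hcolinear_pred _ _ _ _ cB _ sN n ->
  tw_coface T i f \in @Hcolinear_pred _ _ _ _ cB _ sN n.+1.
Proof.
move=> lin /HcolinearP Hf; apply/HcolinearP => s e.
rewrite coface_fn // Hf ?size_mg ?e // (coactL_mg cB e _ (mult_hml f)) //.
by apply: eq_coactL => h t et; rewrite coface_fn // et.
Qed.

Lemma colin_codegen n (j : 'I_n.+1) (f : mult n.+2 B N) :
  f \in @Hcolinear_pred _ _ _ _ cB _ sN n.+1 ->
  tw_codegen j f \in @Hcolinear_pred _ _ _ _ cB _ sN n.
Proof.
move=> /HcolinearP Hf; apply/HcolinearP => s e.
rewrite codegen_fn // Hf ?size_ins ?e // (coactL_ins cB e _ (mult_hml f)) //.
by apply: eq_coactL => h t et; rewrite codegen_fn // et.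
Qed.

Local Notation T := (Twist (coact_twist_bil cB sN)).

Lemma colin_twist b g : T b g = tsum (rho b) (fun u b' => act (g b') u).
Proof. by []. Qed.

Lemma colin_cyc_fn n (f : mult n.+1 B N) s b : size s = n ->
  tw_cyc T f (fn _ (rcons s b)) = tsum (rho b) (fun u b' => act (f (fn _ (b' :: s))) u).
Proof.
move=> e; rewrite cyc_fn // colin_twist; apply: eq_tsum => u b'.
by rewrite mkhomE //; apply: cons_lin.
Qed.

(** In the coaction of psi(b^n_<0>, b^0, ...) . b^n_<-1> the antipode of the
    anti-Yetter-Drinfeld condition meets the leftmost factor of the coaction
    of psi, which also comes from b^n, and cancels it. *)
Lemma colin_cyc n (f : mult n.+1 B N) :
  f \in @Hcolinear_pred _ _ _ _ cB _ sN n -> tw_cyc T f \in @Hcolinear_pred _ _ _ _ cB _ sN n.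
Proof.
move=> Hf; apply/HcolinearP => s; case/lastP: s => // s b; rewrite size_rcons => -[e].
(* with b the last argument, x, y, z and c are the slots of b_<-4>, b_<-3>,
   S(b_<-2>) b_<-1> and b_<0> *)
pose J x y z c := coactL cB s (fun h t => (z ** h ** x) \ox act (f (fn _ (c :: t))) y).
have J1 y z c : linear (fun x => J x y z c) by rewrite /J; lin.
have J2 x z c : linear (fun y => J x y z c) by rewrite /J; lin.
have J3 x y c : linear (fun z => J x y z c) by rewrite /J; lin.
have J4 x y z : linear (fun c => J x y z c) by rewrite /J; lin.
rewrite coactL_rcons colin_cyc_fn // (tsum_map _ _ (coact_lin (sm_rhoP sN))).
transitivity (tsum (rho b) (fun x w => tsum (rho w) (fun y w' => J x y aone w'))); last first.
  apply: eq_tsum => x w; rewrite /J -coactL_tsum; apply: eq_coactL => h t et.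
  rewrite colin_cyc_fn ?et // (tsum_map _ _ (pure_linr _)).
  by apply: eq_tsum => y w'; rewrite amul1l.
transitivity (tsum (rho b) (fun u b' => tsum (Delta hH u) (fun x y =>
  tsum (Delta hH y) (fun y1 y2 => tsum (rho b') (fun v c => J x y1 (antip hH y2 ** v) c))))).
  apply: eq_tsum => u b'; rewrite sm_ayd.
  rewrite (sum_sw2 hH (fun x y1 y2 => tsum (rhoN (f (fn _ (b' :: s))))
     (fun p n' => (antip hH y2 ** p ** x) \ox act n' y1))).
  apply: eq_tsum => x y; apply: eq_tsum => y1 y2.
  rewrite tsum_colinear //=; [|by rewrite e|by lin].
  by apply: eq_tsum => v c; apply: eq_coactL => h t _; rewrite !amulA.
have lg x y c : linear (fun z => J x y (antip hH z) c).
  by apply: (comp_lin (J3 _ _ _)); lin.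
rewrite (tsum_coassoc (g := fun x y b' => tsum (Delta hH y) (fun y1 y2 =>
    tsum (rho b') (fun v c => J x y1 (antip hH y2 ** v) c))) _ (ca_rhoP cB)); last first.
  split=> [y b'|x b'|x y].
  - by apply: tsum_param => y1 y2; apply: tsum_param => v c.
  - apply: (tsum_comp (@linearP _ _ _ _ _)); split=> [y2|y1].
      by apply: tsum_param => v c.
    apply: tsum_param => v c; apply: (comp_lin (J3 _ _ _)); lin.
  - apply: tsum_param => y1 y2; apply: (tsum_comp (coact_lin (ca_rhoP cB))).
    by split=> [c|v]; [apply: (comp_lin (J3 _ _ _)); lin|].
apply: eq_tsum => x w.
rewrite (tsum_coassoc (g := fun y1 y2 b' =>
    tsum (rho b') (fun v c => J x y1 (antip hH y2 ** v) c)) _ (ca_rhoP cB)); last first.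
  split=> [y2 b'|y1 b'|y1 y2].
  - by apply: tsum_param => v c.
  - apply: tsum_param => v c; apply: (comp_lin (J3 _ _ _)); lin.
  - apply: (tsum_comp (coact_lin (ca_rhoP cB))).
    by split=> [c|v]; [apply: (comp_lin (J3 _ _ _)); lin|].
apply: eq_tsum => y1 w'.
rewrite -(tsum_coassoc (g := fun y2 v c => J x y1 (antip hH y2 ** v) c) _ (ca_rhoP cB)).
  rewrite -[RHS](tsum_counit w' (ca_rhoP cB) (J4 x y1 aone)); apply: eq_tsum => y c.
  exact: (@tsum_antipl _ _ hH _ (fun z => J x y1 z c)).
by split=> [v c|y2 c|y2 v] //; apply: (comp_lin (J3 _ _ _)); lin.
Qed.

Lemma HcolinC_laws : cocyclic_laws (HcolinC cB sN).
Proof.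
apply: twisted_laws => [g lg|n i x lin||].
- rewrite colin_twist ca_rho1 tsum_pure ?mkhomE // ?(ract1 (sm_actP sN)) //; lin.
- exact: colin_coface.
- exact: colin_codegen.
- exact: colin_cyc.
Qed.
End Colinear.

Section Linear.
Variables (K : fieldType) (H : ualgType K) (hH : hopf H).
Variables (A : ualgType K) (mA : moduleAlgebra hH A).
Variables (M : lmodType K) (sM : saydContramodule hH M).
Local Notation act := (ma_act mA).
Local Notation alpha := (sc_alpha sM).

Lemma sw_actL (U : lmodType K) n h s (F : seq A -> U) : size s = n.+1 -> mlin n.+1 F ->
  \sum_(u <- sw hH n h) F [seq act p.1 p.2 | p <- zip u s] = actL mA h s F.
Proof.
elim: n h s F => [|n IH] h [|a s] F // [e] mF.
  case: s e => // _; rewrite big_seq1 /=.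
  have lF : linear (fun x => F [:: act x a]).
    by apply: (@lin_head _ _ _ _ (fun x => act x a) 0 F [::] mF) => //; lin.
  by rewrite (@tsum_counitr _ _ hH _ (fun x => F [:: act x a])).
rewrite big_swS; apply: eq_bigr => p _.
exact: (IH p.2 s (fun t => F (act p.1 a :: t)) e (mlin_cons _ mF)).
Qed.

Lemma HlinearP n (f : mult n.+1 A M) : reflect
  (forall h s, size s = n.+1 ->
     actL mA h s (fun t => f (fn _ t)) = sc_act sM h (f (fn _ s)))
  (f \in @Hlinear_pred _ _ _ _ mA _ sM n).
Proof.
have sz m h : {in sw hH m h, forall u, size u = m.+1}.
  elim: m h => [|m IH] h u /=; first by rewrite inE => /eqP ->.
  by case/allpairsPdep => p [v [_ /IH ev ->]]; rewrite /= ev.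
have E h s : size s = n.+1 -> \sum_(u <- sw hH n h) f (fun i => act u`_i (fn _ s i)) =
    actL mA h s (fun t => f (fn _ t)).
  move=> e; rewrite -(sw_actL h e (mult_mlin f)) big_seq [RHS]big_seq.
  apply: eq_bigr => u /sz eu; congr (f _); apply/funext => i.
  by rewrite /fn (nth_map (0, 0)) ?nth_zip ?size_zip ?eu ?e ?minnn.
apply: (iffP (asboolP _)) => Hf.
  by move=> h s e; rewrite -E.
by move=> h a; rewrite -[a]lsK E ?size_ls // Hf // size_ls.
Qed.

Lemma lin_coface n (i : 'I_n.+2) (f : mult n.+1 A M) T : (i <= n)%N ->
  f \in @Hlinear_pred _ _ _ _ mA _ sM n ->
  tw_coface T i f \in @Hlinear_pred _ _ _ _ mA _ sM n.+1.
Proof.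
move=> lin /HlinearP Hf; apply/HlinearP => h s e.
rewrite coface_fn // -Hf ?size_mg ?e // (actL_mg _ _ e _ (mult_mlin f)) //.
by apply: eq_actL => t et; rewrite coface_fn // et.
Qed.

Lemma lin_codegen n (j : 'I_n.+1) (f : mult n.+2 A M) :
  f \in @Hlinear_pred _ _ _ _ mA _ sM n.+1 ->
  tw_codegen j f \in @Hlinear_pred _ _ _ _ mA _ sM n.
Proof.
move=> /HlinearP Hf; apply/HlinearP => h s e.
rewrite codegen_fn // -Hf ?size_ins ?e // (actL_ins _ _ e _ (mult_mlin f)) //.
by apply: eq_actL => t et; rewrite codegen_fn // et.
Qed.

Local Notation T := (Twist (contra_twist_bil mA sM)).

Lemma lin_cyc_fn n (f : mult n.+1 A M) s a : size s = n ->
  tw_cyc T f (fn _ (rcons s a)) =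
  alpha (mkhom (fun z => f (fn _ (act (antipV hH z) a :: s)))).
Proof.
move=> e; rewrite cyc_fn //= /contra_twist_fun; congr (alpha (mkhom _)).
by apply/funext => z; rewrite mkhomE //; apply: cons_lin.
Qed.

(** By the anti-Yetter-Drinfeld condition h acts on the value inside alpha by
    h_2, while its argument becomes S^{-1}(h_1) S^{-1}(z) h_3 . a^n; linearity of
    phi puts h_2 next to S^{-1}(h_1), and the two cancel. *)
Lemma lin_cyc n (f : mult n.+1 A M) :
  f \in @Hlinear_pred _ _ _ _ mA _ sM n -> tw_cyc T f \in @Hlinear_pred _ _ _ _ mA _ sM n.
Proof.
move=> /HlinearP Hf; apply/HlinearP => h s; case/lastP: s => // s a.
rewrite size_rcons => -[e].
rewrite (actL_rcons _ _ _ e (mult_mlin _)) lin_cyc_fn //.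
pose F x y z := actL mA x s (fun t => f (fn _ (act (antipV hH z) (act y a) :: t))).
have lF x y : linear (F x y) by rewrite /F; lin.
transitivity (alpha (mkhom (fun z => tsum (Delta hH h) (fun x y => F x y z)))).
  have lE (z : H) : linear (fun g : Defs.hom H M => g z) by [].
  have -> : mkhom (fun z => tsum (Delta hH h) (fun x y => F x y z)) =
            tsum (Delta hH h) (fun x y => mkhom (F x y)).
    apply: homP => z; rewrite mkhomE; last by lin.
    rewrite (tsum_map _ _ (lE z)); apply: eq_tsum => x y.
    by rewrite mkhomE.
  rewrite (tsum_map _ _ (@linearP _ _ _ _ alpha)); apply: eq_tsum => x y.
  have -> : mkhom (F x y) = actL mA x s (fun t =>
      mkhom (fun z => f (fn _ (act (antipV hH z) (act y a) :: t)))).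
    apply: homP => z; rewrite mkhomE // (actL_map _ _ _ _ (lE z)).
    by apply: eq_actL => t et; rewrite mkhomE //; lin.
  rewrite (actL_map _ _ _ _ (@linearP _ _ _ _ alpha)).
  by apply: eq_actL => t et; rewrite lin_cyc_fn // et.
rewrite sc_ayd; congr (alpha (mkhom _)); apply/funext => z.
have lf : linear (fun z => f (fn _ (act (antipV hH z) a :: s))) by lin.
rewrite (sum_sw2 hH (fun x y1 y2 => sc_act sM y1
   (mkhom (fun z => f (fn _ (act (antipV hH z) a :: s))) (antip hH y2 ** z ** x)))).
(* w, q and y are the slots of h_(2) S^{-1}(h_(1)), h_(3) and h_(4) *)
pose J w q y := actL mA q s (fun t => f (fn _ (act (w ** (antipV hH z ** y)) a :: t))).
have J1 q y : linear (fun w => J w q y) by rewrite /J; lin.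
have J2 w y : linear (fun q => J w q y).
  apply: (actL_linh mA e); exact: (mlin_cons _ (mult_mlin f)).
have J3 w q : linear (fun y => J w q y) by rewrite /J; lin.
transitivity (tsum (Delta hH h) (fun q y => J aone q y)).
  apply: eq_tsum => x y; apply: eq_actL => t et.
  by rewrite amul1l (lactM (ma_actP mA)).
transitivity (tsum (Delta hH h) (fun x y => tsum (Delta hH y) (fun y1 y2 =>
   tsum (Delta hH y1) (fun p q => J (p ** antipV hH x) q y2)))); last first.
  apply: eq_tsum => x y; apply: eq_tsum => y1 y2.
  rewrite mkhomE // -Hf /= ?e //; apply: eq_tsum => p q; apply: eq_actL => t et.
  by rewrite -(lactM (ma_actP mA)) !antipVM antipK !amulA.
transitivity (tsum (Delta hH h) (fun x y => tsum (Delta hH y) (fun p w =>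
   tsum (Delta hH w) (fun q y2 => J (p ** antipV hH x) q y2)))); last first.
  apply: eq_tsum => x y.
  rewrite -(tsum_DeltaA hH (g := fun p q y2 => J (p ** antipV hH x) q y2)) //.
  by split=> // q y2; apply: (comp_lin (J1 _ _)); lin.
have lG p w : linear (fun x => tsum (Delta hH w) (fun q y2 => J (p ** antipV hH x) q y2)).
  by apply: tsum_param => q y2; apply: (comp_lin (J1 _ _)); lin.
rewrite -(tsum_DeltaA hH (g := fun x p w =>
   tsum (Delta hH w) (fun q y2 => J (p ** antipV hH x) q y2))); last first.
  split=> [p w|x w|x p] //.
    by apply: tsum_param => q y2; apply: (comp_lin (J1 _ _)); lin.
  by apply: (tsum_comp (@linearP _ _ _ _ _)).
have lJ : linear (fun w => tsum (Delta hH w) (fun q y2 => J aone q y2)).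
  exact: (tsum_comp (@linearP _ _ _ _ _)).
rewrite -(tsum_counitl hH h lJ); apply: eq_tsum => u w.
rewrite (@tsum_antipVr _ _ hH _ (fun x => tsum (Delta hH w) (fun q y2 => J x q y2))) //.
exact: tsum_param.
Qed.

Lemma HlinC_laws : cocyclic_laws (HlinC mA sM).
Proof.
apply: twisted_laws => [g lg|n i x lin||].
- rewrite /= /contra_twist_fun -[RHS](sc_contra1 sM); congr (alpha (mkhom _)).
  apply/funext => h; rewrite mkhomE // antipV_act1.
  exact: linearZ_of.
- exact: lin_coface.
- exact: lin_codegen.
- exact: lin_cyc.
Qed.
End Linear.

(** * Normalized cochains *)

Section Normalized.
Variables (K : fieldType) (X : cocyclicData K) (lX : cocyclic_laws X).

Lemma normalized_mem n (x : X n) : normalized X x -> x \in cc_mem X n.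
Proof. by case: n x => [|n] x // []. Qed.

Lemma normalized_sum n I (r : seq I) (P : pred I) (F : I -> X n) :
  (forall i, P i -> normalized X (F i)) -> normalized X (\sum_(i <- r | P i) F i).
Proof.
move=> nF; elim/big_ind: _ => // [|x y nx ny]; first exact: normalized0.
by rewrite -[x]scale1r; apply: normalized_lin.
Qed.

Lemma normalizedZ n a (x : X n) : normalized X x -> normalized X (a *: x).
Proof. by move=> nx; rewrite -[_ *: _]addr0; apply: normalized_lin => //; apply: normalized0. Qed.

Lemma hochb_mem n (x : X n) : x \in cc_mem X n -> hochb X x \in cc_mem X n.+1.
Proof. by move=> mx; apply: rpred_sum => i _; apply: rpredZ; apply: coface_mem. Qed.

Lemma iter_cyc_mem n i (x : X n) : x \in cc_mem X n -> iter i (cyc X) x \in cc_mem X n.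
Proof. by move=> mx; elim: i => // i IH; apply: cyc_mem. Qed.

Lemma connesB_mem n (x : X n.+1) : x \in cc_mem X n.+1 -> connesB X x \in cc_mem X n.
Proof.
move=> mx; apply: rpred_sum => i _; apply: rpredZ; apply: iter_cyc_mem.
by apply: codegen_mem => //; apply: cyc_mem.
Qed.

(** In sigma_j b x all terms die except those of the cofaces j and j + 1, which
    give x with opposite signs. *)
Lemma hochb_normalized n (x : X n) : normalized X x -> normalized X (hochb X x).
Proof.
move=> nx; split=> [|j]; first exact/hochb_mem/normalized_mem.
have lj := ltn_ord j.
have ji1 : (j < n.+2)%N by lia.
have ji2 : (j.+1 < n.+2)%N by lia.
pose i1 : 'I_n.+2 := Ordinal ji1; pose i2 : 'I_n.+2 := Ordinal ji2.
have E (i : 'I_n.+2) : i != i1 -> i != i2 -> codegen X j (coface X i x) = 0.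
  rewrite -!val_eqE /= => n1 n2.
  case: n x nx j lj ji1 ji2 i1 i2 i n1 n2 => [|n] x nx j lj _ _ _ _ i n1 n2.
    by have := ltn_ord i; lia.
  have [ij|ij] : (i < j)%N \/ (j.+1 < i)%N by lia.
    by rewrite (codegen_coface_lt lX) // nx.2 linear0.
  by rewrite (codegen_coface_gt lX) // nx.2 linear0.
rewrite /hochb linear_sum (bigD1 i1) //= (bigD1 i2) /=; last first.
  by rewrite -val_eqE /=; lia.
rewrite big1 => [|i /andP [n1 n2]]; last by rewrite linearZ /= E // scaler0.
by rewrite !linearZ /= !(codegen_coface_id lX) ?eqxx ?orbT // exprS mulN1r scaleNr addr0 subrr.
Qed.

(** The extra degeneracy y = sigma_n tau x inserts a unit in front, so y and
    tau y are both killed by all codegeneracies; the relations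
    sigma_j tau = tau sigma_(j+1) and sigma_n tau^2 = tau sigma_0 carry this over
    to all tau^i y. *)
Lemma connesB_normalized n (x : X n.+1) : normalized X x -> normalized X (connesB X x).
Proof.
case: n x => [|m] x nx; first exact/connesB_mem/normalized_mem.
split=> [|j]; first exact/connesB_mem/normalized_mem.
set y := codegen X ord_max (cyc X x).
have next z : (forall k : 'I_m.+1, codegen X k z = 0) -> forall k : 'I_m.+1, (k < m)%N ->
    codegen X k (cyc X z) = 0.
  case: m {x nx j y} z => // m z nz k km.
  by rewrite (codegen_cyc lX) // nz linear0.
have y0 k : codegen X k y = 0.
  have lk := ltn_ord k.
  have ek : (inord k : 'I_m.+2) = k :> nat by rewrite inordK; lia.
  rewrite /y (codegen_codegen lX) // (codegen_cyc lX) ?ek //.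
  by rewrite nx.2 !linear0.
have y1 k : codegen X k (cyc X y) = 0.
  case: (ltnP k m) => km; first exact: next.
  have -> : k = ord_max by apply: val_inj => /=; have := ltn_ord k; lia.
  have e : (inord m : 'I_m.+2) = m :> nat by rewrite inordK.
  have <- : codegen X (inord m) (cyc X (cyc X x)) = cyc X y.
    rewrite (codegen_cyc lX) ?e //; congr (cyc X (codegen X _ _)).
    by apply: val_inj; rewrite /= inordK.
  have := codegen_codegen lX (i := ord_max) (j := ord_max) (cyc X (cyc X x)) (ltnSn m).
  rewrite (codegen_cyc2 lX) nx.2 !linear0 /= => e2; rewrite [RHS]e2.
  by congr (codegen X _ _); apply: val_inj; rewrite /= inordK.
have yi i : (forall k, codegen X k (iter i (cyc X) y) = 0) /\
            (forall k, codegen X k (iter i.+1 (cyc X) y) = 0).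
  elim: i => [|i [IH0 IH1]]; first by split.
  split=> // k; case: (ltnP k m) => km; first exact: next.
  have -> : k = ord_max by apply: val_inj => /=; have := ltn_ord k; lia.
  by rewrite !iterS (codegen_cyc2 lX) IH0 linear0.
rewrite /connesB linear_sum big1 // => i _; rewrite linearZ /=.
by rewrite (yi i).1 scaler0.
Qed.

(** Annihilation by the j-th codegeneracy, without fixing the shape of the degree. *)
Definition killed (j : nat) n : X n -> Prop :=
  if n is m.+1 then fun x => forall k : 'I_m.+1, k = j :> nat -> codegen X k x = 0
  else fun=> True.

Lemma normalized_killed j n (x : X n) : normalized X x -> killed j x.
Proof. by case: n x => // n x [_ nx] k _. Qed.

Lemma killed_coface0 j n (x : X n) : (j < n)%N -> killed j x -> killed j.+1 (coface X ord0 x).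
Proof.
case: n x => // n x lj kx k ek.
rewrite (codegen_coface_lt lX) ?ek // kx ?linear0 //.
by rewrite inordK ?ek //= ?ltnS ?(ltnW lj).
Qed.

Lemma killed_coface_max j n (x : X n) : (j < n)%N -> killed j x ->
  killed j (coface X ord_max x).
Proof.
case: n x => // n x lj kx k ek.
rewrite (codegen_coface_gt lX) ?ek //= kx ?linear0 //.
by rewrite inordK ?ek //= ?ltnS ?(ltnW lj).
Qed.

Lemma front_mem k r (x : X r) : x \in cc_mem X r -> front k x \in cc_mem X (k + r).
Proof. by move=> mx; elim: k => // k IH; apply: coface_mem. Qed.

Lemma back_mem k r (x : X r) : x \in cc_mem X r -> back k x \in cc_mem X (k + r).
Proof. by move=> mx; elim: k => // k IH; apply: coface_mem. Qed.

Lemma front_killed j k r (x : X r) : normalized X x -> (k <= j)%N -> (j < k + r)%N ->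
  killed j (front k x).
Proof.
move=> nx; elim: k j => [|k IH] j; first by move=> _ _; apply: normalized_killed.
case: j => // j h1 h2; apply: killed_coface0 => //.
exact: IH.
Qed.

Lemma back_killed j k r (x : X r) : normalized X x -> (j < r)%N -> killed j (back k x).
Proof.
move=> nx lj; elim: k => [|k IH]; first exact: normalized_killed.
by apply: killed_coface_max => //; rewrite ltn_addl.
Qed.

Lemma front_linear k r : linear (@front K X k r).
Proof. by elim: k => [|k IH] a x y //=; rewrite IH linearP. Qed.

Lemma back_linear k r : linear (@back K X k r).
Proof. by elim: k => [|k IH] a x y //=; rewrite IH linearP. Qed.
End Normalized.

(** * The bicocyclic module and the Alexander-Whitney map *)

Section Bi.
Variables (K : fieldType) (X Y : cocyclicData K).
Variables (lX : cocyclic_laws X) (lY : cocyclic_laws Y).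

Lemma span_map (V W : lmodType K) (P : V -> Prop) (Q : W -> Prop) (f : V -> W) :
  linear f -> (forall x, P x -> f x \in Defs.span Q) -> forall x, x \in Defs.span P -> f x \in Defs.span Q.
Proof.
move=> lf PQ x /asboolP; elim=> [|a u v Pu _ IH]; first by rewrite (linear0_of lf) rpred0.
by rewrite lf; apply: rpredD => //; apply: rpredZ; apply: PQ.
Qed.

Lemma tens_mem r s (x : X r) (y : Y s) : x \in cc_mem X r -> y \in cc_mem Y s ->
  x \ox y \in @bimod_mem K X Y r s.
Proof. by move=> mx my; apply: span_gen. Qed.

Lemma tmap_mem r s r' s' (f : {linear X r -> X r'}) (g : {linear Y s -> Y s'}) t :
  (forall x, x \in cc_mem X r -> f x \in cc_mem X r') ->
  (forall y, y \in cc_mem Y s -> g y \in cc_mem Y s') ->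
  t \in @bimod_mem K X Y r s -> tmap f g t \in @bimod_mem K X Y r' s'.
Proof.
move=> mf mg; apply: span_map; first exact: linearP.
by move=> _ [x y mx my]; rewrite tmap_pure; apply: tens_mem; [apply: mf|apply: mg].
Qed.

(** The condition on the components of an element of Tot. *)
Definition binorm r s (t : tens (X r) (Y s)) :=
  normalized (hor X Y r) (t : hor X Y r s) /\ normalized (ver X Y s) (t : ver X Y s r).

Lemma binorm_lin r s a (t u : tens (X r) (Y s)) : binorm t -> binorm u -> binorm (a *: t + u).
Proof. by move=> [? ?] [? ?]; split; apply: normalized_lin. Qed.

Lemma binorm0 r s : binorm (0 : tens (X r) (Y s)).
Proof. by split; apply: normalized0. Qed.

Lemma binormD r s (t u : tens (X r) (Y s)) : binorm t -> binorm u -> binorm (t + u).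
Proof. by move=> bt bu; rewrite -[t]scale1r; apply: binorm_lin. Qed.

Lemma binormZ r s a (t : tens (X r) (Y s)) : binorm t -> binorm (a *: t).
Proof. by move=> bt; rewrite -[_ *: _]addr0; apply: binorm_lin => //; apply: binorm0. Qed.

Lemma binorm_pure r s (x : X r) (y : Y s) : normalized X x -> normalized Y y ->
  binorm (x \ox y).
Proof.
move=> nx ny; have m := tens_mem (normalized_mem nx) (normalized_mem ny).
split.
  case: s y ny m => // s y [_ ny] m; split=> // j.
  by rewrite /= tmap_pure ny (linear0_of (pure_linr _)).
case: r x nx m => // r x [_ nx] m; split=> // j.
by rewrite /= tmap_pure nx (linear0_of (pure_linl _)).
Qed.

Lemma hochb_hor r s (x : X r) (y : Y s) :
  hochb (hor X Y r) (x \ox y : hor X Y r s) = x \ox hochb Y y.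
Proof.
rewrite /hochb (linear_sum_of _ _ (pure_linr x)); apply: eq_bigr => i _ /=.
by rewrite tmap_pure (linearZ_of _ _ (pure_linr x)).
Qed.

Lemma hochb_ver r s (x : X r) (y : Y s) :
  hochb (ver X Y s) (x \ox y : ver X Y s r) = hochb X x \ox y.
Proof.
rewrite /hochb (linear_sum_of _ _ (pure_linl y)); apply: eq_bigr => i _ /=.
by rewrite tmap_pure (linearZ_of _ _ (pure_linl y)).
Qed.

Lemma connesB_hor r s (x : X r) (y : Y s.+1) :
  connesB (hor X Y r) (x \ox y : hor X Y r s.+1) = x \ox connesB Y y.
Proof.
rewrite /connesB (linear_sum_of _ _ (pure_linr x)); apply: eq_bigr => i _ /=.
rewrite (linearZ_of _ _ (pure_linr x)) !tmap_pure /=; congr (_ *: _).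
by elim: (i : nat) (codegen _ _ _) => //= k IH z; rewrite IH tmap_pure.
Qed.

Lemma connesB_ver r s (x : X r.+1) (y : Y s) :
  connesB (ver X Y s) (x \ox y : ver X Y s r.+1) = connesB X x \ox y.
Proof.
rewrite /connesB (linear_sum_of _ _ (pure_linl y)); apply: eq_bigr => i _ /=.
rewrite (linearZ_of _ _ (pure_linl y)) !tmap_pure /=; congr (_ *: _).
by elim: (i : nat) (codegen _ _ _) => //= k IH z; rewrite IH tmap_pure.
Qed.

(** Families of normalized pure tensors; being pure makes the total
    differential computable, and this class covers all the families used. *)
Definition pure_fam (u : bifam X Y) := forall r s,
  exists x y, [/\ normalized X x, normalized Y y & u r s = x \ox y].

Lemma pure_fam_binorm u r s : pure_fam u -> binorm (u r s).
Proof. by move=> /(_ r s) [x [y [nx ny ->]]]; apply: binorm_pure. Qed.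

Lemma pure_fam_comp n u : pure_fam u -> pure_fam (Tot_comp n u).
Proof.
move=> pu r s; rewrite /Tot_comp; case: eqP => // _.
exists 0, 0; split; try exact: normalized0.
by rewrite (linear0_of (pure_linr _)).
Qed.

Lemma Tot_d_binorm u r s : pure_fam u -> binorm (Tot_d u r s).
Proof.
move=> pu; rewrite /Tot_d; apply: binormD; [apply: binormD; [apply: binormD|]|].
- case: s => [|s]; first exact: binorm0.
  have [x [y [nx ny ->]]] := pu r s; rewrite hochb_hor.
  by apply: binorm_pure => //; apply: hochb_normalized.
- apply: binormZ; case: r => [|r]; first exact: binorm0.
  have [x [y [nx ny ->]]] := pu r s; rewrite hochb_ver.
  by apply: binorm_pure => //; apply: hochb_normalized.
- have [x [y [nx ny ->]]] := pu r s.+1; rewrite connesB_hor.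
  by apply: binorm_pure => //; apply: connesB_normalized.
- apply: binormZ; have [x [y [nx ny ->]]] := pu r.+1 s; rewrite connesB_ver.
  by apply: binorm_pure => //; apply: connesB_normalized.
Qed.

Lemma Tot_compP n u : (forall r s, binorm (u r s)) -> Tot n (Tot_comp n u).
Proof.
move=> bu; split=> r s; rewrite /Tot_comp; last by move/eqP/negPf ->.
by case: eqP => _; [apply: bu|apply: binorm0].
Qed.

Lemma Tot0 n : Tot n (0 : bifam X Y).
Proof. by split=> // r s; apply: binorm0. Qed.

Lemma Tot_lin n a (u v : bifam X Y) : Tot n u -> Tot n v -> Tot n (a *: u + v).
Proof.
move=> [bu su] [bv sv]; split=> r s; first exact: (binorm_lin a (bu r s) (bv r s)).
by move=> h; rewrite !fam_DE !fam_ZE su // sv // scaler0 addr0.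
Qed.

Lemma back_hor k r s (x : X r) (y : Y s) :
  @back K (hor X Y r) k s (x \ox y) = x \ox back k y.
Proof. by elim: k => //= k ->; rewrite tmap_pure. Qed.

Lemma front_ver k r s (x : X r) (y : Y s) :
  @front K (ver X Y s) k r (x \ox y) = front k x \ox y.
Proof. by elim: k => //= k ->; rewrite tmap_pure. Qed.

Lemma AWrs_pure r s (x : X r) (y : Y s) : AWrs (x \ox y) = front s x \ox back r y.
Proof. by rewrite /AWrs back_hor front_ver. Qed.

Lemma AWrs_linear r s : linear (@AWrs K X Y r s).
Proof. exact: (comp_lin (@front_linear K (ver X Y _) _ _) (@back_linear K (hor X Y _) _ _)). Qed.

Lemma tens_cast_linear m m' n n' (em : m = m') (en : n = n') : linear (@tens_cast K X Y _ _ _ _ em en).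
Proof. by case: m' / em; case: n' / en. Qed.

Lemma AW_linear n : linear (fun u : bifam X Y => AW u n).
Proof.
apply: sum_lin => r; apply: (comp_lin (@tens_cast_linear _ _ _ _ _ _)).
exact: (comp_lin (@AWrs_linear _ _)).
Qed.

Lemma eq_AW n (u v : bifam X Y) : (forall r s, (r + s)%N = n -> u r s = v r s) ->
  AW u n = AW v n.
Proof. by move=> e; apply: eq_bigr => r _; rewrite e // subnKC // -ltnS. Qed.

Lemma tens_cast_normalized m m' k (em : m = k) (em' : m' = k) (x : X m) (y : Y m') :
  x \in cc_mem X m -> y \in cc_mem Y m' ->
  (forall j, (j < k)%N -> killed j x \/ killed j y) ->
  normalized (diag X Y) (tens_cast em em' (x \ox y) : diag X Y k).
Proof.
case: k / em em' => em'; case: m / em' x => x mx my kxy /=.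
have mt := tens_mem mx my.
case: m' x y mx my kxy mt => // m x y _ _ kxy mt; split=> // j; rewrite /= tmap_pure.
have [kx|ky] := kxy j (ltn_ord j).
  by rewrite kx // (linear0_of (pure_linl _)).
by rewrite ky // (linear0_of (pure_linr _)).
Qed.

(** The front factor is killed by the codegeneracies of index at least s, the
    back factor by the others. *)
Lemma AW_normalized n (u : bifam X Y) : pure_fam u -> normalized (diag X Y) (AW u n).
Proof.
move=> pu; apply: normalized_sum => r _.
have [x [y [nx ny ->]]] := pu r (n - r)%N; rewrite AWrs_pure.
have lr : (r <= n)%N by rewrite -ltnS.
apply: tens_cast_normalized.
- exact/front_mem/normalized_mem.
- exact/back_mem/normalized_mem.
move=> j lj; case: (leqP (n - r) j) => h; [left|right].
  by apply: front_killed => //; rewrite subnK.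
exact: back_killed.
Qed.
End Bi.

(** * The map Phi on lists *)

Section Theta.
Variables (K : fieldType) (H : ualgType K) (hH : hopf H) (A B : ualgType K).
Variables (mA : moduleAlgebra hH A) (cB : comoduleAlgebra hH B).
Local Notation rho := (ca_rho cB).
Local Notation act := (ma_act mA).
Local Notation Sv := (antipV hH).

Lemma actL_coactL (U : lmodType K) u as_ bs (F : seq A -> H -> seq B -> U) :
  actL mA u as_ (fun t => coactL cB bs (F t)) =
  coactL cB bs (fun h s => actL mA u as_ (fun t => F t h s)).
Proof.
elim: bs F => [|b bs IH] F //=.
by rewrite actL_tsum; apply: eq_tsum => v b'; apply: IH.
Qed.

Section Values.
Variable U : lmodType K.
Implicit Types F : seq B -> seq A -> U.

Definition ml2 n F := (forall s, size s = n -> mlin n (fun bs => F bs s)) /\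
  (forall bs, size bs = n -> mlin n (F bs)).

(** A step of the sorting of a^0 b^0 a^1 b^1 ... into b's followed by a's, by means
    of a |x b = (1 |x b_<0>)(S^{-1}(b_<-1>) . a |x 1): here a moves past b and bs. *)
Definition pstep a b F bs as_ : U :=
  coactL cB (b :: bs) (fun h s => F s (act (Sv h) a :: as_)).

Definition step (r : crossed mA cB) F bs as_ : U :=
  tsum (r : tens A B) (fun a b => pstep a b F bs as_).

(** The leftmost a is moved last and past all b's, so it sees the innermost
    coactions; hence the tail of the list is the outermost part of the recursion. *)
Fixpoint Theta (rs : seq (crossed mA cB)) F : U :=
  if rs is r :: rs' then Theta rs' (step r F) else F [::] [::].

Lemma eq_pstep n F F' a b bs as_ : size bs = n -> size as_ = n ->
  (forall s t, size s = n.+1 -> size t = n.+1 -> F s t = F' s t) ->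
  pstep a b F bs as_ = pstep a b F' bs as_.
Proof.
move=> eb ea e; apply: eq_coactL => h s es.
by apply: e; rewrite ?es /= ?eb ?ea.
Qed.

Lemma eq_step n F F' r bs as_ : size bs = n -> size as_ = n ->
  (forall s t, size s = n.+1 -> size t = n.+1 -> F s t = F' s t) ->
  step r F bs as_ = step r F' bs as_.
Proof. by move=> eb ea e; apply: eq_tsum => a b; apply: (eq_pstep _ _ eb ea). Qed.

Lemma eq_Theta n F F' rs : size rs = n ->
  (forall s t, size s = n -> size t = n -> F s t = F' s t) -> Theta rs F = Theta rs F'.
Proof.
elim: rs n F F' => [|r rs IH] n F F' /= en e; first by apply: e.
apply: (IH (size rs)) => // s t es et; apply: (eq_step _ es et) => s' t' es' et'.
by apply: e; rewrite -en.
Qed.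

Lemma pstep_hml n F a as_ : ml2 n.+1 F -> size as_ = n ->
  hml n.+1 (fun h s => F s (act (Sv h) a :: as_)).
Proof.
move=> [f1 f2] ea; split=> [s es|h]; last by apply: f1; rewrite /= ea.
by apply: (lin_head (f2 _ es) ea); lin.
Qed.

Lemma pstep_bil n F bs as_ : ml2 n.+1 F -> size bs = n -> size as_ = n ->
  bilinear_map (fun a b => pstep a b F bs as_).
Proof.
move=> mF eb ea; split=> [b|a].
  apply: coactL_param => h s es; apply: (lin_head (mF.2 _ _) ea); last by lin.
  by rewrite es /= eb.
exact: (mlin_head (coactL_mlin cB (pstep_hml a mF ea)) eb).
Qed.

Lemma step_lin n F bs as_ : ml2 n.+1 F -> size bs = n -> size as_ = n ->
  linear (fun r => step r F bs as_).
Proof. by move=> mF eb ea; apply: tsum_lin; apply: (pstep_bil mF eb ea). Qed.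

Lemma step_pure n F a b bs as_ : ml2 n.+1 F -> size bs = n -> size as_ = n ->
  step (a \ox b) F bs as_ = pstep a b F bs as_.
Proof. by move=> mF eb ea; apply: tsum_pure; apply: (pstep_bil mF eb ea). Qed.

Lemma step_ml2 n r F : ml2 n.+1 F -> ml2 n (step r F).
Proof.
move=> mF; split=> [s es|bs eb].
  by apply: mlin_tsum => a b; apply: (mlin_cons b (coactL_mlin cB (pstep_hml a mF es))).
apply: mlin_tsum => a b s1 s2 e; apply: coactL_param => h s es.
by apply: (mF.2 _ _ (_ :: s1) s2); rewrite ?es /= ?eb // addSn e.
Qed.

Lemma pstep_param (Z : lmodType K) n (F : Z -> seq B -> seq A -> U) a b bs as_ :
  size bs = n -> size as_ = n ->
  (forall s t, size s = n.+1 -> size t = n.+1 -> linear (fun z => F z s t)) ->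
  linear (fun z => pstep a b (F z) bs as_).
Proof.
move=> eb ea lF; apply: coactL_param => h s es.
by apply: lF; rewrite ?es /= ?eb ?ea.
Qed.

Lemma Theta_param (Z : lmodType K) n (F : Z -> seq B -> seq A -> U) rs : size rs = n ->
  (forall s t, size s = n -> size t = n -> linear (fun z => F z s t)) ->
  linear (fun z => Theta rs (F z)).
Proof.
elim: rs n F => [|r rs IH] n F /= en lF; first by apply: lF.
apply: (IH (size rs)) => // s t es et; apply: tsum_param => a b.
apply: (pstep_param (F := F) _ _ es et) => s' t' es' et'.
by apply: lF; rewrite -en.
Qed.

Lemma Theta_mlin n F : ml2 n F -> mlin n (fun rs => Theta rs F).
Proof.
elim: n F => [|n IH] F mF; first exact: mlin0.
apply: mlinS => [rs e|r] /=.
  by apply: (Theta_param e) => s t es et; apply: (step_lin mF).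
by apply: (IH (step r F)); apply: step_ml2.
Qed.

Lemma Theta_tsum (V W : lmodType K) (t : tens V W) rs (F : V -> W -> seq B -> seq A -> U) :
  Theta rs (fun bs as_ => tsum t (fun v w => F v w bs as_)) =
  tsum t (fun v w => Theta rs (F v w)).
Proof.
elim: rs F => [|r rs IH] F //=.
rewrite -IH; apply: (eq_Theta (erefl _)) => s t' _ _.
rewrite /step tsum_exch; apply: eq_tsum => a b.
exact: coactL_tsum.
Qed.

Lemma ml2_mg n i F : (i < n)%N -> ml2 n F -> ml2 n.+1 (fun bs as_ => F (mg i bs) (mg i as_)).
Proof.
move=> lin [f1 f2]; split=> [s es|bs eb].
  by apply: (mlin_mg (F := fun bs => F bs (mg i s))) => //; apply: f1; rewrite size_mg es.
by apply: (mlin_mg (F := F (mg i bs))) => //; apply: f2; rewrite size_mg eb.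
Qed.

(** The product (a |x b)(a' |x b') = a (b_<-1> . a') |x b_<0> b' contains
    b_<-1>; after moving, S^{-1}(b_<-2>) b_<-3> acts on a' and cancels. *)
Lemma step_mul m F r r' bs as_ : ml2 m.+1 F -> size bs = m -> size as_ = m ->
  step (r ** r') F bs as_ =
  step r' (step r (fun s t => F (mg 0 s) (mg 0 t))) bs as_.
Proof.
move=> mF eb ea; have mF' := ml2_mg (ltn0Sn m) mF.
set F' := fun s t => _ in mF' *.
move: r; apply: lin_tens_ext => [||a b].
- exact: (comp_lin (step_lin mF eb ea) (amul_linl _)).
- apply: tsum_param => a' b'; apply: (pstep_param (F := fun r => step r F') _ _ eb ea) => s t es et.
  exact: (step_lin mF' es et).
move: r'; apply: lin_tens_ext => [||a' b'].
- exact: (comp_lin (step_lin mF eb ea) (amul_linr _)).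
- exact: (step_lin (step_ml2 _ mF') eb ea).
rewrite (step_pure _ _ (step_ml2 _ mF') eb ea).
(* from here on w, x, y and b2 stand for b_<-3>, b_<-2>, b_<-1> and b_<0> *)
pose L c b2 := coactL cB (b' :: bs) (fun h s => F (mg 0 (b2 :: s)) (act (Sv h) c :: as_)).
have L1 b2 : linear (fun c => L c b2).
  apply: coactL_param => h s es; apply: (lin_head (mF.2 _ _) ea); last by lin.
  by rewrite size_mg /= es /= ?eb.
have L2 c : linear (fun b2 => L c b2).
  apply: coactL_param => h s es.
  have mg0 := mlin_mg (ltn0Sn m) (mF.1 (act (Sv h) c :: as_) (congr1 S ea)).
  by apply: (mlin_head mg0); rewrite es /= eb.
transitivity (tsum (rho b) (fun w b1 => tsum (rho b1) (fun v b2 =>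
    tsum (Delta hH v) (fun x y => L (act (Sv y) a ** act (Sv x ** w) a') b2)))).
  rewrite [_ ** _]crossed_mulE.
  rewrite (_ : crossed_mul_pure mA cB a b a' b' =
    tsum (rho b) (fun w b1 => (a ** act w a') \ox (b1 ** b'))) //.
  rewrite (tsum_map _ _ (step_lin mF eb ea)); apply: eq_tsum => w b1.
  rewrite (step_pure _ _ mF eb ea) /pstep.
  rewrite (coactL_mg cB (i := 0) (n := m.+1) (bs := [:: b1, b' & bs]) _ _ (pstep_hml _ mF ea)) //=.
    apply: eq_tsum => v b2.
    rewrite -(tsum_map (L := fun c => L c b2)); last exact: L1.
    rewrite /L /=; apply: eq_tsum => u b''; apply: eq_coactL => h s es.
    congr (F _ (_ :: _)).
    rewrite antipVM (lactM (ma_actP mA)) antipV_actM; congr (act _ _).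
    by apply: eq_tsum => x y; rewrite (lactM (ma_actP mA)).
  by rewrite eb.
transitivity (tsum (rho b) (fun y b2 => L (act (Sv y) a ** a') b2)).
  have LL c' d : linear (fun y => L (act (Sv y) a ** c') d).
    by apply: (comp_lin (L1 _)); lin.
  have LR c' d : linear (fun z => L (c' ** act z a') d).
    by apply: (comp_lin (L1 _)); lin.
  transitivity (tsum (rho b) (fun w b1 => tsum (rho b1) (fun x b1' =>
    tsum (rho b1') (fun y b2 => L (act (Sv y) a ** act (Sv x ** w) a') b2)))).
    apply: eq_tsum => w b1.
    rewrite (tsum_coassoc (g := fun x y b2 => L (act (Sv y) a ** act (Sv x ** w) a') b2)
      _ (ca_rhoP cB)) //.
    by split=> // y z; apply: (comp_lin (LR _ _)); lin.
  rewrite -(tsum_coassoc (g := fun w x b1' => tsum (rho b1') (fun y b2 =>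
    L (act (Sv y) a ** act (Sv x ** w) a') b2)) _ (ca_rhoP cB)).
    have lT : linear (fun b1' => tsum (rho b1') (fun y b2 => L (act (Sv y) a ** a') b2)).
      exact: (tsum_comp (coact_lin (ca_rhoP cB))).
    rewrite -[RHS](tsum_counit b (ca_rhoP cB) lT); apply: eq_tsum => u b1'.
    rewrite (@tsum_antipVl _ _ hH _ (fun z => tsum (rho b1') (fun y b2 =>
      L (act (Sv y) a ** act z a') b2))).
      by rewrite (lact1 (ma_actP mA)).
    exact: tsum_param.
  split=> [x z|w z|w x].
  - by apply: tsum_param => y b2; apply: (comp_lin (LR _ _)); lin.
  - by apply: tsum_param => y b2; apply: (comp_lin (LR _ _)); lin.
  - exact: (tsum_comp (coact_lin (ca_rhoP cB))).
pose G y b2 h h2 s := F (mg 0 (b2 :: s)) ((act (Sv (y ** h2)) a ** act (Sv h) a') :: as_).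
have G1 y b2 h : hml m.+1 (G y b2 h).
  split=> [s es|h2].
    apply: (lin_head (mF.2 _ _) ea); last by lin.
    by rewrite size_mg /= es.
  exact: (mlin_cons b2 (mlin_mg (ltn0Sn m) (mF.1 (_ :: as_) (congr1 S ea)))).
have G2 y b2 h2 : hml m.+1 (fun h => G y b2 h h2).
  split=> [s es|h]; last by case: (G1 y b2 h).
  apply: (lin_head (mF.2 _ _) ea); last by lin.
  by rewrite size_mg /= es.
transitivity (tsum (rho b) (fun y b2 => coactL cB (b' :: bs) (fun h s =>
   tsum (Delta hH h) (fun x1 x2 => G y b2 x1 x2 s)))).
  apply: eq_tsum => y b2; apply: eq_coactL => h s es.
  rewrite antipV_actM (tsum_map (L := fun c => F (mg 0 (b2 :: s)) (c :: as_))).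
    by apply: eq_tsum => x1 x2; rewrite /G antipVM (lactM (ma_actP mA)).
  by apply: (lin_head (mF.2 _ _) ea); rewrite // size_mg /= es /= ?eb.
transitivity (tsum (rho b) (fun y b2 => coactL cB (b' :: bs) (fun h s =>
   coactL cB s (fun h2 s2 => G y b2 h h2 s2)))).
  apply: eq_tsum => y b2; apply: (coactL_assoc cB (n := m.+1)) => //.
  by rewrite /= eb.
rewrite -coactL_tsum; apply: eq_coactL => h s es.
by rewrite (step_pure _ _ mF') //= ?es /= ?eb ?ea.
Qed.

(** A factor standing to the left of the position i only sees the coaction of
    the product of its right neighbours, which is multiplicative. *)
Lemma Theta_mg n i F rs : size rs = n.+1 -> (i < n)%N -> ml2 n F ->
  Theta (mg i rs) F = Theta rs (fun bs as_ => F (mg i bs) (mg i as_)).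
Proof.
elim: i n F rs => [|i IH] [|n] F [|r [|r' rs]] // [e] lin mF.
  by apply: (eq_Theta e) => s t es et; apply: (step_mul r r' mF es et).
have e' : size (r' :: rs) = n.+1 by rewrite /= e.
transitivity (Theta (mg i (r' :: rs)) (step r F)); first by [].
rewrite (IH n (step r F) _ e') //; last exact: step_ml2.
apply: (eq_Theta e') => s t es et; apply: eq_tsum => a b.
rewrite /pstep -[b :: mg i s]/(mg i.+1 (b :: s)).
have et' : size (mg i t) = n by rewrite size_mg et.
by rewrite (coactL_mg cB (n := n.+1) _ _ (pstep_hml a mF et')) //= es.
Qed.

Lemma Theta_ins n i F rs : size rs = n -> (i <= n)%N -> ml2 n.+1 F ->
  Theta (ins i rs) F = Theta rs (fun bs as_ => F (ins i bs) (ins i as_)).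
Proof.
have base m F' bs as_ : size bs = m -> size as_ = m -> ml2 m.+1 F' ->
    step aone F' bs as_ = F' (aone :: bs) (aone :: as_).
  move=> eb ea mF; rewrite (step_pure aone aone mF eb ea) /pstep.
  rewrite -[aone :: bs]/(ins 0 bs) (coactL_ins cB eb _ (pstep_hml aone mF ea)) //.
  rewrite -(coactL_counit cB eb (F := fun s => F' (aone :: s) (aone :: as_))).
    apply: eq_coactL => h s es; rewrite antipV_act1.
    by rewrite (linearZ_of _ _ (mlin_head (mF.2 _ _) ea)) //= es eb.
  by apply: (mlin_cons _ (mF.1 _ _)); rewrite /= ea.
elim: i n F rs => [|i IH] n F rs e lin mF.
  transitivity (Theta rs (step aone F)); first by case: rs e.
  by apply: (eq_Theta e) => s t es et; rewrite (base n).
case: n rs e lin mF => [|n] [|r rs] // [e] lin mF.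
transitivity (Theta (ins i rs) (step r F)); first by [].
rewrite (IH n (step r F) rs e) //; last exact: step_ml2.
apply: (eq_Theta e) => s t es et; apply: eq_tsum => a b.
rewrite /pstep -[b :: ins i s]/(ins i.+1 (b :: s)).
have et' : size (ins i t) = n.+1 by rewrite size_ins et.
by rewrite (coactL_ins cB (n := n.+1) _ _ (pstep_hml a mF et')) //= es.
Qed.

(** When the values of F only involve the last b through the diagonal action of
    b_<-1> on the a's, that action undoes the moves past b factor by factor:
    it cancels against the factor S^{-1}(b_<-2>) in front. *)
Lemma Theta_last n a b rs F (G : B -> seq B -> seq A -> U) : size rs = n ->
  (forall bs as_ c, size bs = n -> size as_ = n.+1 ->
     F (rcons bs c) as_ = tsum (rho c) (fun u c' => actL mA u as_ (G c' bs))) ->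
  ml2 n.+1 F ->
  (forall bs as_, size bs = n -> size as_ = n.+1 -> linear (fun c => G c bs as_)) ->
  (forall c as_, size as_ = n.+1 -> mlin n (fun bs => G c bs as_)) ->
  (forall c bs, size bs = n -> mlin n.+1 (G c bs)) ->
  Theta (rcons rs (a \ox b)) F = Theta rs (fun bs as_ => G b bs (rcons as_ a)).
Proof.
elim: rs n F G => [|r rs IH] n F G en hF mF G1 G2 G3.
  case: n / en hF mF G1 G2 G3 => hF mF G1 G2 G3.
  rewrite [LHS]/= (step_pure (n := 0)) // /pstep /=.
  have lG z : linear (fun c => G c [::] [:: z]) by apply: G1.
  have lA c : linear (fun z => G c [::] [:: act z a]).
    by apply: (lin_head (G3 c [::] erefl) (s := [::])) => //; lin.
  transitivity (tsum (rho b) (fun h b' => tsum (rho b') (fun u b'' =>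
      G b'' [::] [:: act (u ** Sv h) a]))).
    apply: eq_tsum => h b'; rewrite amul1r (hF [::]) //; apply: eq_tsum => u b''.
    rewrite /= -(tsum_counitr hH (f := fun z => G b'' [::] [:: act (z ** Sv h) a])).
      by apply: eq_tsum => x y; rewrite (lactM (ma_actP mA)).
    by apply: (comp_lin (lA _)); lin.
  rewrite -(tsum_coassoc (g := fun h u b'' => G b'' [::] [:: act (u ** Sv h) a]) _ (ca_rhoP cB)).
    rewrite -[RHS](tsum_counit b (ca_rhoP cB) (lG a)); apply: eq_tsum => u b'.
    rewrite (@tsum_antipVr _ _ hH _ (fun z => G b' [::] [:: act z a])) //.
    by rewrite (lact1 (ma_actP mA)).
  by split=> [u c|h c|h u] //; apply: (comp_lin (lA _)); lin.
case: n en hF mF G1 G2 G3 => // n [en] hF mF G1 G2 G3.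
pose G' c bs as_ := tsum (r : tens A B) (fun a0 b0 =>
  coactL cB (b0 :: bs) (fun h s => G c s (act (Sv h) a0 :: as_))).
rewrite [LHS]/=; apply: (IH n (step r F) G' en).
- move=> bs as_ c eb ea.
  transitivity (tsum (r : tens A B) (fun a0 b0 => tsum (rho c) (fun u c' =>
      actL mA u as_ (fun t => coactL cB (b0 :: bs) (fun h s => G c' s (act (Sv h) a0 :: t)))))); last first.
    by rewrite tsum_exch; apply: eq_tsum => u c'; rewrite actL_tsum.
  apply: eq_tsum => a0 b0; rewrite /pstep -rcons_cons coactL_rcons.
  (* w, y and c' are the slots of c_<-2> S^{-1}(c_<-3>), c_<-1> and c_<0> *)
  pose P w y c' := coactL cB (b0 :: bs) (fun h s =>
    actL mA y as_ (fun t => G c' s (act (w ** Sv h) a0 :: t))).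
  have sz s : size s = size (b0 :: bs) -> size s = n.+1 by move->; rewrite /= eb.
  have P1 y c' : linear (fun w => P w y c').
    apply: coactL_param => h s /sz es; apply: actL_param => t et.
    by apply: (lin_head (G3 c' s es)); [rewrite et ea|lin].
  have P2 w c' : linear (fun y => P w y c').
    apply: coactL_param => h s /sz es; apply: (actL_linh mA ea).
    exact: (mlin_cons _ (G3 c' s es)).
  have P3 w y : linear (fun c' => P w y c').
    apply: coactL_param => h s /sz es; apply: actL_param => t et.
    by apply: G1; rewrite //= et ea.
  transitivity (tsum (rho c) (fun v b' => tsum (rho b') (fun u b'' =>
     tsum (Delta hH u) (fun x y => P (x ** Sv v) y b'')))).
    apply: eq_tsum => v b'.
    transitivity (coactL cB (b0 :: bs) (fun h s => tsum (rho b') (fun u b'' =>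
       tsum (Delta hH u) (fun x y =>
         actL mA y as_ (fun t => G b'' s (act (x ** Sv v ** Sv h) a0 :: t)))))).
      apply: eq_coactL => h s /sz es; rewrite hF //=; last by rewrite ea.
      apply: eq_tsum => u b''; apply: eq_tsum => x y; apply: eq_actL => t _.
      by rewrite -(lactM (ma_actP mA)) antipVM amulA.
    by rewrite coactL_tsum; apply: eq_tsum => u b''; rewrite coactL_tsum.
  transitivity (tsum (rho c) (fun v b' => tsum (rho b') (fun x c' =>
     tsum (rho c') (fun y b'' => P (x ** Sv v) y b'')))).
    apply: eq_tsum => v b'.
    rewrite (tsum_coassoc (g := fun x y b'' => P (x ** Sv v) y b'') _ (ca_rhoP cB)) //.
    by split=> // y z; apply: (comp_lin (P1 _ _)); lin.
  rewrite -(tsum_coassoc (g := fun v x c' => tsum (rho c') (fun y b'' =>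
     P (x ** Sv v) y b'')) _ (ca_rhoP cB)).
    have lP : linear (fun c' => tsum (rho c') (fun y b'' => P aone y b'')).
      exact: (tsum_comp (coact_lin (ca_rhoP cB))).
    transitivity (tsum (rho c) (fun y b'' => P aone y b'')).
      rewrite -[RHS](tsum_counit c (ca_rhoP cB) lP); apply: eq_tsum => u c'.
      rewrite (@tsum_antipVr _ _ hH _ (fun w => tsum (rho c') (fun y b'' => P w y b''))) //.
      exact: tsum_param.
    apply: eq_tsum => u c'; rewrite actL_coactL; apply: eq_coactL => h s _.
    by apply: eq_actL => t _; rewrite amul1l.
  split=> [x z|v z|v x].
  - by apply: tsum_param => y b''; apply: (comp_lin (P1 _ _)); lin.
  - by apply: tsum_param => y b''; apply: (comp_lin (P1 _ _)); lin.
  - exact: (tsum_comp (coact_lin (ca_rhoP cB))).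
- exact: step_ml2.
- move=> bs as_ eb ea; apply: tsum_param => a0 b0; apply: coactL_param => h s es.
  by apply: G1; rewrite ?es /= ?eb ?ea.
- move=> c as_ ea; apply: mlin_tsum => a0 b0; 
    apply: (mlin_cons b0 (coactL_mlin cB (G := fun h s => G c s (act (Sv h) a0 :: as_)) _)).
  split=> [s es|h].
    by apply: (lin_head (G3 c s es) ea); lin.
  by apply: G2; rewrite /= ea.
- move=> c bs eb; apply: mlin_tsum => a0 b0 s1 s2 e; apply: coactL_param => h s es.
  apply: (G3 c s _ (_ :: s1) s2); last by rewrite /= addSn e.
  by rewrite es /= eb.
Qed.
End Values.
End Theta.

(** * Phi is a map of cocyclic modules *)

Section IteratedCoactions.
Variables (K : fieldType) (H : ualgType K) (hH : hopf H) (A B : ualgType K).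
Variables (mA : moduleAlgebra hH A) (cB : comoduleAlgebra hH B).
Local Notation rho := (ca_rho cB).
Local Notation act := (ma_act mA).
Local Notation Sv := (antipV hH).

Lemma big_coactsS (V : nmodType) l b (G : seq H * B -> V) :
  \sum_(c <- coacts cB l.+1 b) G c =
  \sum_(p <- terms (rho b)) \sum_(c <- coacts cB l p.2) G (rcons c.1 p.1, c.2).
Proof. exact: big_allpairs_dep. Qed.

(** Iterated coactions grow at the outer end by definition, but the recursion
    for Phi adds coactions at the inner end. *)
Lemma big_coacts_inner (V : nmodType) l b (G : seq H * B -> V) :
  \sum_(c <- coacts cB l.+1 b) G c =
  \sum_(c <- coacts cB l b) \sum_(p <- terms (rho c.2)) G (p.1 :: c.1, p.2).
Proof.
elim: l b G => [|l IH] b G.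
  by rewrite big_coactsS big_seq1; apply: eq_bigr => p _; rewrite big_seq1.
rewrite big_coactsS [RHS]big_coactsS; apply: eq_bigr => p _.
exact: (IH p.2 (fun c => G (rcons c.1 p.1, c.2))).
Qed.

Lemma big_choices_nested (V : nmodType) (T T' T'' : Type) n
    (s'' : 'I_n -> seq T'') (s : 'I_n -> seq T) (q : T -> seq T') (f : T -> T' -> T'')
    (G : ('I_n -> T'') -> V) :
  (forall j (F : T'' -> V), \sum_(c <- s'' j) F c =
     \sum_(c <- s j) \sum_(p <- q c) F (f c p)) ->
  \sum_(c <- choices s'') G c = \sum_(c <- choices s)
    \sum_(p <- choices (fun j => q (c j))) G (fun j => f (c j) (p j)).
Proof.
elim: n s'' s G => [|n IH] s'' s G e.
  by rewrite !big_seq1; congr G; apply/funext => -[].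
rewrite !big_choicesS e; apply: eq_bigr => x _.
transitivity (\sum_(c <- choices (fun j => s (fintype.lift ord0 j))) \sum_(p0 <- q x)
    \sum_(p <- choices (fun j => q (c j)))
      G (fun i => if unlift ord0 i is Some j then f (c j) (p j) else f x p0)).
  rewrite [RHS]exchange_big; apply: eq_bigr => p0 _.
  by rewrite (IH _ (fun j => s (fintype.lift ord0 j))).
apply: eq_bigr => c _; rewrite big_choicesS unlift_none; apply: eq_bigr => p0 _.
have -> : (fun j => q (if unlift ord0 (fintype.lift ord0 j) is Some j0 then c j0 else x)) =
    (fun j : 'I_n => q (c j)).
  by apply/funext => j; rewrite liftK.
apply: eq_bigr => p _; congr G; apply/funext => i.
by case: (unlift ord0 i).
Qed.

Variable U : lmodType K.
Implicit Types F : seq B -> seq A -> U.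

Fixpoint pTheta (l : seq (A * B)) F : U :=
  if l is p :: l' then pTheta l' (pstep mA cB p.1 p.2 F) else F [::] [::].

(** The closed formula with its iterated coactions is the recursion: the
    innermost coactions of all the b's are the ones used by the leftmost a. *)
Lemma coacts_pTheta n (a : 'I_n -> A) (b : 'I_n -> B) F :
  \sum_(c <- choices (fun j => coacts cB j.+1 (b j)))
    F (ls (fun j => (c j).2))
      (ls (fun k => act (Sv (\big[amul/aone]_(j < n | (k <= j)%N) (c j).1`_k)) (a k))) =
  pTheta (ls (fun i => (a i, b i) : (A * B)%type)) F.
Proof.
elim: n a b F => [|n IH] a b F; first by rewrite big_seq1 !ls0.
rewrite [in RHS]lsS [RHS]/= -IH big_choicesS.
rewrite big_coactsS; under eq_bigr do rewrite big_seq1.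
pose s'' (j : 'I_n) := coacts cB (fintype.lift ord0 j).+1 (b (fintype.lift ord0 j)).
pose s' (j : 'I_n) := coacts cB j.+1 (b (fintype.lift ord0 j)).
rewrite -/s''; under eq_bigr => p0 _.
  rewrite (@big_choices_nested _ _ _ _ n s'' s' (fun c => terms (rho c.2))
    (fun c p => (p.1 :: c.1, p.2))); last by move=> j G; rewrite -big_coacts_inner.
  over.
rewrite exchange_big; apply: eq_bigr => c _ /=.
rewrite /pstep /=; apply: eq_bigr => p0 _.
rewrite -choices_coactL; apply: eq_bigr => p _.
rewrite !lsS unlift_none; congr (F (_ :: _) (_ :: _)).
- by congr ls; apply/funext => j; rewrite liftK.
- rewrite big_mkcond big_ord_recl /= unlift_none /=.
  by congr (act (Sv (_ ** _)) _); apply: eq_bigr => j _; rewrite liftK.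
- congr ls; apply/funext => k; congr (act (Sv _) _).
  rewrite big_mkcond big_ord_recl /= amul1l [in RHS]big_mkcond /=.
  by apply: eq_bigr => j _; rewrite liftK /bump /= !add1n ltnS.
Qed.

Lemma choices_Theta n (r : 'I_n -> crossed mA cB) F :
  \sum_(e <- choices (fun i => terms (r i : tens A B)))
     pTheta (ls (fun i => ((e i).1, (e i).2) : (A * B)%type)) F = Theta (ls r) F.
Proof.
elim: n r F => [|n IH] r F; first by rewrite big_seq1 !ls0.
rewrite big_choicesS lsS.
transitivity (tsum (r ord0 : tens A B) (fun a b =>
  Theta (ls (fun j => r (fintype.lift ord0 j))) (pstep mA cB a b F))).
  apply: eq_bigr => p _; rewrite -IH; apply: eq_bigr => e _.
  by rewrite lsS /= unlift_none; congr (pTheta (ls _) _); apply/funext => j; rewrite liftK.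
by rewrite -Theta_tsum.
Qed.
End IteratedCoactions.

Section PhiMap.
Variables (K : fieldType) (H : ualgType K) (hH : hopf H) (A B : ualgType K).
Variables (mA : moduleAlgebra hH A) (cB : comoduleAlgebra hH B).
Variables (N M : lmodType K) (sN : saydModule hH N) (sM : saydContramodule hH M).
Local Notation rho := (ca_rho cB).
Local Notation act := (ma_act mA).
Local Notation Sv := (antipV hH).
Local Notation X := (HcolinC cB sN).
Local Notation Y := (HlinC mA sM).
Local Notation R := (crossed mA cB).
Local Notation L := (coeq sN sM).
Local Notation Z := (ordC R L).

Lemma to_coeq_bil : bilinear_map (to_coeq sN sM).
Proof.
split=> [m|n]; apply: (comp_lin (@cls_is_linear _ _ _)); apply: (comp_lin (@cls_is_linear _ _ _)).
  exact: pure_linl.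
exact: pure_linr.
Qed.

Lemma to_coeq_act n h m : to_coeq sN sM (sm_act sN n h) m = to_coeq sN sM n (sc_act sM h m).
Proof. by congr (cls _ _); apply/cls_eq; apply: span_gen. Qed.

Lemma to_coeq_alpha n (f : Defs.hom H M) : to_coeq sN sM n (sc_alpha sM f) =
  tsum (sm_rho sN n) (fun p n' => to_coeq sN sM n' (f p)).
Proof.
transitivity (cls (@coeq_rel K H hH N M sN sM)
  (\sum_(p <- terms (sm_rho sN n)) cls (@tensH_rel K H hH N M sN sM) (p.2 \ox f p.1))).
  by apply/cls_eq; apply: span_gen.
exact: (linear_sum_of _ _ (@cls_is_linear _ _ _)).
Qed.

Definition pairing n (psi : mult n B N) (phi : mult n A M) (bs : seq B) (as_ : seq A) : L :=
  to_coeq sN sM (psi (fn n bs)) (phi (fn n as_)).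

Lemma pairing_ml2 n psi phi : ml2 n (@pairing n psi phi).
Proof.
split=> [s es|s es].
  by apply: (mlin_map (to_coeq_bil.1 _)); apply: mult_mlin.
by apply: (mlin_map (to_coeq_bil.2 _)); apply: mult_mlin.
Qed.

Lemma Phi_Theta n (t : tens (mult n.+1 B N) (mult n.+1 A M)) (r : 'I_n.+1 -> R) :
  Phi sN sM t r = tsum t (fun psi phi => Theta (ls r) (pairing psi phi)).
Proof.
apply: eq_bigr => w _; rewrite -choices_Theta; apply: eq_bigr => e _.
rewrite -coacts_pTheta; apply: eq_bigr => c _.
by rewrite /pairing !lsK.
Qed.

Lemma pairing_bil n (rs : seq R) : size rs = n ->
  bilinear_map (fun (psi : mult n B N) phi => Theta rs (pairing psi phi)).
Proof.
move=> e; split=> [phi|psi]; apply: (Theta_param e) => s t _ _.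
  by move=> a x y; rewrite /pairing mult_linE to_coeq_bil.1.
by move=> a x y; rewrite /pairing mult_linE to_coeq_bil.2.
Qed.

Lemma Phi_mlin n (t : tens (mult n.+1 B N) (mult n.+1 A M)) :
  (fun r => Phi sN sM t r) \in @multilin_pred K n.+1 R L.
Proof.
have m : mlin n.+1 (fun rs : seq R => tsum t (fun psi phi => Theta rs (pairing psi phi))).
  by apply: mlin_tsum => psi phi; apply: Theta_mlin; apply: pairing_ml2.
have -> : (fun r : 'I_n.+1 -> R => Phi sN sM t r) =
    fun r : 'I_n.+1 -> R => tsum t (fun psi phi => Theta (ls r) (pairing psi phi)).
  by apply/funext => r; rewrite Phi_Theta.
exact: mlin_mult m.
Qed.

Definition PhiC n (t : diag X Y n) : Z n := Subm (Phi_mlin t).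

Lemma PhiC_fn n (t : diag X Y n) rs : size rs = n.+1 ->
  (PhiC t : mult n.+1 R L) (fn _ rs) = tsum t (fun psi phi => Theta rs (pairing psi phi)).
Proof. by move=> e; rewrite [LHS]/mult_fun /= Phi_Theta ls_fn. Qed.

Lemma PhiC_linear n : linear (@PhiC n).
Proof.
move=> a t u; apply: mult_eqP => rs e; rewrite mult_linE !PhiC_fn //.
exact: (tsum_lin (pairing_bil e)).
Qed.

Lemma PhiC_pure n (psi : X n) (phi : Y n) rs : size rs = n.+1 ->
  (PhiC (psi \ox phi : diag X Y n) : mult n.+1 R L) (fn _ rs) = Theta rs (pairing psi phi).
Proof. by move=> e; rewrite PhiC_fn // tsum_pure //; apply: pairing_bil. Qed.

(** The diagonal is spanned by psi (x) phi with both factors equivariant, so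
    identities on it may be checked with equivariance of each factor at hand. *)
Lemma diag_ext n (W : lmodType K) (f g : tens (X n) (Y n) -> W) : linear f -> linear g ->
  (forall psi phi, psi \in cc_mem X n -> phi \in cc_mem Y n ->
     f (psi \ox phi) = g (psi \ox phi)) ->
  forall t, t \in cc_mem (diag X Y) n -> f t = g t.
Proof.
move=> lf lg e t /asboolP; elim=> [|a u v Pu _ IH].
  by rewrite (linear0_of lf) (linear0_of lg).
by rewrite lf lg IH; congr (_ *: _ + _); case: Pu => x y mx my; apply: e.
Qed.

Lemma PhiC_codegen n (j : 'I_n.+1) (t : diag X Y n.+1) : t \in cc_mem (diag X Y) n.+1 ->
  PhiC (codegen (diag X Y) j t) = codegen Z j (PhiC t).
Proof.
move: t; apply: diag_ext => [||psi phi _ _].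
- exact: (comp_lin (@PhiC_linear _) (@linearP _ _ _ _ _)).
- exact: (comp_lin (@linearP _ _ _ _ _) (@PhiC_linear _)).
rewrite /= tmap_pure; apply: mult_eqP => rs e.
rewrite codegen_fn // !PhiC_pure ?size_ins ?e //.
rewrite (Theta_ins e _ (pairing_ml2 _ _)) //; apply: (eq_Theta e) => s t es et.
by rewrite /pairing !codegen_fn.
Qed.

Lemma PhiC_inner n (i : 'I_n.+2) (t : diag X Y n) : (i <= n)%N -> t \in cc_mem (diag X Y) n ->
  PhiC (coface (diag X Y) i t) = coface Z i (PhiC t).
Proof.
move=> lin; move: t; apply: diag_ext => [||psi phi _ _].
- exact: (comp_lin (@PhiC_linear _) (@linearP _ _ _ _ _)).
- exact: (comp_lin (@linearP _ _ _ _ _) (@PhiC_linear _)).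
rewrite /= tmap_pure; apply: mult_eqP => rs e.
rewrite coface_fn // !PhiC_pure ?size_mg ?e //.
rewrite (Theta_mg e _ (pairing_ml2 _ _)) //; apply: (eq_Theta e) => s t es et.
by rewrite /pairing !coface_fn.
Qed.

(** In tau psi the value of psi is acted upon by b^n_<-1>; in the coequalizer this
    action moves to tau phi, where it undoes the moves past b^n. What is left is
    n (x) alpha(f), and the coequalizer relation turns it into a coaction of the
    value of psi, that is, of its arguments. *)
Lemma PhiC_cyc n (t : diag X Y n) : t \in cc_mem (diag X Y) n ->
  PhiC (cyc (diag X Y) t) = cyc Z (PhiC t).
Proof.
move: t; apply: diag_ext => [||psi phi mpsi mphi].
- exact: (comp_lin (@PhiC_linear _) (@linearP _ _ _ _ _)).
- exact: (comp_lin (@linearP _ _ _ _ _) (@PhiC_linear _)).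
rewrite /= tmap_pure; apply: mult_eqP => rs; case/lastP: rs => // rs r.
rewrite size_rcons => -[e].
rewrite cyc_fn // [RHS](mkhomE (cons_lin (PhiC (psi \ox phi : diag X Y n) : mult n.+1 R L) e)).
rewrite !PhiC_pure ?size_rcons /= ?e //.
move: r; apply: lin_tens_ext => [||a b].
- have -> : (fun r : R => Theta (rcons rs r) (pairing (cyc X psi) (cyc Y phi))) =
     (fun r => Theta (rs ++ [:: r]) (pairing (cyc X psi) (cyc Y phi))).
    by apply/funext => r; rewrite cats1.
  by apply: (Theta_mlin (pairing_ml2 _ _)); rewrite /= e addn1.
- exact: (mlin_head (Theta_mlin (pairing_ml2 psi phi)) e).
have /HlinearP cphi : (cyc Y phi : mult n.+1 A M) \in @Hlinear_pred _ _ _ _ mA _ sM n.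
  exact: (cyc_mem (HlinC_laws mA sM)).
have tl := tsum_map _ _ (to_coeq_bil.1 _).
pose G c bs as_ := to_coeq sN sM ((psi : mult n.+1 B N) (fn _ (c :: bs)))
   ((cyc Y phi : mult n.+1 A M) (fn _ as_)).
rewrite (Theta_last (G := G) _ _ e).
- rewrite [RHS]/=; apply: (eq_Theta e) => s t es et.
  rewrite (step_pure mA cB a b (pairing_ml2 psi phi) es et) /pstep.
  rewrite /G [X in to_coeq _ _ _ X](lin_cyc_fn mA sM phi a et) to_coeq_alpha.
  have lphi : linear (fun z => (phi : mult n.+1 A M) (fn _ (act (Sv z) a :: t))) by lin.
  rewrite (tsum_colinear mpsi) /= ?es //; last first.
    split=> [n'|p]; last exact: to_coeq_bil.1.
    exact: (comp_lin (to_coeq_bil.2 _) (@hom_linear _ _ _ _)).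
  apply: eq_tsum => u b'; apply: eq_coactL => h s' _.
  by rewrite mkhomE.
- move=> bs as_ c eb ea; rewrite /pairing [X in to_coeq _ _ X _](colin_cyc_fn cB sN psi c eb) tl.
  apply: eq_tsum => u c'; rewrite to_coeq_act -cphi //.
  exact: (actL_map _ _ _ _ (to_coeq_bil.2 _)).
- exact: pairing_ml2.
- by move=> bs as_ eb ea; apply: (comp_lin (to_coeq_bil.1 _)); apply: cons_lin.
- move=> c as_ ea; apply: (mlin_map (to_coeq_bil.1 _)).
  exact: (mlin_cons _ (mult_mlin (psi : mult n.+1 B N))).
- move=> c bs eb; apply: (mlin_map (to_coeq_bil.2 _)); exact: mult_mlin.
Qed.
End PhiMap.

(** * The extended Alexander-Whitney map on products of cochains *)

Section Families.
Variable K : fieldType.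

Lemma fam_sumE (I : Type) (V : I -> lmodType K) J (r : seq J) (F : J -> fam V) i :
  (\sum_(j <- r) F j) i = \sum_(j <- r) F j i.
Proof. by elim/big_rec2: _ => // j x y _ <-. Qed.

Lemma eq_totd (X : cocyclicData K) n (z z' : fam X) :
  (forall k, (k <= n.+1)%N -> z k = z' k) -> totd z n = totd z' n.
Proof. by move=> e; rewrite /totd e //; case: n e => // n e; rewrite e //; lia. Qed.

Lemma lin_add (V W : lmodType K) (f g : V -> W) :
  linear f -> linear g -> linear (fun x => f x + g x).
Proof. by move=> lf lg a x y; rewrite lf lg scalerDr addrACA. Qed.

Lemma sum_ord_delta (V : zmodType) N (k : nat) (x : V) :
  \sum_(m < N) (if k == m :> nat then x else 0) = if (k < N)%N then x else 0.
Proof.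
case: ltnP => h.
  rewrite (bigD1 (Ordinal h)) // big1 => [|m /eqP nm]; first by rewrite eqxx; exact: addr0.
  by case: eqP => // e; case: nm; apply: val_inj; rewrite /= e.
by rewrite big1 // => m _; case: eqP => // e; move: (ltn_ord m); rewrite -e ltnNge h.
Qed.
End Families.

Section TotalChain.
Variables (K : fieldType) (X Y : cocyclicData K).
Variables (lX : cocyclic_laws X) (lY : cocyclic_laws Y).

Lemma Tot_d_linear : linear (@Tot_d K X Y).
Proof.
suff l r s : linear (fun u : bifam X Y => Tot_d u r s).
  move=> a u v; apply: functional_extensionality_dep => r.
  by apply: functional_extensionality_dep => s; apply: l.
apply: lin_add; [apply: lin_add; [apply: lin_add|]|].
- case: s => [|s] b x y; first by rewrite scaler0 addr0.
  exact: (@hochb_linear _ (hor X Y r)).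
- apply: lin_scale; case: r => [|r] b x y; first by rewrite scaler0 addr0.
  exact: (@hochb_linear _ (ver X Y s)).
- by move=> b x y; apply: (@connesB_linear _ (hor X Y r)).
- by apply: lin_scale => b x y; apply: (@connesB_linear _ (ver X Y s)).
Qed.

Lemma eq_Tot_d (u v : bifam X Y) r s :
  (forall r' s', (r' + s' <= (r + s).+1)%N -> u r' s' = v r' s') ->
  Tot_d u r s = Tot_d v r s.
Proof.
move=> e; rewrite /Tot_d !(e r s.+1) ?(e r.+1 s); try lia.
congr (_ + _ + _ + _).
  by case: s e => // s e; rewrite e //; lia.
by case: r e => // r e; rewrite e //; lia.
Qed.

Lemma Tot_comp_linear n : linear (@Tot_comp K X Y n).
Proof.
move=> a u v; apply: functional_extensionality_dep => r.
apply: functional_extensionality_dep => s.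
by rewrite !fam_DE !fam_ZE /Tot_comp; case: eqP => // _; rewrite scaler0 addr0.
Qed.

Lemma Tot_comp_sum N (u : bifam X Y) r s : (r + s < N)%N ->
  (\sum_(m < N) Tot_comp m u : bifam X Y) r s = u r s.
Proof.
move=> h; rewrite !fam_sumE /Tot_comp.
by rewrite sum_ord_delta h.
Qed.

Variable AW' : forall n : nat, bifam X Y -> diag X Y n.
Hypothesis hAW : AW_extension AW'.

Lemma AW'_0 n : AW' n 0 = 0.
Proof.
have := AW'_linear hAW 1 (Tot0 _ _ n.+2) (Tot0 _ _ n.+2).
by rewrite scaler0 addr0 scale1r => /(congr1 (fun x => x - AW' n 0)); rewrite subrr addrK.
Qed.

Lemma eq_AWbar n (u v : bifam X Y) :
  (forall r s, (r + s)%N = n \/ (r + s)%N = n.+2 -> u r s = v r s) ->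
  AWbar AW' u n = AWbar AW' v n.
Proof.
move=> e; rewrite /AWbar (eq_AW (v := v)) => [|r s h]; last by apply: e; left.
congr (_ + AW' n _); apply: functional_extensionality_dep => r.
apply: functional_extensionality_dep => s; rewrite /Tot_comp.
by case: eqP => // h; apply: e; right.
Qed.

Lemma AWbar_lin n a (u v : bifam X Y) :
  Tot n.+2 (Tot_comp n.+2 u) -> Tot n.+2 (Tot_comp n.+2 v) ->
  AWbar AW' (a *: u + v) n = a *: AWbar AW' u n + AWbar AW' v n.
Proof.
move=> Tu Tv; rewrite /AWbar AW_linear Tot_comp_linear (AW'_linear hAW) //.
by rewrite scalerDr addrACA.
Qed.

Lemma AWbar_sum n N (F : 'I_N -> bifam X Y) :
  (forall m, Tot n.+2 (Tot_comp n.+2 (F m))) ->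
  \sum_m AWbar AW' (F m) n = AWbar AW' (\sum_m F m) n.
Proof.
move=> TF.
suff [_ ->] : Tot n.+2 (Tot_comp n.+2 (\sum_m F m)) /\
  AWbar AW' (\sum_m F m) n = \sum_m AWbar AW' (F m) n by [].
elim/big_rec2: _ => [|m x y _ [Ty ey]].
  have c0 k : Tot_comp k (0 : bifam X Y) = 0.
    exact: (linear0_of (@Tot_comp_linear _)).
  by rewrite /AWbar c0 AW'_0 (linear0_of (@AW_linear _ _ _ _)) addr0; split=> //; apply: Tot0.
have -> : F m + y = 1 *: F m + y by rewrite scale1r.
split; first by rewrite Tot_comp_linear; apply: Tot_lin.
by rewrite AWbar_lin // ey scale1r.
Qed.

(** The chain property of the extended map, stated for homogeneous families,
    summed over the homogeneous components. *)
Lemma AWbar_chain (u : bifam X Y) : pure_fam u ->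
  totd (AWbar AW' u) = AWbar AW' (Tot_d u).
Proof.
move=> pu; apply: functional_extensionality_dep => n.
(* both sides in degree n only see components of u of degree at most n + 3 *)
pose w m := Tot_comp m u.
have pw m : pure_fam (w m) by apply: pure_fam_comp.
have S r s : (r + s < n.+4)%N -> (\sum_(m < n.+4) w m : bifam X Y) r s = u r s.
  exact: Tot_comp_sum.
have Tw k m : Tot k (Tot_comp k (w m)).
  by apply: Tot_compP => r s; apply: pure_fam_binorm.
have Tdw k m : Tot k (Tot_comp k (Tot_d (w m))).
  by apply: Tot_compP => r s; apply: Tot_d_binorm.
have Twm m : Tot m (w m) by apply: Tot_compP => r s; apply: pure_fam_binorm.
transitivity (totd (\sum_(m < n.+4) AWbar AW' (w m)) n).
  apply: eq_totd => k hk; rewrite fam_sumE AWbar_sum //.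
  by apply: eq_AWbar => r s h; rewrite S //; lia.
rewrite (linear_sum_of _ _ (@totd_linear _ _)) fam_sumE.
under eq_bigr => m _ do rewrite (AW'_chain hAW (Twm m)).
rewrite AWbar_sum // -(linear_sum_of _ _ Tot_d_linear).
apply: eq_AWbar => r s h; apply: eq_Tot_d => r' s' h'; rewrite S //; lia.
Qed.

Section Product.
Variables (y : fam X) (z : fam Y).

Lemma tens_pure_fam : (forall k, normalized X (y k)) -> (forall k, normalized Y (z k)) ->
  pure_fam (tens_fam y z).
Proof. by move=> ny nz r s; exists (y r), (z s). Qed.

(** The sign (-1)^s of the total differential only depends on the parity of the
    degree of the second factor. *)
Lemma Tot_d_tens q : (forall s, odd s != odd q -> z s = 0) ->
  Tot_d (tens_fam y z) = (-1) ^+ q *: tens_fam (totd y) z + tens_fam y (totd z).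
Proof.
move=> zq; apply: functional_extensionality_dep => r.
apply: functional_extensionality_dep => s; rewrite !fam_DE !fam_ZE /Tot_d /tens_fam.
rewrite connesB_hor connesB_ver -addrA addrACA -scalerDr [RHS]addrC; congr (_ + _).
  rewrite /totd (linearD_of _ _ (pure_linr _)); congr (_ + _).
  by case: s => [|s]; [rewrite (linear0_of (pure_linr _))|rewrite hochb_hor].
have -> : (if r is r'.+1 return tens (X r) (Y s) then
    hochb (ver X Y s) (y r' \ox z s) else 0) + connesB X (y r.+1) \ox z s = totd y r \ox z s.
  rewrite /totd (linearD_of _ _ (pure_linl _)); congr (_ + _).
  by case: r => [|r]; [rewrite (linear0_of (pure_linl _))|rewrite hochb_ver].
case: (eqVneq (odd s) (odd q)) => h; first by rewrite -signr_odd h signr_odd.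
by rewrite zq // (linear0_of (pure_linr _)) !scaler0.
Qed.
End Product.

Lemma tens_fam_bil : bilinear_map (@tens_fam K X Y).
Proof.
split=> [z|y] a u v; apply: functional_extensionality_dep => r;
  apply: functional_extensionality_dep => s.
  exact: (@pure_linl _ _ _ (z s) a (u r) (v r)).
exact: (@pure_linr _ _ _ (y r) a (u s) (v s)).
Qed.

Lemma AWbar_normalized n u : pure_fam u -> normalized (diag X Y) (AWbar AW' u n).
Proof.
move=> pu; rewrite /AWbar -[AW u n]scale1r; apply: normalized_lin.
  exact: AW_normalized.
apply: (AW'_normalized hAW); apply: Tot_compP => r s.
exact: pure_fam_binorm.
Qed.
End TotalChain.

(** * The cup product *)

Section CochainMap.
Variables (K : fieldType) (H : ualgType K) (hH : hopf H) (A B : ualgType K).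
Variables (mA : moduleAlgebra hH A) (cB : comoduleAlgebra hH B).
Variables (N M : lmodType K) (sN : saydModule hH N) (sM : saydContramodule hH M).
Local Notation X := (HcolinC cB sN).
Local Notation Y := (HlinC mA sM).
Local Notation Z := (ordC (crossed mA cB) (coeq sN sM)).
Local Notation D := (diag X Y).
Let lX : cocyclic_laws X := HcolinC_laws cB sN.
Let lY : cocyclic_laws Y := HlinC_laws mA sM.

Lemma diag_coface_mem n i (t : D n) : t \in cc_mem D n -> coface D i t \in cc_mem D n.+1.
Proof. by apply: tmap_mem => x mx; apply: coface_mem. Qed.

Lemma diag_codegen_mem n j (t : D n.+1) : t \in cc_mem D n.+1 -> codegen D j t \in cc_mem D n.
Proof. by apply: tmap_mem => x mx; apply: codegen_mem. Qed.

Lemma diag_cyc_mem n (t : D n) : t \in cc_mem D n -> cyc D t \in cc_mem D n.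
Proof. by apply: tmap_mem => x mx; apply: cyc_mem. Qed.

Lemma PhiC_coface n (i : 'I_n.+2) (t : D n) : t \in cc_mem D n ->
  PhiC (coface D i t) = coface Z i (PhiC t).
Proof.
move=> mt; case: (leqP i n) => h; first exact: PhiC_inner.
have -> : coface D i t = cyc D (coface D ord0 t).
  move: t mt; apply: diag_ext => [||psi phi _ _]; first exact: linearP.
    exact: (comp_lin (@linearP _ _ _ _ _) (@linearP _ _ _ _ _)).
  rewrite /= !tmap_pure.
  by congr (_ \ox _); apply: coface_last.
rewrite PhiC_cyc; last exact: diag_coface_mem.
rewrite PhiC_inner //; symmetry; exact: coface_last.
Qed.

Lemma PhiC_hochb n (t : D n) : t \in cc_mem D n -> PhiC (hochb D t) = hochb Z (PhiC t).
Proof.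
move=> mt; rewrite /hochb (linear_sum_of _ _ (@PhiC_linear _ _ _ _ _ _ _ _ _ _ _ _)).
apply: eq_bigr => i _; rewrite (linearZ_of _ _ (@PhiC_linear _ _ _ _ _ _ _ _ _ _ _ _)).
by rewrite PhiC_coface.
Qed.

Lemma PhiC_connesB n (t : D n.+1) : t \in cc_mem D n.+1 ->
  PhiC (connesB D t) = connesB Z (PhiC t).
Proof.
move=> mt; rewrite /connesB (linear_sum_of _ _ (@PhiC_linear _ _ _ _ _ _ _ _ _ _ _ _)).
apply: eq_bigr => i _; rewrite (linearZ_of _ _ (@PhiC_linear _ _ _ _ _ _ _ _ _ _ _ _)).
congr (_ *: _).
have m0 := diag_codegen_mem ord_max (diag_cyc_mem mt).
have mi k : iter k (cyc D) (codegen D ord_max (cyc D t)) \in cc_mem D n.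
  by elim: k => // k IH; apply: diag_cyc_mem.
rewrite -PhiC_cyc // -PhiC_codegen; last exact: diag_cyc_mem.
by elim: (i : nat) => // k IH; rewrite !iterS PhiC_cyc // IH.
Qed.

Lemma PhiC_totd (z : fam D) : (forall n, z n \in cc_mem D n) ->
  totd (fun n => PhiC (z n) : Z n) = (fun n => PhiC (totd z n)).
Proof.
move=> mz; apply: functional_extensionality_dep => n.
rewrite /totd (linearD_of _ _ (@PhiC_linear _ _ _ _ _ _ _ _ _ _ _ _)) PhiC_connesB //.
congr (_ + _); case: n => [|n]; last by rewrite PhiC_hochb.
by rewrite (linear0_of (@PhiC_linear _ _ _ _ _ _ _ _ _ _ _ _)).
Qed.

Lemma PhiC_normalized n (t : D n) : normalized D t -> normalized Z (PhiC t).
Proof.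
case: n t => // n t [mt kt]; split=> // j.
by rewrite -PhiC_codegen // kt (linear0_of (@PhiC_linear _ _ _ _ _ _ _ _ _ _ _ _)).
Qed.
End CochainMap.

Section Cohomology.
Variables (K : fieldType) (X : cocyclicData K).

Lemma class_linear n : linear (@class K X n).
Proof. exact: cls_is_linear. Qed.

Lemma coboundary_class n (z : cocycle X n) : coboundary n (z : fam X) -> class z = 0.
Proof.
by move=> cz; rewrite -(linear0_of (@class_linear n)); apply/cls_eq; rewrite subr0; apply: span_gen.
Qed.

Lemma totd_coboundary n m (y : fam X) : n = m.+1 -> cochain m y -> coboundary n (totd y).
Proof. by move=> ->; exists y. Qed.

Lemma coboundary0 n : coboundary n (0 : fam X).
Proof.
case: n => // n; exists 0; last by rewrite (linear0_of (@totd_linear _ _)).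
by split=> // k; apply: normalized0.
Qed.

Lemma cochainZ n a (z : fam X) : cochain n z -> cochain n (a *: z).
Proof.
move=> [nz sz]; split=> k; first by apply: normalizedZ.
by move=> /sz e; rewrite fam_ZE e scaler0.
Qed.

Lemma cocycleP n (z : cocycle X n) : cochain n (z : fam X) /\ totd (z : fam X) = 0.
Proof. by case: z => z /= /asboolP. Qed.

Lemma class_factor n (V : lmodType K) (f : cocycle X n -> V) : linear f ->
  (forall z : cocycle X n, coboundary n (z : fam X) -> f z = 0) ->
  forall z z', class z = class z' -> f z = f z'.
Proof.
move=> lf f0 z z' /cls_eq /asboolP s; apply/eqP; rewrite -subr_eq0 -(linearB_of _ _ lf).
apply/eqP; elim: s => [|a x y Px _ IH]; first exact: linear0_of.
by rewrite lf IH f0 // scaler0 addr0.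
Qed.

Lemma cochain_parity q (z : fam X) s : cochain q z -> odd s != odd q -> z s = 0.
Proof. by move=> [_ hz] h; apply: hz; rewrite negb_and h orbT. Qed.
End Cohomology.

Section Cup.
Variables (K : fieldType) (H : ualgType K) (hH : hopf H) (A B : ualgType K).
Variables (mA : moduleAlgebra hH A) (cB : comoduleAlgebra hH B).
Variables (N M : lmodType K) (sN : saydModule hH N) (sM : saydContramodule hH M).
Local Notation X := (HcolinC cB sN).
Local Notation Y := (HlinC mA sM).
Local Notation Z := (ordC (crossed mA cB) (coeq sN sM)).
Local Notation D := (diag X Y).
Let lX : cocyclic_laws X := HcolinC_laws cB sN.
Let lY : cocyclic_laws Y := HlinC_laws mA sM.
Variable AW' : forall n : nat, bifam X Y -> diag X Y n.
Hypothesis hAW : AW_extension AW'.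

Definition cup_cochain (y : fam X) (z : fam Y) : fam Z :=
  fun n => PhiC (AWbar AW' (tens_fam y z) n).

Lemma cup_chain q (y : fam X) (z : fam Y) : (forall k, normalized X (y k)) -> cochain q z ->
  totd (cup_cochain y z) =
  (fun n => PhiC (AWbar AW' ((-1) ^+ q *: tens_fam (totd y) z + tens_fam y (totd z)) n)).
Proof.
move=> ny cz; have p := tens_pure_fam ny cz.1.
rewrite /cup_cochain PhiC_totd => [|n]; last first.
  by apply: normalized_mem; apply: AWbar_normalized.
apply: functional_extensionality_dep => n.
by rewrite (AWbar_chain lX lY hAW p) (@Tot_d_tens _ _ _ y z q) // => s; apply: cochain_parity.
Qed.

Lemma totd_normalized n (C : cocyclicData K) (lC : cocyclic_laws C) (y : fam C) :
  (forall k, normalized C (y k)) -> normalized C (totd y n).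
Proof.
move=> ny; rewrite /totd -[X in X + _]scale1r; apply: normalized_lin.
  by case: n => [|n]; [apply: normalized0|apply: hochb_normalized].
exact: connesB_normalized.
Qed.

Lemma Tot_comp_tens n (y : fam X) (z : fam Y) : (forall k, normalized X (y k)) -> (forall k, normalized Y (z k)) ->
  Tot n (Tot_comp n (tens_fam y z)).
Proof.
move=> ny nz; apply: Tot_compP => r s.
by apply: pure_fam_binorm; apply: tens_pure_fam.
Qed.

Lemma cup_linl a (y y' : fam X) (z : fam Y) : (forall k, normalized X (y k)) -> (forall k, normalized X (y' k)) ->
  (forall k, normalized Y (z k)) ->
  cup_cochain (a *: y + y') z = a *: cup_cochain y z + cup_cochain y' z.
Proof.
move=> ny ny' nz; apply: functional_extensionality_dep => n.
rewrite fam_DE fam_ZE /cup_cochain ((tens_fam_bil _ _).1 z) AWbar_lin //.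
- exact: PhiC_linear.
- exact: Tot_comp_tens.
- exact: Tot_comp_tens.
Qed.

Lemma cup_linr a (y : fam X) (z z' : fam Y) : (forall k, normalized X (y k)) -> (forall k, normalized Y (z k)) ->
  (forall k, normalized Y (z' k)) ->
  cup_cochain y (a *: z + z') = a *: cup_cochain y z + cup_cochain y z'.
Proof.
move=> ny nz nz'; apply: functional_extensionality_dep => n.
rewrite fam_DE fam_ZE /cup_cochain ((tens_fam_bil _ _).2 y) AWbar_lin //.
- exact: PhiC_linear.
- exact: Tot_comp_tens.
- exact: Tot_comp_tens.
Qed.

Lemma cup_cochainP p q (y : fam X) (z : fam Y) : cochain p y -> cochain q z -> cochain (p + q) (cup_cochain y z).
Proof.
move=> [ny sy] [nz sz]; split=> k.
  by apply: PhiC_normalized; apply: AWbar_normalized => //; apply: tens_pure_fam.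
move=> hk; rewrite /cup_cochain.
have -> : AWbar AW' (tens_fam y z) k = AWbar AW' 0 k.
  apply: eq_AWbar => r s h; rewrite /tens_fam.
  case: (boolP ((r <= p)%N && (odd r == odd p))) => hr; last first.
    by rewrite sy // (linear0_of (pure_linl _)).
  case: (boolP ((s <= q)%N && (odd s == odd q))) => hs; last first.
    by rewrite sz // (linear0_of (pure_linr _)).
  case/negP: hk; case/andP: hr => r1 /eqP r2; case/andP: hs => s1 /eqP s2.
  rewrite oddD -r2 -s2 -oddD; case: h => e; first by rewrite e eqxx andbT; lia.
  by rewrite e /= negbK eqxx andbT; lia.
rewrite /AWbar (linear0_of (@Tot_comp_linear _ _ _ _)) (AW'_0 hAW).
rewrite (linear0_of (@AW_linear _ _ _ _)) addr0.
exact: (linear0_of (@PhiC_linear _ _ _ _ _ _ _ _ _ _ _ _)).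
Qed.

Fact cup_cocycle_mem p q (psi : cocycle X p) (phi : cocycle Y q) :
  cup_cochain psi phi \in @cocycle_pred K Z (p + q).
Proof.
have [cpsi dpsi] := cocycleP psi; have [cphi dphi] := cocycleP phi.
apply/asboolP; split; first exact: cup_cochainP.
rewrite (cup_chain cpsi.1 cphi) dpsi dphi.
apply: functional_extensionality_dep => n.
rewrite (linear0_of ((tens_fam_bil _ _).1 _)) (linear0_of ((tens_fam_bil _ _).2 _)).
rewrite scaler0 addr0 /AWbar (linear0_of (@Tot_comp_linear _ _ _ _)) (AW'_0 hAW).
rewrite (linear0_of (@AW_linear _ _ _ _)) addr0.
exact: (linear0_of (@PhiC_linear _ _ _ _ _ _ _ _ _ _ _ _)).
Qed.

Definition cup_cocycle p q (psi : cocycle X p) (phi : cocycle Y q) : cocycle Z (p + q) :=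
  Subm (cup_cocycle_mem psi phi).

Lemma cup_cocycle_bil p q : bilinear_map (@cup_cocycle p q).
Proof.
by split=> [phi|psi] a u v; apply: val_inj; [apply: cup_linl|apply: cup_linr] => k;
  (exact: (cocycleP _).1.1).
Qed.

Lemma cup_cochain0l (z : fam Y) : cup_cochain 0 z = 0.
Proof.
apply: functional_extensionality_dep => n; rewrite /cup_cochain.
rewrite (linear0_of ((tens_fam_bil _ _).1 _)) /AWbar (linear0_of (@Tot_comp_linear _ _ _ _)).
rewrite (AW'_0 hAW) (linear0_of (@AW_linear _ _ _ _)) addr0.
exact: (linear0_of (@PhiC_linear _ _ _ _ _ _ _ _ _ _ _ _)).
Qed.

Lemma cup_cochain0r (y : fam X) : cup_cochain y 0 = 0.
Proof.
apply: functional_extensionality_dep => n; rewrite /cup_cochain.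
rewrite (linear0_of ((tens_fam_bil _ _).2 _)) /AWbar (linear0_of (@Tot_comp_linear _ _ _ _)).
rewrite (AW'_0 hAW) (linear0_of (@AW_linear _ _ _ _)) addr0.
exact: (linear0_of (@PhiC_linear _ _ _ _ _ _ _ _ _ _ _ _)).
Qed.

(** Phi commutes with b + B and the extended Alexander-Whitney map is a chain map,
    so this is the Leibniz rule of the total differential. *)
Lemma cup_Leibniz q (y : fam X) (z : fam Y) : (forall k, normalized X (y k)) -> cochain q z ->
  totd (cup_cochain y z) =
  (-1) ^+ q *: cup_cochain (totd y) z + cup_cochain y (totd z).
Proof.
move=> ny cz; rewrite (cup_chain ny cz); apply: functional_extensionality_dep => n.
rewrite fam_DE fam_ZE AWbar_lin //.
- exact: PhiC_linear.
- by apply: Tot_comp_tens => k; [apply: totd_normalized|apply: cz.1].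
- by apply: Tot_comp_tens => k; [apply: ny|apply: totd_normalized => //; apply: cz.1].
Qed.

Lemma cup_coboundaryl p q (psi : cocycle X p) (phi : cocycle Y q) :
  coboundary p (psi : fam X) -> class (cup_cocycle psi phi) = 0.
Proof.
have [cphi dphi] := cocycleP phi; move=> cpsi; apply: coboundary_class.
rewrite [X in coboundary _ X](_ : _ = cup_cochain psi phi) //.
case: p psi cpsi => [|m] psi.
  by move=> psi0; rewrite (psi0 : (psi : fam X) = 0) cup_cochain0l; apply: coboundary0.
case=> y cy ->.
have -> : cup_cochain (totd y) phi = totd ((-1) ^+ q *: cup_cochain y phi).
  rewrite (linearZ_of _ _ (@totd_linear _ _)) (cup_Leibniz cy.1 cphi) dphi cup_cochain0r addr0.
  by rewrite scalerA -expr2 sqrr_sign scale1r.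
by apply: (totd_coboundary (m := m + q)) => //; apply: cochainZ; apply: cup_cochainP.
Qed.

Lemma cup_coboundaryr p q (psi : cocycle X p) (phi : cocycle Y q) :
  coboundary q (phi : fam Y) -> class (cup_cocycle psi phi) = 0.
Proof.
have [cpsi dpsi] := cocycleP psi; move=> cphi; apply: coboundary_class.
rewrite [X in coboundary _ X](_ : _ = cup_cochain psi phi) //.
case: q phi cphi => [|m] phi.
  by move=> phi0; rewrite (phi0 : (phi : fam Y) = 0) cup_cochain0r; apply: coboundary0.
case=> z cz ->.
have -> : cup_cochain psi (totd z) = totd (cup_cochain psi z).
  by rewrite (cup_Leibniz cpsi.1 cz) dpsi cup_cochain0l scaler0 add0r.
by apply: (totd_coboundary (m := p + m)); [rewrite addnS|apply: cup_cochainP].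
Qed.

Lemma class_repr (C : cocyclicData K) n (u : HC C n) : exists z : cocycle C n, class z = u.
Proof. by exists (repr u); apply: clsK. Qed.

Definition cup_class p q (u : HC X p) (v : HC Y q) : HC Z (p + q) :=
  class (cup_cocycle (projT1 (cid (class_repr u))) (projT1 (cid (class_repr v)))).

Lemma cup_classE p q (psi : cocycle X p) (phi : cocycle Y q) :
  cup_class (class psi) (class phi) = class (cup_cocycle psi phi).
Proof.
rewrite /cup_class; case: cid => psi' /= e1; case: cid => phi' /= e2.
have l1 phi0 : linear (fun psi0 => class (@cup_cocycle p q psi0 phi0)).
  exact: (comp_lin (@class_linear _ _ _) ((cup_cocycle_bil _ _).1 phi0)).
have l2 psi0 : linear (fun phi0 => class (@cup_cocycle p q psi0 phi0)).
  exact: (comp_lin (@class_linear _ _ _) ((cup_cocycle_bil _ _).2 psi0)).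
rewrite (class_factor (l1 phi') _ e1) => [|c]; last exact: cup_coboundaryl.
by rewrite (class_factor (l2 psi) _ e2) // => c; apply: cup_coboundaryr.
Qed.

Lemma cup_class_bil p q : bilinear_map (@cup_class p q).
Proof.
split=> [v|u] a x y; have [x' <-] := class_repr x; have [y' <-] := class_repr y.
  have [v' <-] := class_repr v; rewrite -(@class_linear _ _ _ a x' y') !cup_classE.
  by rewrite ((cup_cocycle_bil _ _).1 v') (@class_linear _ _ _ a).
have [u' <-] := class_repr u; rewrite -(@class_linear _ _ _ a x' y') !cup_classE.
by rewrite ((cup_cocycle_bil _ _).2 u') (@class_linear _ _ _ a).
Qed.
End Cup.

Theorem theorem4p3 (R : realType) (H A B : ualgType R[i]) (hH : hopf H)
  (mA : moduleAlgebra hH A) (cB : comoduleAlgebra hH B) (N M : lmodType R[i])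
  (sN : saydModule hH N) (sM : saydContramodule hH M)
  (AW' : forall n : nat,
     bifam (HcolinC cB sN) (HlinC mA sM) -> diag (HcolinC cB sN) (HlinC mA sM) n)
  (hAW' : AW_extension AW') (p q : nat) :
  exists cup : {linear tens (HC (HcolinC cB sN) p) (HC (HlinC mA sM) q) ->
                  HC (ordC (crossed mA cB) (coeq sN sM)) (p + q)%N},
    forall (psi : cocycle (HcolinC cB sN) p) (phi : cocycle (HlinC mA sM) q),
      exists2 z : cocycle (ordC (crossed mA cB) (coeq sN sM)) (p + q)%N,
        (forall (n : nat) (r : 'I_n.+1 -> crossed mA cB),
           (cocycle_val z n : mult n.+1 (crossed mA cB) (coeq sN sM)) r =
           Phi sN sM (AWbar AW' (tens_fam psi phi) n) r) &
        cup (class psi \ox class phi) = class z.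
Proof.
have [cup cupE] := linear_is (tsum_lin (cup_class_bil hAW' p q)).
exists cup => psi phi; exists (cup_cocycle hAW' psi phi) => //.
by rewrite cupE tsum_pure ?cup_classE //; apply: cup_class_bil.
Qed.
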